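(* Let $\eta$ be an $\mathbb{N}$-valued random variable with $\mathbf{P}[\eta\ge1]>0$ and $\mathbf{E}\,\eta<\infty$. Then \[ \lim_{d\to\infty}p_c(\mathbb{Z}^d,\eta)=\frac{1}{1+\mathbf{E}\,\eta}. \]
   Context: Here $\mathbb{N}=\{0,1,2,\dots\}$, and $\mathbb{Z}^d$ denotes the graph with vertex set $\mathbb{Z}^d$ and edges between points at $\ell^1$-distance $1$, with root $\mathbf{0}$ the origin. Frog model $\mathrm{FM}(\mathcal{G},p,\eta)$. Let $\mathcal{G}$ be an infinite connected undirected graph all of whose sites (vertices) have finite degree, with a fixed site $\mathbf{0}$ called the root; let $p\in[0,1]$ and let $\eta$ be a random variable with values in $\mathbb{N}$. Let $\{\eta(x)\}_{x}$, $\{(S^x_n(i))_{n\in\mathbb{N}}\}_{x,\,i\ge1}$, $\{\Xi^x_p(i)\}_{x,\,i\ge 1}$ be independent families of independent random variables, where $\eta(x)$ has the law of $\eta$, $(S^x_n(i))_n$ is a discrete-time simple random walk on $\mathcal{G}$ started from $x$, and $\mathbf{P}[\Xi^x_p(i)=k]=(1-p)p^{k-1}$, $k=1,2,\dots$ (for $p=1$, $\Xi^x_p(i)=\infty$, no death). Site $x$ initially contains $\eta(x)$ particles; at time $0$ all particles are sleeping except those at the root, which are active. If the particles of site $x$ are activated at time $T(x)$, the $i$-th of them ($1\le i\le\eta(x)$) is active and located at $S^x_n(i)$ at time $T(x)+n$ for $0\le n<\Xi^x_p(i)$, and then disappears. When an active particle visits a site, all sleeping particles there become active. Formally, $t(x,y)=\min_{1\le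 i\le\eta(x)}\min\{n<\Xi^x_p(i):S^x_n(i)=y\}$ for $x\ne y$ ($\infty$ if there is no such $n$), and $T(x)=\inf\{t(x_0,x_1)+\dots+t(x_{m-1},x_m)\}$ over all finite sequences $\mathbf{0}=x_0,x_1,\dots,x_m=x$, with $T(\mathbf{0})=0$; $T(x)=\infty$ means that $x$ is never visited by active particles. The model survives if at every time there is at least one active particle; otherwise it dies out. The critical parameter is $p_c(\mathcal{G},\eta)=\inf\{p\in[0,1]:\mathbf{P}[\mathrm{FM}(\mathcal{G},p,\eta)\text{ survives}]>0\}$. *)

(* Defs.v *)
From HB Require Import structures.
From mathcomp Require Import all_boot all_order all_algebra.
From mathcomp Require Import finmap zify.
From mathcomp Require Import all_classical all_reals all_analysis.

Set Implicit Arguments.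
Unset Strict Implicit.
Unset Printing Implicit Defensive.

Import Order.TTheory GRing.Theory Num.Theory.
Import numFieldNormedType.Exports.

Local Open Scope classical_set_scope.
Local Open Scope ring_scope.

Record rooted_graph := RootedGraph {
  vertex :> countType;
  adj : rel vertex;
  root : vertex;
  adj_irr : irreflexive adj;
  adj_sym : symmetric adj;
  locally_finite : forall x, finite_set [set y | adj x y]
}.

Definition degree (G : rooted_graph) (x : G) : nat :=
  #|` fset_set [set y | adj x y]|.

Definition Zd_adj (d : nat) (x y : 'rV[int]_d) : bool :=
  \sum_(i < d) `|x ord0 i - y ord0 i| == 1.

Lemma Zd_adj_irr d : irreflexive (@Zd_adj d).
Proof. by move=> x; rewrite /Zd_adj big1// => i _; rewrite subrr normr0. Qed.

Lemma Zd_adj_sym d : symmetric (@Zd_adj d).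
Proof.
by move=> x y; rewrite /Zd_adj; under eq_bigr do rewrite distrC.
Qed.

Lemma Zd_locally_finite d (x : 'rV[int]_d) : finite_set [set y | Zd_adj x y].
Proof.
pose f (g : {ffun 'I_d -> 'I_3}) : 'rV[int]_d :=
  \row_i (x ord0 i + (g i)%:Z - 1).
apply: (@sub_finite_set _ _ (f @` setT)); last first.
  by apply: finite_image; exact: finite_finset.
move=> y /eqP xy; exists [ffun i => inord (absz (y ord0 i - x ord0 i + 1))] => //.
apply/rowP => i; rewrite mxE ffunE.
have := xy; rewrite (bigD1 i)//= => xyi.
have yx1 : `|x ord0 i - y ord0 i| <= 1.
  by rewrite -xyi lerDl sumr_ge0.
move: yx1; rewrite ler_norml => /andP[h1 h2].
have h3 : 0 <= y ord0 i - x ord0 i + 1 by lia.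
rewrite inordK; last by rewrite -ltz_nat gez0_abs//; lia.
by rewrite gez0_abs// addrA subrKC addrK.
Qed.

Definition Zd (d : nat) : rooted_graph :=
  @RootedGraph 'rV[int]_d (@Zd_adj d) 0
    (@Zd_adj_irr d) (@Zd_adj_sym d) (@Zd_locally_finite d).

Section discrete_sigma_algebras.
Context {Om : Type}.

(* The sigma-algebra generated by X, for X with values in a countable set,
   all of whose subsets are taken to be measurable. *)
Definition sigma_discrete (E : countType) (X : Om -> E) : set (set Om) :=
  [set X @^-1` B | B in [set: set E]].

Definition sigma_process (E : countType) (X : nat -> Om -> E) :
    set (set Om) :=
  <<s \bigcup_n sigma_discrete (X n) >>.

End discrete_sigma_algebras.

Definition mutually_independent d (Om : measurableType d) (R : realType)
    (P : probability Om R) (J : choiceType) (F : J -> set (set Om)) : Prop :=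
  forall (s : {fset J}) (A : J -> set Om),
    (forall j, j \in s -> F j (A j)) ->
    P (\bigcap_(j in [set` s]) A j) = (\prod_(j <- s) P (A j))%E.

(* Particles of a site are indexed from 0: the particles of x are those with
   index i < particles x, and walk x i, lifetime x i are the paper's
   S^x(i+1), Xi^x(i+1).  The lifetime None is infinite. *)
Record frogs (G : rooted_graph) (Om : Type) := Frogs {
  particles : G -> Om -> nat;
  walk : G -> nat -> nat -> Om -> G;
  lifetime : G -> nat -> Om -> option nat
}.

Section laws.
Context d (Om : measurableType d) (R : realType) (P : probability Om R).

Definition simple_random_walk (G : rooted_graph) (x : G)
    (S : nat -> Om -> G) : Prop :=
  forall (n : nat) (v : nat -> G),
    P [set w | forall k, (k <= n)%N -> S k w = v k] =
    ((v 0%N == x)%:R *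
     \prod_(k < n) ((adj (v k) (v k.+1))%:R / (degree (v k))%:R))%:E.

Definition geometric_lifetime (p : R) (L : Om -> option nat) : Prop :=
  (forall k, (1 <= k)%N ->
     P [set w | L w = Some k] = ((1 - p) * p ^+ k.-1)%:E) /\
  (p = 1 -> P [set w | L w = None] = 1%E).

Definition frog_sigma (G : rooted_graph) (F : frogs G Om)
    (j : G + (G * nat) + (G * nat)) : set (set Om) :=
  match j with
  | inl (inl x) => sigma_discrete (particles F x)
  | inl (inr (x, i)) => sigma_process (walk F x i)
  | inr (x, i) => sigma_discrete (lifetime F x i)
  end.

Definition is_FM (G : rooted_graph) (p : R) (eta : probability nat R)
    (F : frogs G Om) : Prop :=
  [/\ forall j, frog_sigma F j `<=` measurable,
      mutually_independent P (frog_sigma F),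
      forall x (B : set nat), P (particles F x @^-1` B) = eta B,
      forall x i, simple_random_walk x (walk F x i) &
      forall x i, geometric_lifetime p (lifetime F x i)].

End laws.

Definition alive_at (n : nat) (L : option nat) : bool :=
  if L is Some k then (n < k)%N else true.

Section dynamics.
Context (R : realType) (G : rooted_graph) (Om : Type) (F : frogs G Om).
Local Open Scope ereal_scope.

(* t(x,y); t(x,x) is not used by the paper, and the consecutive repetitions
   it allows in a route do not change the infimum below. *)
Definition passage_time (w : Om) (x y : G) : \bar R :=
  ereal_inf [set n%:R%:E | n in
    [set n | exists i, [/\ (i < particles F x w)%N,
                           alive_at n (lifetime F x i w) &
                           walk F x i n w = y]]].

Definition activation_time (w : Om) (x : G) : \bar R :=
  ereal_inf [set \sum_(t <- pairmap (passage_time w) (root G) s) t | s in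
    [set s : seq G | last (root G) s = x]].

Definition active_at (w : Om) (n : nat) (x : G) (i : nat) : Prop :=
  (i < particles F x w)%N /\
  exists m : nat, alive_at m (lifetime F x i w) /\
    activation_time w x + m%:R%:E = n%:R%:E.

Definition survives (w : Om) : Prop :=
  forall n, exists x i, active_at w n x i.

End dynamics.

(* The conditions in is_FM determine the law of the family F, hence the
   probability of survival; the realization of FM(G,p,eta) is thus irrelevant. *)
Definition survives_with_positive_probability (R : realType)
    (G : rooted_graph) (p : R) (eta : probability nat R) : Prop :=
  exists (d : measure_display) (Om : measurableType d)
    (P : probability Om R) (F : frogs G Om),
    is_FM P p eta F /\ (0 < P [set w | survives R F w])%E.

Definition p_c (R : realType) (G : rooted_graph) (eta : probability nat R) : R :=
  inf [set p | 0 <= p <= 1 /\ survives_with_positive_probability G p eta].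

(* Main.v *)
Require Import Defs.
From HB Require Import structures.
From mathcomp Require Import all_boot all_order all_algebra.
From mathcomp Require Import finmap zify ring lra.
From mathcomp Require Import all_classical all_reals all_analysis measurable_realfun.

Set Implicit Arguments.
Unset Strict Implicit.
Unset Printing Implicit Defensive.

Import Order.TTheory GRing.Theory Num.Theory.
Import numFieldNormedType.Exports.

Local Open Scope classical_set_scope.
Local Open Scope ring_scope.

(* Write mu for the mean of eta.

   Lower bound.  If a frog is active at time n, a time-minimal route leads to
   its site through distinct sites, so that it is reached by a chain of frogs
   that start at distinct sites, hence are independent.  On every graph the
   expected number of such chains is at most mu * (p * (1 + mu)) ^ n, so
   p * (1 + mu) < 1 forces extinction.

   Upper bound.  Let p * (1 + mu) > 1, with eta truncated at M.  Follow a
   prescribed self-avoiding walk made of blocks of L steps; at each new site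
   either keep the current frog or switch to one of the frogs sleeping there.
   A block takes L0 steps in distinct "ordinary" coordinates, one step in each
   of four auxiliary classes of coordinates and a final step up in a fifth
   one, whose sum (the level) grows by 1 per block: blocks at different levels
   are then independent.  The expected number lambda of possible blocks is at
   least 2 when L0 is large and d is large enough.  For the second moment, two
   chains interact only if their positions nearly agree in the four auxiliary
   class sums.  These sums perform a four-dimensional walk whose Green function
   is bounded, and two interacting blocks really collide with probability
   O(1/d).  So the number of chains of n blocks has second moment O(lambda^(2n)),
   and with probability bounded away from 0 chains of every length exist. *)

(** * Independent families of events *)

(** A first moment alone says nothing about survival, and the frogs of the true process are strongly
    dependent. Prescribing the directions makes the probability of a block an exact product, and the
    level serves twice: it separates the coordinates read by successive blocks, and it is a clock,
    since a walk gains at most one level per unit of time, so that long chains mean late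
    activations. The five final steps cost a constant factor, because each auxiliary class holds a
    fixed share of the coordinates; the ordinary steps must outgrow this cost, whence [L0], and keep
    almost all coordinates, whence small shares. Collisions cost [O(1/d)] with a constant that
    depends only on the block length, so the dimension is chosen last. Four classes are used because
    each class sum spreads like [k^(-1/2)]. Survival with positive probability is an existential
    statement over realizations: the upper bound has to build one, which is done from the digits of
    a uniform point, while the lower bound must hold in every realization. *)

Lemma sigma_setT (T : Type) (G : set (set T)) : <<s G >> setT.
Proof.
have [h0 hD _] := smallest_sigma_algebra setT G.
by have := hD _ h0; rewrite setD0.
Qed.

Lemma sigma_setI (T : Type) (G : set (set T)) (A B : set T) :
  <<s G >> A -> <<s G >> B -> <<s G >> (A `&` B).
Proof.
elim/Ppointed: T => T in G A B *; last exact: (@measurableI _ (g_sigma_algebraType G)).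
move=> _ _; rewrite (_ : A `&` B = set0); first exact: sigma_algebra0.
exact: empty_eq0.
Qed.

Section independence.
Context d (Om : measurableType d) (R : realType) (P : probability Om R).
Local Open Scope ereal_scope.

Definition indep_families (J : choiceType) (F : J -> set (set Om)) : Prop :=
  forall (s : seq J) (A : J -> set Om), uniq s ->
    (forall j, j \in s -> F j (A j)) ->
    P (\big[setI/setT]_(j <- s) A j) = \prod_(j <- s) P (A j).

Lemma mutually_independentE (J : choiceType) (F : J -> set (set Om)) :
  mutually_independent P F <-> indep_families F.
Proof.
split=> h s A; last first.
  by move=> FA; rewrite bigcap_seq h// fset_uniq.
move=> us FA; have := h [fset j in s]%fset A.
rewrite bigcap_seq.
have p : perm_eq [fset j in s]%fset s.
  by apply: uniq_perm => // i; rewrite inE.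
rewrite (perm_big _ p)/= => ->; last by move=> j; rewrite inE; exact: FA.
by rewrite (perm_big _ p).
Qed.

(** Both sides are finite measures in [B] that agree on the pi-system [G], which contains the whole
    space; hence they agree on the generated sigma-algebra. *)
Lemma independent_sigma (G : set (set Om)) (C : set Om) :
  G `<=` measurable -> setI_closed G -> G setT -> measurable C ->
  (forall B, G B -> P (B `&` C) = P B * P C) ->
  forall B, <<s G >> B -> P (B `&` C) = P B * P C.
Proof.
move=> Gm GI GT mC h B GB.
have PC0 : (0 <= fine (P C))%R by apply: fine_ge0.
pose m1 : {measure set Om -> \bar R} := mrestr P mC.
pose m2 : {measure set Om -> \bar R} := mscale (NngNum PC0) P.
have m2E A : m2 A = P A * P C.
  by rewrite /m2/= /mscale/= fineK ?fin_num_measure// muleC.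
rewrite -m2E -[LHS]/(m1 B).
apply: (@g_sigma_algebra_measure_unique _ R Om G Gm (fun=> setT) _ _ m1 m2) => //.
- by rewrite bigcup_const//.
- by move=> A GA; rewrite m2E -h.
- by move=> _; rewrite /m1/= /mrestr setTI (le_lt_trans (probability_le1 _ _)) ?ltry.
Qed.

Lemma sigma_measurable (G : set (set Om)) :
  G `<=` measurable -> <<s G >> `<=` measurable.
Proof. by move=> Gm; apply: smallest_sub => //; exact: sigma_algebra_measurable. Qed.

Lemma bigsetI_measurable_seq (J : eqType) (s : seq J) (A : J -> set Om) :
  (forall j, j \in s -> measurable (A j)) ->
  measurable (\big[setI/setT]_(j <- s) A j).
Proof.
elim: s => [|i s IH] h; rewrite ?big_nil ?big_cons; first exact: measurableT.
apply: measurableI; first by apply: h; rewrite mem_head.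
by apply: IH => j js; apply: h; rewrite inE js orbT.
Qed.

(** The pi-systems are replaced by their sigma-algebras one index at a time: [t] lists the indices
    already treated, and [independent_sigma] handles the next one with the other events held
    fixed. *)
Lemma indep_families_sigma (J : choiceType) (F : J -> set (set Om)) :
  (forall j, F j `<=` measurable) -> (forall j, setI_closed (F j)) ->
  (forall j, F j setT) -> indep_families F ->
  indep_families (fun j => <<s F j >>).
Proof.
move=> Fm FI FT Find.
suff H (t : seq J) : indep_families
    (fun j => if j \in t then <<s F j >> else F j).
  by move=> s A us sA; apply: (H s) => // j js; rewrite js; exact: sA.
elim: t => [//|x t IH] s A us sA.
have mA j : j \in s -> measurable (A j).
  move=> /sA; case: ifP => _; last exact: Fm.
  exact: sigma_measurable.
have [xs|xs] := boolP (x \in s); last first.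
  apply: IH => // j js; have := sA _ js; rewrite inE.
  by case: eqP => // jx; rewrite jx (negbTE xs) in js.
have [xt|xt] := boolP (x \in t).
  apply: IH => // j js; have := sA _ js; rewrite inE.
  by case: eqP => //= ->; rewrite xt.
have p : perm_eq s (x :: rem x s) by exact: perm_to_rem.
rewrite !(perm_big _ p)/= !big_cons.
have us' : uniq (x :: rem x s) by rewrite -(perm_uniq p).
have xrem : x \notin rem x s by case/andP: us'.
have Arem j : j \in rem x s -> (if j \in t then <<s F j >> else F j) (A j).
  move=> jr; have jx : (j == x) = false.
    by apply/eqP => jx; move: xrem; rewrite -{1}jx jr.
  by have := sA _ (mem_rem jr); rewrite in_cons jx.
have PC : P (\big[setI/setT]_(j <- rem x s) A j) = \prod_(j <- rem x s) P (A j).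
  by apply: IH; [case/andP: us'|exact: Arem].
rewrite -PC; apply: (@independent_sigma (F x)) => //.
- by apply: bigsetI_measurable_seq => j /mem_rem; exact: mA.
- move=> B FB.
  pose A' j := if j == x then B else A j.
  have eA' j : j \in rem x s -> A' j = A j.
    by move=> jr; rewrite /A' ifN//; apply/eqP => jx; move: xrem; rewrite -{1}jx jr.
  have A'x : A' x = B by rewrite /A' eqxx.
  have := IH (x :: rem x s) A' us'; rewrite !big_cons A'x.
  rewrite (eq_big_seq _ eA') PC => ->; last first.
    move=> j; rewrite in_cons => /predU1P[->|jr]; first by rewrite (negbTE xt) A'x.
    by rewrite eA'//; exact: Arem.
  by congr (_ * _); apply: eq_big_seq => j /eA' ->.
- by have := sA _ xs; rewrite inE eqxx.
Qed.
End independence.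

(** * Products of countably many discrete laws *)

(* The sequence is read off a uniform point of [0, 1[: digit j is the inverse
   distribution function of nu j, and rescale j maps the interval on which
   digit j is constant affinely back onto [0, 1[. *)
Section nested_intervals.
Context (R : realType) (nu : nat -> probability nat R).

Definition cum (j k : nat) : R := fine (nu j `I_k).
Definition pmf (j k : nat) : R := fine (nu j [set k]).

Lemma pmf_ge0 j k : 0 <= pmf j k.
Proof. exact: fine_ge0. Qed.

Lemma cum0 j : cum j 0 = 0.
Proof. by rewrite /cum II0 measure0. Qed.

Lemma cumS j k : cum j k.+1 = cum j k + pmf j k.
Proof.
rewrite /cum /pmf -fineD ?fin_num_measure//; congr fine.
rewrite IIS measureU//.
by apply/seteqP; split=> x //= [/[swap] ->]; rewrite ltnn.
Qed.

Lemma cum_le1 j k : cum j k <= 1.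
Proof.
by rewrite -lee_fin fineK ?fin_num_measure// probability_le1.
Qed.

Lemma cum_gt j u : u < 1 -> exists k, u < cum j k.+1.
Proof.
move=> u1.
have : (nu j (`I_ k)) @[k --> \oo] --> nu j (\bigcup_k `I_ k).
  apply: nondecreasing_cvg_mu => //.
  by move=> m n mn; apply/subsetPset => x /= /leq_trans; exact.
have -> : \bigcup_k `I_ k = [set: nat].
  by apply/seteqP; split=> x // _; exists x.+1 => /=.
rewrite probability_setT => h.
have /(cvgr_gt _) /(_ u u1) : cum j k @[k --> \oo] --> (1 : R) by exact: fine_cvg.
case=> N _ /(_ N.+1) /= hN; exists N.
exact: hN.
Qed.

(** The default [0] concerns only [u >= 1], since [cum j k] tends to [1]; the points [state j w]
    never meet it. *)
Definition digit (j : nat) (u : R) : nat :=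
  if pselect (exists k, u < cum j k.+1) is left e then ex_minn e else 0%N.

Lemma digitP j u k : 0 <= u < 1 ->
  (digit j u = k) <-> (cum j k <= u < cum j k.+1).
Proof.
move=> /andP[u0 u1]; rewrite /digit; case: pselect => [e|]; last first.
  by have := cum_gt j u1.
case: ex_minnP => m um mmin; split=> [<-|/andP[ku uk]].
  rewrite um andbT; case: m um mmin => [|m] um mmin; first by rewrite cum0.
  by rewrite leNgt; apply/negP => /mmin; rewrite ltnn.
have cum_homo a b : (a <= b)%N -> cum j a <= cum j b.
  move=> ab; rewrite fine_le ?fin_num_measure// le_measure ?inE//.
  by move=> x /= /leq_trans; exact.
apply/eqP; rewrite eqn_leq mmin//= leqNgt; apply/negP => mk.
by have := lt_le_trans um (cum_homo _ _ mk); rewrite ltNge ku.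
Qed.

Definition rescale (j : nat) (u : R) : R :=
  (u - cum j (digit j u)) / pmf j (digit j u).

Lemma rescale_itv j u : 0 <= u < 1 -> 0 <= rescale j u < 1.
Proof.
move=> u01; have /(digitP j _ u01) := erefl (digit j u).
rewrite /rescale; set k := digit j u => /andP[h1]; rewrite cumS => h2.
have q0 : 0 < pmf j k by rewrite -(ltrD2l (cum j k)) addr0 (le_lt_trans h1).
by rewrite divr_ge0 ?subr_ge0 ?pmf_ge0//= ltr_pdivrMr// mul1r ltrBlDl.
Qed.

Fixpoint in_cyl (j : nat) (ks : seq nat) (u : R) : Prop :=
  if ks is k :: ks' then digit j u = k /\ in_cyl j.+1 ks' (rescale j u)
  else True.

Fixpoint cyl_left (j : nat) (ks : seq nat) : R :=
  if ks is k :: ks' then cum j k + pmf j k * cyl_left j.+1 ks' else 0.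

Fixpoint cyl_size (j : nat) (ks : seq nat) : R :=
  if ks is k :: ks' then pmf j k * cyl_size j.+1 ks' else 1.

Lemma cyl_size_ge0 j ks : 0 <= cyl_size j ks.
Proof. by elim: ks j => //= k ks IH j; rewrite mulr_ge0 ?pmf_ge0. Qed.

Lemma cyl_bounds j ks :
  0 <= cyl_left j ks /\ cyl_left j ks + cyl_size j ks <= 1.
Proof.
elim: ks j => [|k ks IH] j /=; first by rewrite add0r.
have [h1 h2] := IH j.+1; split.
  by rewrite addr_ge0 ?mulr_ge0 ?pmf_ge0//; apply: fine_ge0.
rewrite -addrA -mulrDr (le_trans _ (cum_le1 j k.+1))// cumS lerD2l.
by rewrite ler_piMr ?pmf_ge0.
Qed.

(** Prescribing the first digit confines [u] to an interval of length [pmf j k], and [rescale] turns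
    the remaining conditions into an interval for the later digits; pulling it back by the affine
    map gives a subinterval. *)
Lemma in_cylP j ks u : 0 <= u < 1 ->
  in_cyl j ks u <-> (cyl_left j ks <= u < cyl_left j ks + cyl_size j ks).
Proof.
elim: ks j u => [|k ks IH] j u u01 /=; first by rewrite add0r u01.
have [h1 h2] := cyl_bounds j.+1 ks.
have s0 := cyl_size_ge0 j.+1 ks.
split=> [[dk]|].
  move/IH; move=> /(_ (rescale_itv _ u01)); move/digitP: (dk) => /(_ u01).
  rewrite cumS /rescale dk => /andP[k1 k2].
  have q0 : 0 < pmf j k by rewrite -(ltrD2l (cum j k)) addr0 (le_lt_trans k1).
  rewrite ler_pdivlMr// ltr_pdivrMr//.
  move=> /andP[]; set a := cyl_left _ _; set b := cyl_size _ _ => u1 u2.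
  by apply/andP; split; lra.
(* For a digit of mass zero the interval is empty; otherwise the division in [rescale] is by a
   positive number. *)
have [q0|q0] := eqVneq (pmf j k) 0.
  rewrite q0 !mul0r !addr0 => /andP[a b].
  by have := le_lt_trans a b; rewrite ltxx.
have {}q0 : 0 < pmf j k by rewrite lt_neqAle eq_sym q0 pmf_ge0.
move=> /andP[u1 u2].
have dk : digit j u = k.
  apply/digitP => //; rewrite cumS; apply/andP; split.
    by rewrite (le_trans _ u1)// lerDl mulr_ge0 ?pmf_ge0.
  by rewrite (lt_le_trans u2)// -addrA -mulrDr lerD2l ler_piMr// ltW.
split=> //; apply/IH; first exact: rescale_itv.
rewrite /rescale dk ler_pdivlMr// ltr_pdivrMr//.
move: u1 u2; set a := cyl_left _ _; set b := cyl_size _ _ => u1 u2.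
by apply/andP; split; lra.
Qed.

(** Points outside [[0, 1[] are sent to [0], so that [coord] is defined on the whole real line,
    which carries the uniform law as sample space. *)
Fixpoint state (j : nat) (w : R) : R :=
  if j is j'.+1 then rescale j' (state j' w)
  else if 0 <= w < 1 then w else 0.

Lemma state_itv j w : 0 <= state j w < 1.
Proof.
elim: j => [|j IH] /=; last exact: rescale_itv.
by case: ifPn; rewrite // lexx ltr01.
Qed.

Definition coord (j : nat) (w : R) : nat := digit j (state j w).

Lemma in_cyl_state j ks w : in_cyl j ks (state j w) <->
  forall i, (i < size ks)%N -> coord (j + i) w = nth 0%N ks i.
Proof.
elim: ks j => [|k ks IH] j //=; split=> [[dk /(IH j.+1) h]|h].
  by case=> [|i] ik; rewrite ?addn0//= -addSnnS h.
split; first by have := h 0%N isT; rewrite addn0.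
by apply/(IH j.+1) => i ik; rewrite addSnnS h.
Qed.

Definition cyl (ks : seq nat) : set R :=
  [set w | forall i, (i < size ks)%N -> coord i w = nth 0%N ks i].

Lemma cyl_itv ks : cyl ks `&` `[0, 1[%classic =
  `[cyl_left 0 ks, cyl_left 0 ks + cyl_size 0 ks[%classic.
Proof.
have [h1 h2] := cyl_bounds 0 ks.
apply/seteqP; split=> w /=; rewrite !in_itv/=.
  move=> [/(in_cyl_state 0) /in_cylP h w01]; have := h (state_itv _ _).
  by rewrite /= w01.
move=> /andP[a b]; have w01 : 0 <= w < 1.
  by rewrite (le_trans h1 a)/= (lt_le_trans b).
split=> //; apply/(in_cyl_state 0)/in_cylP; first exact: state_itv.
by rewrite /= w01 a b.
Qed.

Definition unit_law : probability _ R := @uniform_prob R 0 1 ltr01.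

Lemma unit_law_itv (a b : R) : 0 <= a -> a <= b -> b <= 1 ->
  unit_law `[a, b[%classic = (b - a)%:E.
Proof.
move=> a0 ab b1; rewrite /unit_law/= /uniform_prob.
rewrite (eq_integral (fun=> 1%E)); last first.
  move=> x; rewrite inE/= in_itv/= => /andP[ax xb].
  by rewrite /uniform_pdf subr0 invr1 (le_trans a0 ax) (le_trans (ltW xb) b1).
rewrite integral_cst//= mul1e lebesgue_measure_itv/= lte_fin.
case: ifPn => //; rewrite -leNgt => ba.
by have -> : b = a; [apply/eqP; rewrite eq_le ba|rewrite subrr].
Qed.

Lemma unit_law_cyl ks : measurable (cyl ks) /\
  unit_law (cyl ks) = (cyl_size 0 ks)%:E.
Proof.
have m01 : measurable (`[0, 1[%classic : set R) by [].
(* Off the unit interval all coordinates are constant, so a cylinder contains all of the complement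
   or none of it; [2] is a test point. *)
have mA : measurable (cyl ks `&` ~` `[0, 1[%classic).
  have [c0|c0] := pselect (cyl ks 2).
    rewrite (_ : _ `&` _ = ~` `[0, 1[%classic); first exact: measurableC.
    apply/setIidPr => w /=; rewrite in_itv/= => /negP w01 i ik.
    rewrite -c0// /coord; congr digit; elim: i {ik} => /= [|i ->//].
    by rewrite (negbTE w01) ifN//; apply/negP => /andP[_]; lra.
  rewrite (_ : _ `&` _ = set0)//.
  apply/seteqP; split => w //= -[cw]; rewrite in_itv/= => /negP w01.
  apply: c0 => i ik; rewrite -cw// /coord; congr digit.
  elim: i {ik} => /= [|i ->//].
  by rewrite (negbTE w01) ifN//; apply/negP => /andP[_]; lra.
have mB : measurable (cyl ks `&` `[0, 1[%classic) by rewrite cyl_itv.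
have cE : cyl ks = (cyl ks `&` `[0, 1[%classic) `|` (cyl ks `&` ~` `[0, 1[%classic).
  by rewrite -setIUr setUv setIT.
split; first by rewrite cE; exact: measurableU.
have z : unit_law (~` `[0, 1[%classic) = 0%E.
  rewrite probability_setC// unit_law_itv// subr0.
  by rewrite -EFinB subrr.
have [h1 h2] := cyl_bounds 0 ks.
have e1 : unit_law (cyl ks `&` `[0, 1[%classic) = (cyl_size 0 ks)%:E.
  by rewrite cyl_itv unit_law_itv ?lerDl ?cyl_size_ge0// addrC addKr.
have e2 : unit_law (cyl ks `&` ~` `[0, 1[%classic) = 0%E.
  apply/eqP; rewrite eq_le measure_ge0 andbT -z; apply: le_measure; rewrite ?inE//.
  exact: measurableC.
rewrite cE measureU//; last by rewrite setIACA setICr setI0.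
by rewrite -[RHS]adde0 -e2 -e1.
Qed.

End nested_intervals.

Section product_space_nat.
Context (R : realType) (nu : nat -> probability nat R).
Local Notation X := (coord nu).
Local Notation P := (unit_law R).

Definition fixes (kappa : nat -> option nat) : set R :=
  [set w | forall j k, kappa j = Some k -> X j w = k].

Definition weight (j : nat) (o : option nat) : R :=
  if o is Some k then pmf nu j k else 1.

Lemma pmf_sum (j : nat) : (\sum_(0 <= k <oo) (pmf nu j k)%:E = 1)%E.
Proof.
rewrite -(probability_setT (nu j)).
have -> : [set: nat] = \bigcup_k [set k] by apply/seteqP; split=> // k _; exists k.
rewrite measure_bigcup//; last by apply/trivIsetP => x y _ _ /eqP xy; apply/seteqP; split => z //= [-> /xy].
by apply: congr_lim; apply/funext => n; apply: eq_big => [k|k _]; [rewrite in_setT|rewrite /pmf fineK ?fin_num_measure].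
Qed.

(** Cylinders prescribe an initial segment, while [kappa] may leave gaps. A gap at [m] is filled by
    summing over the value of that coordinate, whose masses add up to [1]; the induction is on the
    number [l] of positions from [m] on that may still be gaps. *)
Lemma unit_law_fixes (kappa : nat -> option nat) (n : nat) :
  (forall j, (n <= j)%N -> kappa j = None) ->
  measurable (fixes kappa) /\
  P (fixes kappa) = (\prod_(j < n) weight j (kappa j))%:E.
Proof.
suff H : forall l m, (m + l = n)%N -> forall kappa,
    (forall j, (n <= j)%N -> kappa j = None) ->
    (forall j, (j < m)%N -> kappa j != None) ->
    measurable (fixes kappa) /\
    P (fixes kappa) = (\prod_(j < n) weight j (kappa j))%:E.
  by move=> kn; apply: (H n 0%N).
elim=> [|l IH] m mln {}kappa kn km.
  have {}mln : m = n by rewrite -mln addn0.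
  have E : fixes kappa = cyl nu (mkseq (fun j => odflt 0%N (kappa j)) n).
    apply/seteqP; split=> w /= h.
      move=> i; rewrite size_mkseq => ni; rewrite nth_mkseq//.
      by have := km i; rewrite mln ni => /(_ isT); case: (kappa i) (h i) => // k /(_ k) -> .
    move=> j k jk; have jn : (j < n)%N.
      by rewrite ltnNge; apply/negP => /kn; rewrite jk.
    by have := h j; rewrite size_mkseq nth_mkseq// jk => ->.
  have [mc Pc] := unit_law_cyl nu (mkseq (fun j => odflt 0%N (kappa j)) n).
  rewrite E; split=> //; rewrite Pc; congr EFin.
  have S ks j0 : cyl_size nu j0 ks = \prod_(j < size ks) pmf nu (j0 + j) (nth 0%N ks j).
    elim: ks j0 => [|k ks IH] j0 /=; first by rewrite big_ord0.
    rewrite big_ord_recl addn0 IH; congr (_ * _); apply: eq_bigr => j _.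
    by rewrite /= addSnnS.
  rewrite S size_mkseq; apply: eq_bigr => j _; rewrite nth_mkseq// add0n.
  by have := km j; rewrite mln => /(_ (ltn_ord j)); case: (kappa j).
have mn : (m < n)%N by rewrite -mln -addSnnS leq_addr.
case km' : (kappa m) => [k|].
  apply: (IH m.+1) => //; first by rewrite addSnnS.
  by move=> j; rewrite ltnS leq_eqVlt => /predU1P[->|/km//]; rewrite km'.
pose kap k j := if j == m then Some k else kappa j.
have H k : measurable (fixes (kap k)) /\
    P (fixes (kap k)) = (\prod_(j < n) weight j (kap k j))%:E.
  apply: (IH m.+1) => //; first by rewrite addSnnS.
    by move=> j nj; rewrite /kap ifN ?kn// gtn_eqF// (leq_trans mn).
  move=> j; rewrite ltnS leq_eqVlt /kap => /predU1P[->|jm]; first by rewrite eqxx.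
  by case: (j =P m) => // _; exact: km.
have E : fixes kappa = \bigcup_k fixes (kap k).
  apply/seteqP; split=> [w h|w [k _] h].
    exists (X m w) => // j k; rewrite /kap; case: eqP => [-> [//]|_]; exact: h.
  move=> j k' jk'; apply: h; rewrite /kap; case: eqP => // jm.
  by rewrite jm km' in jk'.
split; first by rewrite E; apply: bigcup_measurable => k _; exact: (H k).1.
rewrite E measure_bigcup//; last 2 first.
  by move=> k _; exact: (H k).1.
  apply/trivIsetP => x y _ _ /eqP xy; apply/seteqP; split => w //= [hx hy].
  by apply: xy; rewrite -(hx m x) ?(hy m y)// /kap eqxx.
have c0 : (0 <= (\prod_(j < n | j != Ordinal mn) weight j (kappa j))%:E)%E.
  by rewrite lee_fin prodr_ge0// => j _; rewrite /weight; case: (kappa j) => // k; exact: pmf_ge0.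
transitivity (\sum_(0 <= k <oo) ((\prod_(j < n | j != Ordinal mn) weight j (kappa j))%:E * (pmf nu m k)%:E))%E.
  apply: congr_lim; apply/funext => N; apply: eq_big => [k|k _]; first by rewrite in_setT.
  apply: (etrans (H k).2); rewrite (bigD1 (Ordinal mn))//= {1}/kap eqxx mulrC EFinM.
  congr (_%:E * _)%E; apply: eq_bigr => j /negbTE jm.
  by rewrite -(inj_eq val_inj)/= in jm; rewrite /kap jm.
rewrite nneseriesZl//; last by move=> k _; rewrite lee_fin pmf_ge0.
by rewrite pmf_sum mule1 [in RHS](bigD1 (Ordinal mn))//= km' mul1r.
Qed.

End product_space_nat.

Section grouping_nat.
Context (R : realType) (nu : nat -> probability nat R).
Local Notation X := (coord nu).
Local Notation P := (unit_law R).

Lemma measurable_coord j (B : set nat) : measurable (X j @^-1` B).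
Proof.
have -> : X j @^-1` B = \bigcup_(k in B) fixes nu (fun i => if i == j then Some k else None).
  apply/seteqP; split=> [w Bw|w [k Bk] h] /=.
    by exists (X j w) => // i k; case: eqP => // -> [].
  by rewrite (h j k)// eqxx.
apply: bigcup_measurable => k _.
apply: (@unit_law_fixes _ nu _ j.+1 _).1 => i ji.
by rewrite gtn_eqF.
Qed.

Lemma unit_law_coord j (B : set nat) : P (X j @^-1` B) = nu j B.
Proof.
have BE : B = \bigcup_(k in B) [set k] by apply/seteqP; split=> [k Bk|k [_ Bk ->]//]; exists k.
have tI : trivIset B (fun k : nat => [set k]).
  by apply/trivIsetP => x y _ _ /eqP xy; apply/seteqP; split => z //= [-> /xy].
have tX : trivIset B (fun k : nat => X j @^-1` [set k]).
  by apply/trivIsetP => x y _ _ /eqP xy; apply/seteqP; split => z //= [-> /xy].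
rewrite {2}BE measure_bigcup// {1}BE preimage_bigcup measure_bigcup//; last first.
  by move=> k _; exact: measurable_coord.
apply: eq_eseriesr => k _.
pose kappa i := if i == j then Some k else None.
have -> : X j @^-1` [set k] = fixes nu kappa.
  apply/seteqP; split=> [w wk|w h] /=; last by rewrite (h j k)// /kappa eqxx.
  by move=> i k'; rewrite /kappa; case: eqP => // -> [<-].
apply: (etrans (@unit_law_fixes _ nu kappa j.+1 _).2).
  by move=> i ji; rewrite /kappa gtn_eqF.
rewrite (bigD1 ord_max)//= /kappa eqxx big1 ?mulr1.
  by rewrite /= /pmf fineK ?fin_num_measure.
by move=> i ij; rewrite ifN.
Qed.

Context (I : choiceType) (g : nat -> I).

(** The empty set is included for closure under intersection: it is what two contradictory
    prescriptions have in common. *)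
Definition group_cylinders (i : I) : set (set R) :=
  [set B | B = set0 \/ exists n (kappa : nat -> option nat),
     [/\ forall j, (n <= j)%N -> kappa j = None,
         forall j, g j != i -> kappa j = None & B = fixes nu kappa]].

Lemma group_cylinders_setI i : setI_closed (group_cylinders i).
Proof.
move=> A B [->|[n [k [kn ki ->]]]]; first by rewrite set0I; left.
move=> [->|[n' [k' [kn' ki' ->]]]]; first by rewrite setI0; left.
have [[w [wk wk']]|h] := pselect (fixes nu k `&` fixes nu k' !=set0); last first.
  left; apply/seteqP; split=> // w ww; apply: h; by exists w.
right; exists (maxn n n'), (fun j => if k j is Some a then Some a else k' j); split.
- by move=> j; rewrite geq_max => /andP[/kn -> /kn' ->].
- by move=> j gj; rewrite ki// ki'.
- apply/seteqP; split=> v.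
    move=> [vk vk'] j a; case kj : (k j) => [b|]; last exact: vk'.
    by move=> [<-]; exact: vk.
  move=> h; split=> j a ja; first by apply: h; rewrite ja.
  case kj : (k j) => [b|]; last by apply: h; rewrite kj.
  by rewrite -(wk' _ _ ja) (wk _ _ kj); apply: h; rewrite kj.
Qed.

Lemma group_cylinders_setT i : group_cylinders i setT.
Proof.
right; exists 0%N, (fun=> None); split => //.
by apply/seteqP; split=> // w _ j k.
Qed.

Lemma group_cylinders_measurable i : group_cylinders i `<=` measurable.
Proof.
move=> _ [->|[n [k [kn _ ->]]]]; first exact: measurable0.
exact: (unit_law_fixes nu kn).1.
Qed.

(** Unless some event is empty, the prescriptions of different groups concern different coordinates
    and merge into one prescription [kk], whose probability is a product over coordinates that can
    be regrouped by [g]. *)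
Lemma indep_group_cylinders : indep_families P group_cylinders.
Proof.
move=> s A us sA.
have [[i [is_ Ai0]]|nA0] := pselect (exists i, i \in s /\ A i = set0).
  have p : perm_eq s (i :: rem i s) by exact: perm_to_rem.
  by rewrite !(perm_big _ p)/= !big_cons Ai0 set0I measure0 mul0e.
have [n hn] : exists n : nat, forall i, i \in s -> exists kappa : nat -> option nat,
     [/\ forall j, (n <= j)%N -> kappa j = None,
         forall j, g j != i -> kappa j = None & A i = fixes nu kappa].
  elim: s {us} sA nA0 => [|i s IH] sA nA0; first by exists 0%N.
  have [||n hn] := IH.
  - by move=> j js; apply: sA; rewrite in_cons js orbT.
  - by move=> [j [js Aj]]; apply: nA0; exists j; rewrite in_cons js orbT.
  have [A0|[m [k [k1 k2 Ak]]]] := sA i (mem_head _ _).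
    by exfalso; apply: nA0; exists i; rewrite mem_head.
  exists (maxn n m) => j; rewrite in_cons => /predU1P[->|/hn[k' [k1' k2' Ak']]].
    by exists k; split=> // x; rewrite geq_max => /andP[_ /k1].
  by exists k'; split=> // x; rewrite geq_max => /andP[/k1'].
have /choice[kap {}hn] : forall i, exists kappa : nat -> option nat, i \in s ->
     [/\ forall j, (n <= j)%N -> kappa j = None,
         forall j, g j != i -> kappa j = None & A i = fixes nu kappa].
  move=> i; have [/hn[k ki]|//] := boolP (i \in s); last by exists (fun=> None).
  by exists k.
pose kk j := if g j \in s then kap (g j) j else None.
have -> : \big[setI/setT]_(i <- s) A i = fixes nu kk.
  rewrite -bigcap_seq; apply/seteqP; split=> w h.
    move=> j k; rewrite /kk; case: ifP => // gs jk.
    by have := h _ gs; have [_ _ ->] := hn _ gs; exact.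
  move=> i /= is_; have [_ ki ->] := hn _ is_; move=> j k jk.
  have gi : g j = i by apply/eqP/negPn/negP => /ki; rewrite jk.
  by apply: h; rewrite /kk gi is_.
rewrite (unit_law_fixes nu (n := n) _).2; last first.
  by move=> j nj; rewrite /kk; case: ifP => // gs; have [-> //] := hn _ gs.
rewrite (eq_big_seq (fun i => (\prod_(j < n) weight nu j (kap i j))%:E)%E); last first.
  by move=> i is_; have [ki _ ->] := hn _ is_; exact: (unit_law_fixes nu ki).2.
rewrite prodEFin exchange_big/=; congr EFin; apply: eq_bigr => j _.
rewrite /kk; case: ifPn => [gs|gs]; last first.
  rewrite big_seq big1// => i is_; have [_ -> //] := hn _ is_.
  by apply: contraNneq gs => ->.
rewrite (bigD1_seq (g j))//= [X in _ * X]big_seq_cond big1 ?mulr1//.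
move=> i /andP[is_ gi]; have [_ -> //] := hn _ is_.
by rewrite eq_sym.
Qed.

Lemma indep_grouped_coords :
  indep_families P (fun i => <<s \bigcup_(j in [set j | g j = i]) sigma_discrete (X j) >>).
Proof.
have H := @indep_families_sigma _ _ R P I _ group_cylinders_measurable group_cylinders_setI
  group_cylinders_setT indep_group_cylinders.
move=> s A us sA; apply: H => // i /sA; apply: smallest_sub => //.
move=> _ [j /= gj [B _ <-]].
have -> : X j @^-1` B = \bigcup_(k in B) fixes nu (fun i => if i == j then Some k else None).
  apply/seteqP; split=> [w Bw|w [k Bk] h] /=.
    by exists (X j w) => // i' k; case: eqP => // -> [].
  by rewrite (h j k)// eqxx.
rewrite bigcup_mkcond; apply: (@sigma_algebra_bigcup _ setT) => k.
case: ifP => _; last exact: (@sigma_algebra0 _ setT).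
apply: sub_sigma_algebra; right.
exists j.+1, (fun i => if i == j then Some k else None); split=> //.
  by move=> i' ji; rewrite gtn_eqF.
by move=> i' gi; case: (i' =P j) => // e; rewrite e gj eqxx in gi.
Qed.

End grouping_nat.

(** Independence is asserted for every grouping [g], because later arguments group the coordinates
    in several ways: by the variables of the frog model, and by membership in the set of coordinates
    already read. *)
Theorem exists_product_space (R : realType) (J : countType)
    (nu : J -> probability nat R) :
  exists (d : measure_display) (Om : measurableType d)
    (P : probability Om R) (X : J -> Om -> nat),
  [/\ forall j B, measurable (X j @^-1` B),
      forall j B, P (X j @^-1` B) = nu j B &
      forall (I : choiceType) (g : J -> I),
        indep_families P
          (fun i => <<s \bigcup_(j in [set j | g j = i]) sigma_discrete (X j) >>)].
Proof.
(* Naturals that code no index carry the point mass at [0]. *)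
pose nu' n : probability nat R :=
  if choice.unpickle n is Some j then nu j else dirac 0%N.
exists _, _, (unit_law R), (fun j => coord nu' (choice.pickle j)); split.
- by move=> j B; exact: measurable_coord.
- by move=> j B; rewrite unit_law_coord /nu' choice.pickleK.
- move=> I g s A us sA.
  pose g' n := omap g (choice.pickle_inv n).
  pose A' (i : option I) := if i is Some i then A i else setT.
  have := @indep_grouped_coords R nu' _ g' (map Some s) A'.
  rewrite !big_map/=; apply; first by rewrite map_inj_uniq// => x y [].
  move=> _ /mapP[i /sA Ai ->]; move: Ai => /=; apply: sub_smallest2r.
    exact: smallest_sigma_algebra.
  move=> B [j /= gj jB]; exists (choice.pickle j) => //=.
  by rewrite /g' choice.pickleK_inv/= gj.
Qed.

(** * Collisions of two walks *)

Section words.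
Context {T : eqType}.
Implicit Types (a : seq T) (s : seq T).

Fixpoint words a (n : nat) : seq (seq T) :=
  if n is n'.+1 then [seq t :: s | t <- a, s <- words a n'] else [:: [::]].

Lemma mem_words a n s :
  (s \in words a n) = (size s == n) && all [in a] s.
Proof.
elim: n s => [|n IH] s; first by rewrite inE; case: s.
apply/allpairsP/idP => [[[t s'] /= [ta]]|].
  by rewrite IH => /andP[/eqP <- h] -> /=; rewrite eqxx ta.
case: s => [//|t s] /andP[ss /= /andP[ta h]]; exists (t, s); split=> //=.
by rewrite IH -eqSS ss.
Qed.

Lemma words_uniq a n : uniq a -> uniq (words a n).
Proof.
move=> ua; elim: n => //= n IH; apply: allpairs_uniq => //.
by move=> [t s] [t' s'] /= _ _ [-> ->].
Qed.

Lemma big_words_cons (R : nmodType) a n (F : seq T -> R) :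
  \sum_(s <- words a n.+1) F s = \sum_(t <- a) \sum_(s <- words a n) F (t :: s).
Proof. by rewrite /= big_allpairs_dep. Qed.

Lemma big_words0 (R : nmodType) a (F : seq T -> R) :
  \sum_(s <- words a 0) F s = F [::].
Proof. by rewrite /= big_seq1. Qed.

End words.
Arguments words : simpl never.

(** * Coordinates of the environment and the walks they drive *)

Section indices.
Context (d : nat).

Definition site := 'rV[int]_d.
Definition direction := ('I_d * bool)%type.
Definition step_vec (v : direction) : site :=
  (if v.2 then 1 else -1) *: delta_mx ord0 v.1.

Lemma step_vec_inj : injective step_vec.
Proof.
move=> [i b] [j c] /rowP e.
have := e i; have := e j; rewrite !mxE !eqxx /= [i == j]eq_sym.
case: eqVneq => [->|ne] /=; first by case: (b); case: (c).
by case: (b); case: (c).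
Qed.

Definition frog := (site * nat)%type.

(* inl x is the number of frogs at x; inr ((f, t), true) is the direction of
   step t.+1 of frog f, and inr ((f, t), false) is 0 if f does not survive it. *)
Definition env_index := (site + (frog * nat) * bool)%type.

Definition index_site (j : env_index) : site :=
  match j with inl x => x | inr (g, _) => g.1.1 end.

(* The code letter 0 means that the current frog is followed further, the
   letter i.+1 that one switches to frog i of the current site. *)
Definition next_frog (y : site) (g : frog * nat) (c : nat) : frog * nat :=
  if c is i.+1 then ((y, i), 0%N) else (g.1, g.2.+1).

Fixpoint trail (y : site) (u : seq direction) : seq site :=
  if u is v :: u' then (y + step_vec v) :: trail (y + step_vec v) u' else [::].

Lemma size_trail y u : size (trail y u) = size u.
Proof. by elim: u y => //= v u IH y; rewrite IH. Qed.

Definition displacement (u : seq direction) : site := \sum_(v <- u) step_vec v.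

Lemma last_trail y u : last y (trail y u) = y + displacement u.
Proof.
elim: u y => [|v u IH] y /=; first by rewrite /displacement big_nil addr0.
by rewrite IH /displacement big_cons addrA.
Qed.

End indices.

Section environment.
Context (R : realType) (d : nat) (disp : measure_display)
  (Om : measurableType disp) (P : probability Om R)
  (X : env_index d -> Om -> nat) (dir_of : nat -> direction d).
Hypothesis Xm : forall j B, measurable (X j @^-1` B).
Hypothesis Xind : forall (I : choiceType) (g : env_index d -> I),
  indep_families P (fun i => <<s \bigcup_(j in [set j | g j = i]) sigma_discrete (X j) >>).
Let N := #|{: direction d}|.
Hypothesis Xdir : forall g (v : direction d),
  P (X (inr (g, true)) @^-1` [set k | dir_of k = v]) = ((N%:R : R)^-1)%:E.

Definition Pr (A : set Om) : R := fine (P A).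

Lemma Pr_ge0 A : 0 <= Pr A. Proof. exact: fine_ge0. Qed.

Lemma PrE A : measurable A -> (Pr A)%:E = P A.
Proof. by move=> mA; rewrite /Pr fineK// fin_num_measure. Qed.

Lemma le_Pr A B : measurable A -> measurable B -> A `<=` B -> Pr A <= Pr B.
Proof.
by move=> mA mB AB; rewrite -lee_fin !PrE//; apply: le_measure; rewrite ?inE.
Qed.

Lemma PrT : Pr setT = 1. Proof. by rewrite /Pr probability_setT. Qed.

Lemma Pr0 : Pr set0 = 0. Proof. by rewrite /Pr measure0. Qed.

Definition env_sigma (I : set (env_index d)) : set (set Om) :=
  <<s \bigcup_(j in I) sigma_discrete (X j) >>.

Lemma env_sigma_measurable I A : env_sigma I A -> measurable A.
Proof.
apply: sigma_measurable => _ [j _ [B _ <-]]; exact: Xm.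
Qed.

Lemma env_sigmaS I I' : I `<=` I' -> env_sigma I `<=` env_sigma I'.
Proof.
move=> II'; apply: sub_smallest2r; first exact: smallest_sigma_algebra.
by move=> B [j Ij jB]; exists j => //; exact: II'.
Qed.

Lemma env_sigmaT I : env_sigma I setT.
Proof.
exact: sigma_setT.
Qed.

Lemma env_sigmaI I A B : env_sigma I A -> env_sigma I B -> env_sigma I (A `&` B).
Proof.
exact: sigma_setI.
Qed.

Lemma env_sigma_preimage I j B : I j -> env_sigma I (X j @^-1` B).
Proof. by move=> Ij; apply: sub_sigma_algebra; exists j => //; exists B. Qed.

Lemma env_sigma_indep I I' A B : (forall j, I j -> I' j -> False) ->
  env_sigma I A -> env_sigma I' B -> Pr (A `&` B) = Pr A * Pr B.
Proof.
move=> II' sA sB.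
have := @Xind _ (fun j => `[< I j >]) [:: true; false] (fun b => if b then A else B) isT.
rewrite !big_cons !big_nil setIT mule1 => H.
apply: EFin_inj; rewrite EFinM !PrE; [|exact: env_sigma_measurable sB|exact: env_sigma_measurable sA|].
  apply: H => -[] _; [move: sA|move: sB]; apply: env_sigmaS => j jI /=; first exact/asboolP.
  by apply/asboolP => ?; exact: II' jI.
by apply: measurableI; [exact: env_sigma_measurable sA|exact: env_sigma_measurable sB].
Qed.

Lemma sum_Pr_disjoint (T : choiceType) (s : seq T) (E : T -> set Om) (A : set Om) :
  uniq s -> measurable A -> (forall t, measurable (E t)) ->
  (forall t t', t != t' -> E t `&` E t' = set0) ->
  \sum_(t <- s) Pr (A `&` E t) <= Pr A.
Proof.
move=> us mA mE dE.
suff: \sum_(t <- s) Pr (A `&` E t) <= Pr (A `&` \big[setU/set0]_(t <- s) E t).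
  move=> /le_trans; apply; apply: le_Pr => //.
  by apply: measurableI => //; apply: bigsetU_measurable => t _; exact: mE.
elim: s us => [|t s IH] /=; first by rewrite !big_nil Pr_ge0.
move=> /andP[ts us]; rewrite !big_cons.
have mU : measurable (\big[setU/set0]_(t <- s) E t).
  by apply: bigsetU_measurable => t' _; exact: mE.
have -> : Pr (A `&` (E t `|` \big[setU/set0]_(j <- s) E j)) =
   Pr (A `&` E t) + Pr (A `&` \big[setU/set0]_(j <- s) E j).
  apply: EFin_inj; rewrite EFinD !PrE//; [|exact: measurableI|exact: measurableI|].
    rewrite setIUr measureU//; [by apply: measurableI|by apply: measurableI|].
    rewrite setIACA setIid (_ : E t `&` _ = set0) ?setI0//.
    rewrite -bigcup_seq; apply/seteqP; split=> // w [Et [t' /= t's Et']].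
    have tt' : t != t' by apply: contraNneq ts => ->.
    by have : (E t `&` E t') w; [split|rewrite dE].
  by apply: measurableI => //; exact: measurableU.
by rewrite lerD2l IH.
Qed.

Definition dir_event (g : frog d * nat) (v : direction d) : set Om :=
  X (inr (g, true)) @^-1` [set k | dir_of k = v].

Lemma dir_event_disjoint g v v' : v != v' -> dir_event g v `&` dir_event g v' = set0.
Proof.
move=> vv'; apply/seteqP; split=> // w [h1 h2]; move/eqP: vv'; apply.
by rewrite /= -h1 -h2.
Qed.

Lemma Pr_dir_event I A g v : env_sigma I A -> ~ I (inr (g, true)) ->
  Pr (A `&` dir_event g v) = Pr A / N%:R.
Proof.
move=> sA nI.
rewrite (@env_sigma_indep I [set inr (g, true)] A (dir_event g v))//.
- by rewrite {2}/Pr /dir_event Xdir.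
- by move=> j Ij /= jg; rewrite jg in Ij.
- exact: env_sigma_preimage.
Qed.

(** The walk at [y] is carried by frog [g.1], which has made [g.2] steps; the letters of [c] say
    where it changes frogs, an exhausted code counting as [0]. Only directions are tested, neither
    survival nor the number of frogs: this larger event suffices for upper bounds on collisions. *)
Fixpoint trail_event (y : site d) (g : frog d * nat) (u : seq (direction d)) (c : seq nat)
    : set Om :=
  if u is v :: u' then
    dir_event g v `&`
    trail_event (y + step_vec v) (next_frog (y + step_vec v) g (head 0%N c)) u' (behead c)
  else setT.

Lemma trail_event_measurable y g u c : measurable (trail_event y g u c).
Proof.
elim: u y g c => [|v u IH] y g c /=; first exact: measurableT.
by apply: measurableI; [exact: Xm|exact: IH].
Qed.

Local Notation walks n := (words (enum {: direction d}) n).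

(** For a fixed code the events of different words are disjoint: at the first difference one and the
    same frog would have to take two directions in the same step. *)
Lemma sum_trail_event A y g c n : measurable A ->
  \sum_(u <- walks n) Pr (A `&` trail_event y g u c) <= Pr A.
Proof.
elim: n A y g c => [|n IH] A y g c mA; first by rewrite big_words0 /= setIT.
rewrite big_words_cons.
apply: (@le_trans _ _ (\sum_(v <- enum {: direction d}) Pr (A `&` dir_event g v))).
  apply: ler_sum => v _.
  under eq_bigr do rewrite /= setIA.
  by apply: IH; apply: measurableI => //; exact: Xm.
apply: sum_Pr_disjoint => //; first exact: enum_uniq.
  by move=> v; exact: Xm.
exact: dir_event_disjoint.
Qed.

(** Summing out one walk after the other uses only disjointness, whatever the dependence between the
    two. *)
Lemma sum_trail_event2 A y g c n y' g' c' n' : measurable A ->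
  \sum_(u <- walks n) \sum_(u' <- walks n')
    Pr (A `&` (trail_event y g u c `&` trail_event y' g' u' c')) <= Pr A.
Proof.
move=> mA; apply: le_trans (sum_trail_event y g c n mA); apply: ler_sum => u _.
under eq_bigr do rewrite setIA.
by apply: sum_trail_event; apply: measurableI => //; exact: trail_event_measurable.
Qed.

End environment.

(* When k sites have been visited, at most (2k+1)N of the N^2 pairs of next
   directions of the two walks make a collision; otherwise k grows by 2. *)
Definition collision_bound (n k : nat) : nat := (n * (2 * (k + 2 * n) + 1))%N.

Lemma collision_boundS n k :
  (2 * k + 1 + collision_bound n k.+2 <= collision_bound n.+1 k)%N.
Proof. rewrite /collision_bound; lia. Qed.

Lemma collision_bound_mono n k k' : (k <= k')%N ->
  (collision_bound n k <= collision_bound n k')%N.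
Proof. by move=> kk'; rewrite /collision_bound leq_mul2l; apply/orP; right; lia. Qed.

Section collisions.
Context (R : realType) (d : nat) (disp : measure_display)
  (Om : measurableType disp) (P : probability Om R)
  (X : env_index d -> Om -> nat) (dir_of : nat -> direction d).
Hypothesis Xm : forall j B, measurable (X j @^-1` B).
Hypothesis Xind : forall (I : choiceType) (g : env_index d -> I),
  indep_families P (fun i => <<s \bigcup_(j in [set j | g j = i]) sigma_discrete (X j) >>).
Let N := #|{: direction d}|.
Hypothesis Xdir : forall g (v : direction d),
  P (X (inr (g, true)) @^-1` [set k | dir_of k = v]) = ((N%:R : R)^-1)%:E.
Hypothesis N_gt0 : (0 < N)%N.

Local Notation Pr := (Pr P).
Local Notation env_sigma := (env_sigma X).
Local Notation dir_event := (dir_event X dir_of).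
Local Notation trail_event := (trail_event X dir_of).
Local Notation dirs := (enum {: direction d}).
Local Notation walks n := (words dirs n).

Lemma sum_indicator_le (T : eqType) (s : seq T) (Q : pred T) (a : R) (m : nat) :
  0 <= a -> (count Q s <= m)%N ->
  \sum_(t <- s) (if Q t then a else 0) <= a * m%:R.
Proof.
move=> a0 cm; rewrite -big_mkcond/= big_const_seq iter_addr_0 -[leLHS]mulr_natr.
by rewrite ler_wpM2l// ler_nat.
Qed.

Lemma count_hit (y : site d) (vis : seq (site d)) :
  (count (fun v => (y + step_vec v)%R \in vis) dirs <= size vis)%N.
Proof.
rewrite -size_filter -(size_map (fun v => y + step_vec v)).
apply: uniq_leq_size.
  rewrite map_inj_uniq; first by apply: filter_uniq; exact: enum_uniq.
  by move=> v v' /addrI; exact: step_vec_inj.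
by move=> z /mapP[v]; rewrite mem_filter => /andP[h _] ->.
Qed.

Lemma sizeN : size dirs = N. Proof. by rewrite -cardE. Qed.

Let NR_gt0 : 0 < N%:R :> R. Proof. by rewrite ltr0n. Qed.

(** The first walk hits [vis] in at most [size vis] directions; if it does not, the second one hits
    [vis] or the new site in at most [size vis + 1]. Each case is counted with the [N] directions of
    the other walk. *)
Lemma sum_first_collision (y y' : site d) (vis : seq (site d)) (a : R) :
  0 <= a -> uniq vis ->
  \sum_(v <- dirs) \sum_(v' <- dirs)
    (if ~~ uniq ((y + step_vec v) :: (y' + step_vec v') :: vis) then a else 0)
  <= a * ((2 * size vis + 1) * N)%:R.
Proof.
move=> a0 uvis.
apply: (@le_trans _ _ (\sum_(v <- dirs)
   ((if y + step_vec v \in vis then a * N%:R else 0) + a * (size vis).+1%:R))).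
  apply: ler_sum => v _.
  case: ifPn => [vv|vv].
    rewrite -[leLHS]addr0 lerD ?mulr_ge0//.
    by apply: sum_indicator_le; rewrite // -sizeN count_size.
  rewrite add0r; apply: sum_indicator_le => //.
  apply: leq_trans (count_hit y' ((y + step_vec v) :: vis)).
  apply: sub_count => v' /=; rewrite uvis andbT !in_cons negb_and !negbK (negbTE vv) orbF.
  by rewrite eq_sym.
rewrite big_split/= big_const_seq iter_addr_0 count_predT sizeN.
have := @sum_indicator_le _ dirs (fun v => y + step_vec v \in vis) (a * N%:R) _
  (mulr_ge0 a0 (ler0n _ _)) (count_hit y vis).
move=> h; apply: le_trans (lerD h (lexx _)) _.
rewrite -[X in _ + X]mulr_natr -!mulrA -!natrM -mulrDr -natrD ler_wpM2l// ler_nat.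
by rewrite mulnDl mul1n mulnC; lia.
Qed.

Definition frog_fresh (I : set (env_index d)) (g : frog d * nat) :=
  forall a, (g.2 <= a)%N -> ~ I (inr ((g.1, a), true)).

(** [vis] contains every site whose coordinates occur in [I]. As long as the two walks step onto new
    sites, they are driven by distinct frogs with unread directions, so the next pair of steps is
    uniform given the past; a frog chosen at a new site is unread as well. The collision
    probabilities of the successive steps add up to [collision_bound]. *)
Lemma collision_separate n (y y' : site d) g g' c c' vis I A :
  env_sigma I A -> uniq vis -> g.1 != g'.1 -> frog_fresh I g -> frog_fresh I g' ->
  (forall j, I j -> index_site j \in vis) -> g.1.1 \in vis -> g'.1.1 \in vis ->
  \sum_(u <- walks n) \sum_(u' <- walks n)
    (if ~~ uniq (vis ++ trail y u ++ trail y' u') then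
       Pr (A `&` (trail_event y g u c `&` trail_event y' g' u' c')) else 0)
  <= Pr A * (collision_bound n (size vis))%:R / N%:R.
Proof.
elim: n y y' g g' c c' vis I A => [|n IH] y y' g g' c c' vis I A sA uvis gg' fg fg' Ivis gvis g'vis.
  rewrite !big_words0 /= cats0 uvis /= divr_ge0 ?mulr_ge0 ?Pr_ge0//.
rewrite big_words_cons.
under eq_bigr => v _.
  under eq_bigr do rewrite big_words_cons.
  rewrite exchange_big/=; over.
rewrite /=.
pose b : R := (collision_bound n (size vis).+2)%:R.
have PA0 : 0 <= Pr A by exact: Pr_ge0.
pose K : R := Pr A / N%:R / N%:R.
have K0 : 0 <= K by rewrite /K !divr_ge0.
have b0 : 0 <= b by rewrite /b.
have mA := env_sigma_measurable Xm sA.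
apply: (@le_trans _ _ (\sum_(v <- dirs) \sum_(v' <- dirs)
   ((if ~~ uniq ((y + step_vec v) :: (y' + step_vec v') :: vis) then K else 0)
     + K * (b / N%:R)))); last first.
  under eq_bigr do rewrite big_split/= big_const_seq iter_addr_0 count_predT sizeN.
  rewrite big_split/= big_const_seq iter_addr_0 count_predT sizeN.
  apply: le_trans (lerD (sum_first_collision y y' K0 uvis) (lexx _)) _.
  rewrite -[(_ *+ N)]mulr_natr -[(_ *+ N)]mulr_natr.
  rewrite [leLHS](_ : _ = Pr A * ((2 * size vis + 1)%:R + b) / N%:R); last first.
    by rewrite /K natrM; field; rewrite gt_eqF.
  rewrite ler_wpM2r ?invr_ge0// ler_wpM2l// /b -natrD ler_nat.
  exact: collision_boundS.
apply: ler_sum => v _; apply: ler_sum => v' _.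
set y1 := y + step_vec v; set y1' := y' + step_vec v'.
pose A' := A `&` (dir_event g v `&` dir_event g' v').
have ni1 : ~ I (inr (g, true)) by have := fg g.2 (leqnn _); rewrite -surjective_pairing.
have ni2 : ~ I (inr (g', true)) by have := fg' g'.2 (leqnn _); rewrite -surjective_pairing.
pose I1 := I `|` [set inr (g, true)].
pose I2 := I1 `|` [set inr (g', true)].
have sA1 : env_sigma I1 (A `&` dir_event g v).
  apply: env_sigmaI; first by apply: env_sigmaS sA => j; left.
  by apply: env_sigma_preimage; right.
have sA' : env_sigma I2 A'.
  rewrite /A' setIA; apply: env_sigmaI; first by apply: env_sigmaS sA1 => j; left.
  by apply: env_sigma_preimage; right.
have PA' : Pr A' = K.
  rewrite /A' setIA (Pr_dir_event Xm Xind Xdir v' sA1).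
    by rewrite (Pr_dir_event Xm Xind Xdir v sA ni1).
  move=> [//|/= [e]]; move: gg'; by rewrite e eqxx.
have evE u u' : A `&` ((dir_event g v `&` trail_event y1 (next_frog y1 g (head 0%N c)) u (behead c)) `&`
     (dir_event g' v' `&` trail_event y1' (next_frog y1' g' (head 0%N c')) u' (behead c'))) =
   A' `&` (trail_event y1 (next_frog y1 g (head 0%N c)) u (behead c) `&`
           trail_event y1' (next_frog y1' g' (head 0%N c')) u' (behead c')).
  by rewrite /A' [X in A `&` X]setIACA [LHS]setIA.
have mA' := env_sigma_measurable Xm sA'.
(* After a collision the remaining steps are summed out, leaving the mass [K] of this pair of steps;
   without one, the induction goes on with two more visited sites. *)
have [hu|hu] := boolP (uniq (y1 :: y1' :: vis)); last first.
  have KB : 0 <= K * (b / N%:R) by rewrite mulr_ge0// divr_ge0.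
  rewrite /= (le_trans _ (_ : K <= _)) ?lerDl//.
  rewrite -PA'; apply: le_trans (sum_trail_event2 P dir_of Xm y1 (next_frog y1 g (head 0%N c)) (behead c) n
     y1' (next_frog y1' g' (head 0%N c')) (behead c') n mA').
  apply: ler_sum => u _; apply: ler_sum => u' _; rewrite evE.
  by case: ifP => // _; exact: Pr_ge0.
rewrite /= add0r -PA'.
have vis1 : y1 \notin vis by move: hu => /= /andP[]; rewrite in_cons negb_or => /andP[].
have vis1' : y1' \notin vis by move: hu => /= /and3P[].
have y1y1' : y1 != y1' by move: hu => /= /andP[]; rewrite in_cons negb_or => /andP[].
have I2vis j : I2 j -> index_site j \in vis.
  by move=> [[/Ivis //|->//]|->].
have := IH y1 y1' (next_frog y1 g (head 0%N c)) (next_frog y1' g' (head 0%N c'))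
   (behead c) (behead c') (y1 :: y1' :: vis) I2 A' sA' hu.
rewrite -/b mulrA => H.
apply: le_trans (H _ _ _ _ _ _).
- apply: ler_sum => u _; apply: ler_sum => u' _; rewrite evE.
  have -> : uniq (vis ++ y1 :: trail y1 u ++ y1' :: trail y1' u') =
            uniq ((y1 :: y1' :: vis) ++ trail y1 u ++ trail y1' u').
    apply: perm_uniq; rewrite -cat1s perm_catCA /= perm_cons.
    rewrite catA -cat1s perm_catCA /= perm_cons.
    by rewrite catA.
  by [].
- case: (head 0%N c) => [|i]; case: (head 0%N c') => [|i'] //=.
  + by apply: contraNneq vis1' => e; rewrite -[y1']/((y1', i').1) -e.
  + by apply: contraNneq vis1 => e; rewrite -[y1]/((y1, i).1) e.
  + by apply: contraNneq y1y1' => -[->].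
- move=> a; case: (head 0%N c) => [|i] /= ga.
    move=> [[|]|]; first exact/fg/ltnW.
      by move=> [e]; move: ga; rewrite -e ltnn.
    by move=> [e]; move: gg'; rewrite -e eqxx.
  by move=> /I2vis /=; exact/negP.
- move=> a; case: (head 0%N c') => [|i] /= ga.
    move=> [[|]|]; first exact/fg'/ltnW.
      by move=> [e]; move: gg'; rewrite -e eqxx.
    by move=> [e]; move: ga; rewrite -e ltnn.
  by move=> /I2vis /=; exact/negP.
- by move=> j /I2vis h; rewrite !in_cons h !orbT.
- by case: (head 0%N c) => [|i] /=; rewrite !in_cons ?gvis ?eqxx ?orbT.
- by case: (head 0%N c') => [|i] /=; rewrite !in_cons ?g'vis ?eqxx ?orbT.
Qed.

(** While the codes agree the two walks coincide, as one frog cannot take two directions. At the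
    first differing letter they continue with different frogs from the same new site. At least one
    step remains, since codes are shorter than words, and equal displacements make the two trails
    meet, so [collision_separate] applies. *)
Lemma collision_join n (y : site d) g c c' vis I A :
  size c = n -> size c' = n -> c != c' ->
  env_sigma I A -> uniq vis -> frog_fresh I g ->
  (forall j, I j -> index_site j \in vis) -> g.1.1 \in vis ->
  \sum_(u <- walks n.+1) \sum_(u' <- walks n.+1)
    (if displacement u == displacement u' then
       Pr (A `&` (trail_event y g u c `&` trail_event y g u' c')) else 0)
  <= Pr A * (collision_bound n.+1 (size vis))%:R / N%:R.
Proof.
elim: n y g c c' vis I A => [|n IH] y g c c' vis I A sc sc' cc' sA uvis fg Ivis gvis.
  by move/size0nil: sc cc' => ->; move/size0nil: sc' => ->; rewrite eqxx.
rewrite big_words_cons.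
under eq_bigr => v _.
  under eq_bigr do rewrite big_words_cons.
  rewrite exchange_big/=; over.
rewrite /=.
have PA0 : 0 <= Pr A by exact: Pr_ge0.
have mA := env_sigma_measurable Xm sA.
pose b : R := (collision_bound n.+1 (size vis).+1)%:R.
pose K : R := Pr A / N%:R.
have K0 : 0 <= K by rewrite /K !divr_ge0.
have b0 : 0 <= b by rewrite /b.
have ni : ~ I (inr (g, true)) by have := fg g.2 (leqnn _); rewrite -surjective_pairing.
apply: (@le_trans _ _ (\sum_(v <- dirs)
   ((if y + step_vec v \in vis then K else 0) + K * (b / N%:R)))); last first.
  rewrite big_split/= big_const_seq iter_addr_0 count_predT sizeN.
  apply: le_trans (lerD (sum_indicator_le K0 (count_hit y vis)) (lexx _)) _.
  rewrite -[(_ *+ N)]mulr_natr.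
  rewrite [leLHS](_ : _ = Pr A * ((size vis)%:R + b) / N%:R); last first.
    by rewrite /K; field; rewrite gt_eqF.
  rewrite ler_wpM2r ?invr_ge0// ler_wpM2l// /b -natrD ler_nat.
  apply: leq_trans (collision_boundS n.+1 (size vis)).
  by rewrite leq_add ?collision_bound_mono//; lia.
apply: ler_sum => v _; set y1 := y + step_vec v.
pose A' := A `&` dir_event g v.
pose I' := I `|` [set inr (g, true)].
have sA' : env_sigma I' A'.
  apply: env_sigmaI; first by apply: env_sigmaS sA => j; left.
  by apply: env_sigma_preimage; right.
have mA' := env_sigma_measurable Xm sA'.
have PA' : Pr A' = K by exact: (Pr_dir_event Xm Xind Xdir v sA ni).
rewrite (bigD1_seq v) ?mem_enum ?enum_uniq//= [X in _ + X]big1 ?addr0; last first.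
  move=> v' v'v; rewrite big1// => u _; rewrite big1// => u' _.
  rewrite setIACA dir_event_disjoint ?set0I ?setI0 ?Pr0 ?if_same//.
  by rewrite eq_sym.
have evE u u' : A `&` ((dir_event g v `&` trail_event y1 (next_frog y1 g (head 0%N c)) u (behead c)) `&`
     (dir_event g v `&` trail_event y1 (next_frog y1 g (head 0%N c')) u' (behead c'))) =
   A' `&` (trail_event y1 (next_frog y1 g (head 0%N c)) u (behead c) `&`
           trail_event y1 (next_frog y1 g (head 0%N c')) u' (behead c')).
  by rewrite /A' [X in A `&` X]setIACA setIid [LHS]setIA.
have dispE u u' : (displacement (v :: u) == displacement (v :: u')) = (displacement u == displacement u').
  by rewrite /displacement !big_cons (inj_eq (addrI _)).
(* A return to [vis] could lead to frogs already read; it happens for at most [size vis] directions,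
   and its whole mass is conceded. *)
have [y1vis|y1vis] := boolP (y1 \in vis).
  rewrite (le_trans _ (_ : K <= _)) ?lerDl ?mulr_ge0 ?divr_ge0//.
  rewrite -PA'; apply: le_trans (sum_trail_event2 P dir_of Xm y1 (next_frog y1 g (head 0%N c)) (behead c) n.+1
     y1 (next_frog y1 g (head 0%N c')) (behead c') n.+1 mA').
  apply: ler_sum => u _; apply: ler_sum => u' _; rewrite evE.
  by case: ifP => // _; exact: Pr_ge0.
rewrite add0r -PA' /b mulrA.
have I'vis j : I' j -> index_site j \in vis.
  by move=> [/Ivis //|->].
have uvis1 : uniq (y1 :: vis) by rewrite /= y1vis.
have fresh' h : frog_fresh I' (next_frog y1 g h).
  move=> a; case: h => [|i] /= ga.
    move=> [|]; first exact/fg/ltnW.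
    by move=> [e]; move: ga; rewrite -e ltnn.
  by move=> /I'vis /=; exact/negP.
have site' h : (next_frog y1 g h).1.1 \in y1 :: vis.
  by case: h => [|i] /=; rewrite !in_cons ?gvis ?eqxx ?orbT.
have [hh|hh] := eqVneq (head 0%N c) (head 0%N c').
  have := IH y1 (next_frog y1 g (head 0%N c)) (behead c) (behead c') (y1 :: vis) I' A'.
  rewrite !size_behead sc sc' => H; apply: le_trans (H _ _ _ _ _ _ _ _) => //.
    apply: ler_sum => u _; apply: ler_sum => u' _.
    by rewrite evE dispE -hh.
  by case: (c) (c') sc sc' cc' hh => [//|a l] [//|a' l'] /= _ _; rewrite eqseq_cons negb_and => /orP[/eqP|].
    by move=> j /I'vis h; rewrite in_cons h orbT.
have := @collision_separate n.+1 y1 y1 (next_frog y1 g (head 0%N c)) (next_frog y1 g (head 0%N c'))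
  (behead c) (behead c') (y1 :: vis) I' A' sA' uvis1.
move=> H; apply: le_trans (H _ _ _ _ _ _) => //.
- rewrite big_seq [leRHS]big_seq; apply: ler_sum => u; rewrite mem_words => /andP[/eqP su _].
  rewrite big_seq [leRHS]big_seq; apply: ler_sum => u'; rewrite mem_words => /andP[/eqP su' _].
  rewrite evE dispE; case: ifP => [/eqP uu'|]; last by case: ifP => // _; rewrite Pr_ge0.
  rewrite ifT//; apply/negP => un.
  have : last y1 (trail y1 u) = last y1 (trail y1 u') by rewrite !last_trail uu'.
  case: u su uu' un => // w u _ _; case: u' su' => // w' u' _.
  rewrite cat_uniq cat_uniq => /and3P[_ _ /and3P[_ /hasPn h _]] /= e.
  have := h (last (y1 + step_vec w') (trail (y1 + step_vec w') u')).
  by rewrite /= mem_last => /(_ isT); rewrite -e /= mem_last.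
- case: (head 0%N c) hh => [|i]; case: (head 0%N c') => [|i'] //= ii'.
  + by apply: contraNneq y1vis => e; rewrite -[y1]/((y1, i').1) -e.
  + by apply: contraNneq y1vis => e; rewrite -[y1]/((y1, i).1) e.
  + by apply: contraNneq ii' => -[->].
- by move=> j /I'vis h; rewrite in_cons h orbT.
Qed.

Lemma collision_labels n (x : site d) i i' c c' :
  i != i' ->
  \sum_(u <- walks n.+1) \sum_(u' <- walks n.+1)
    (if displacement u == displacement u' then
       Pr (trail_event x ((x, i), 0%N) u c `&` trail_event x ((x, i'), 0%N) u' c') else 0)
  <= (collision_bound n.+1 1)%:R / N%:R.
Proof.
move=> ii'.
have := @collision_separate n.+1 x x ((x, i), 0%N) ((x, i'), 0%N) c c' [:: x] set0 setT (@env_sigmaT _ _ _ X set0).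
rewrite PrT mul1r => H; apply: le_trans (H _ _ _ _ _ _ _); last first.
- by rewrite /= mem_head.
- by rewrite /= mem_head.
- by [].
- by move=> a _.
- by move=> a _.
- by apply: contra_neq ii' => -[].
- by [].
rewrite big_seq [leRHS]big_seq; apply: ler_sum => u; rewrite mem_words => /andP[/eqP su _].
rewrite big_seq [leRHS]big_seq; apply: ler_sum => u'; rewrite mem_words => /andP[/eqP su' _].
rewrite setTI; case: ifP => [/eqP uu'|]; last by case: ifP => // _; rewrite Pr_ge0.
rewrite ifT//; apply/negP => un.
have : last x (trail x u) = last x (trail x u') by rewrite !last_trail uu'.
case: u su uu' un => // w u _ _; case: u' su' => // w' u' _.
rewrite cat_uniq cat_uniq => /and3P[_ _ /and3P[_ /hasPn h _]] /= e.
have := h (last (x + step_vec w') (trail (x + step_vec w') u')).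
by rewrite /= mem_last => /(_ isT); rewrite -e /= mem_last.
Qed.

Lemma collision_sites n (x x' : site d) i i' c c' :
  x != x' ->
  \sum_(u <- walks n) \sum_(u' <- walks n)
    (if ~~ uniq ((x :: trail x u) ++ (x' :: trail x' u')) then
       Pr (trail_event x ((x, i), 0%N) u c `&` trail_event x' ((x', i'), 0%N) u' c') else 0)
  <= (collision_bound n 2)%:R / N%:R.
Proof.
move=> xx'.
have := @collision_separate n x x' ((x, i), 0%N) ((x', i'), 0%N) c c' [:: x; x'] set0 setT (@env_sigmaT _ _ _ X set0).
rewrite PrT mul1r => H; apply: le_trans (H _ _ _ _ _ _ _); last first.
- by rewrite /= !in_cons eqxx orbT.
- by rewrite /= mem_head.
- by [].
- by move=> a _.
- by move=> a _.
- by apply: contra_neq xx' => -[].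
- by rewrite /= in_cons in_nil orbF xx'.
apply: ler_sum => u _; apply: ler_sum => u' _; rewrite setTI.
have -> : uniq ((x :: trail x u) ++ x' :: trail x' u') = uniq ([:: x; x'] ++ trail x u ++ trail x' u').
  apply: perm_uniq; rewrite /= perm_cons -cat1s perm_catCA /= perm_cons.
  by [].
by [].
Qed.

End collisions.

(** * Blocks *)

Section blocks.
Context (R : realType) (d : nat) (disp : measure_display)
  (Om : measurableType disp) (P : probability Om R)
  (X : env_index d -> Om -> nat) (dir_of : nat -> direction d).
Hypothesis Xm : forall j B, measurable (X j @^-1` B).
Hypothesis Xind : forall (I : choiceType) (g : env_index d -> I),
  indep_families P (fun i => <<s \bigcup_(j in [set j | g j = i]) sigma_discrete (X j) >>).
Let N := #|{: direction d}|.
Hypothesis Xdir : forall g (v : direction d),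
  P (X (inr (g, true)) @^-1` [set k | dir_of k = v]) = ((N%:R : R)^-1)%:E.
Variable p : R.
Hypothesis Xbit : forall g, P (X (inr (g, false)) @^-1` [set k | k != 0%N]) = p%:E.
Variable tail : nat -> R.
Hypothesis Xeta : forall x i, P (X (inl x) @^-1` [set k | (i < k)%N]) = (tail i)%:E.

Local Notation Pr := (Pr P).
Local Notation env_sigma := (env_sigma X).
Local Notation dir_event := (dir_event X dir_of).
Local Notation trail_event := (trail_event X dir_of).

Definition survival_event (g : frog d * nat) : set Om :=
  X (inr (g, false)) @^-1` [set k | k != 0%N].

Definition label_event (y : site d) (c : nat) : set Om :=
  if c is i.+1 then X (inl y) @^-1` [set k | (i < k)%N] else setT.

Definition label_weight (c : nat) : R := if c is i.+1 then tail i else 1.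

(** Refines [trail_event] by survival of every step and by presence of the selected frogs; this is
    what makes the sites of the walk actually activated. *)
Fixpoint walk_event (y : site d) (g : frog d * nat) (u : seq (direction d)) (c : seq nat)
    : set Om :=
  if u is v :: u' then
    let y' := y + step_vec v in
    dir_event g v `&` survival_event g `&` label_event y' (head 0%N c) `&`
    walk_event y' (next_frog y' g (head 0%N c)) u' (behead c)
  else setT.

Lemma label_event_measurable y c : measurable (label_event y c).
Proof. by case: c => [|i] /=; [exact: measurableT|exact: Xm]. Qed.

Lemma walk_event_measurable y g u c : measurable (walk_event y g u c).
Proof.
elim: u y g c => [|v u IH] y g c /=; first exact: measurableT.
apply: measurableI; last exact: IH.
apply: measurableI; last exact: label_event_measurable.
by apply: measurableI; exact: Xm.
Qed.

Lemma sub_walk_event y g u c : walk_event y g u c `<=` trail_event y g u c.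
Proof.
elim: u y g c => [//|v u IH] y g c /= w [[[h _] _] /IH h'].
by split.
Qed.

(** The last site of the walk is not read, because the code is shorter than the word and selects no
    frog there. It is left to the next block, so consecutive blocks read disjoint coordinates. *)
Lemma env_sigma_walk_event (S : seq (site d)) y g u c :
  (size c < size u)%N -> g.1.1 \in S ->
  {subset behead (belast y (trail y u)) <= S} ->
  env_sigma [set j | index_site j \in S] (walk_event y g u c).
Proof.
elim: u y g c => [//|v u IH] y g c /= sc gS uS.
apply: env_sigmaI; last first.
  case: u IH sc uS => [|v' u] IH sc uS; first exact: env_sigmaT.
  apply: IH; first by case: (c) sc.
    by case: (head 0%N c) => [//|i] /=; apply: uS; rewrite /= mem_head.
  by move=> z zz; apply: uS; rewrite /= in_cons zz orbT.
apply: env_sigmaI; first by apply: env_sigmaI; apply: env_sigma_preimage.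
case: c sc => [|[|i] c] sc /=; [exact: env_sigmaT|exact: env_sigmaT|].
apply: env_sigma_preimage => /=; apply: uS.
by case: (u) sc => //= v' u' _; rewrite mem_head.
Qed.

(** On a self-avoiding trail each step uses a direction, a survival bit and possibly a number of
    frogs at the new site, none of them read before; the factors therefore multiply exactly. *)
Lemma Pr_walk_event vis I A y g u c :
  (size c < size u)%N -> uniq (vis ++ trail y u) -> env_sigma I A ->
  (forall a b, (g.2 <= a)%N -> ~ I (inr ((g.1, a), b))) ->
  (forall j, I j -> index_site j \in vis) -> g.1.1 \in vis ->
  Pr (A `&` walk_event y g u c) =
  Pr A * (p / N%:R) ^+ size u * \prod_(i <- c) label_weight i.
Proof.
elim: u vis I A y g c => [//|v u IH] vis I A y g c /= sc uvis sA fg Ivis gvis.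
set y1 := y + step_vec v.
have vis1 : y1 \notin vis.
  move: uvis; rewrite cat_uniq => /and3P[_ /hasPn h _].
  by apply: h; rewrite mem_head.
have uvis1 : uniq ((y1 :: vis) ++ trail y1 u).
  move: uvis; rewrite -cat1s (@perm_uniq _ _ ((y1 :: vis) ++ trail y1 u))//.
  by rewrite perm_catCA.
pose I1 := I `|` [set inr (g, true)].
pose I2 := I1 `|` [set inr (g, false)].
pose I3 := I2 `|` [set inl y1].
have ni b : ~ I (inr (g, b)) by have := fg g.2 b (leqnn _); rewrite -surjective_pairing.
have sA1 : env_sigma I1 (A `&` dir_event g v).
  apply: env_sigmaI; first by apply: env_sigmaS sA => j; left.
  by apply: env_sigma_preimage; right.
have P1 : Pr (A `&` dir_event g v) = Pr A / N%:R by exact: (Pr_dir_event Xm Xind Xdir v sA).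
have sA2 : env_sigma I2 (A `&` dir_event g v `&` survival_event g).
  apply: env_sigmaI; first by apply: env_sigmaS sA1 => j; left.
  by apply: env_sigma_preimage; right.
have P2 : Pr (A `&` dir_event g v `&` survival_event g) = Pr A * (p / N%:R).
  rewrite (@env_sigma_indep _ _ _ _ _ _ Xm Xind I1 [set inr (g, false)])//.
  - rewrite P1 {2}/Pr /survival_event Xbit /=; ring.
  - by move=> j [Ij|->] /= jg; [rewrite jg in Ij; exact: ni Ij|].
  - exact: env_sigma_preimage.
have I2vis j : I2 j -> index_site j \in vis by move=> [[/Ivis//|->//]|->].
have sA3 : env_sigma I3 (A `&` dir_event g v `&` survival_event g `&` label_event y1 (head 0%N c)).
  apply: env_sigmaI; first by apply: env_sigmaS sA2 => j; left.
  by case: (head 0%N c) => [|i]; [exact: env_sigmaT|apply: env_sigma_preimage; right].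
have P3 : Pr (A `&` dir_event g v `&` survival_event g `&` label_event y1 (head 0%N c)) =
    Pr A * (p / N%:R) * label_weight (head 0%N c).
  rewrite (@env_sigma_indep _ _ _ _ _ _ Xm Xind I2 [set inl y1])//.
  - rewrite P2; congr (_ * _); case: (head 0%N c) => [|i]; first exact: PrT.
    by rewrite /Pr /= Xeta.
  - by move=> j /I2vis jv /= jy; rewrite jy /= (negbTE vis1) in jv.
  - by case: (head 0%N c) => [|i]; [exact: env_sigmaT|apply: env_sigma_preimage].
have I3vis j : I3 j -> index_site j \in y1 :: vis.
  by move=> [/I2vis h|-> /=]; rewrite in_cons ?eqxx// h orbT.
have E B : A `&` (dir_event g v `&` survival_event g `&` label_event y1 (head 0%N c) `&` B) =
   A `&` dir_event g v `&` survival_event g `&` label_event y1 (head 0%N c) `&` B.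
  by rewrite !setIA.
rewrite E; case: u IH sc uvis uvis1 => [|v' u] IH sc uvis uvis1.
  case: c sc {E I3vis P3 sA3 I3} => // _ /=.
  by rewrite !setIT P2 big_nil expr1 mulr1.
rewrite (IH (y1 :: vis) I3) //; last 3 first.
- by case: (c) sc.
- move=> a b; case: (head 0%N c) => [|i] /= ga; last first.
    move=> [/I2vis /=|//]; exact/negP.
  move=> [[[|[e]]|[e]]|//].
  + exact/fg/ltnW.
  + by move=> _; move: ga; rewrite -e ltnn.
  + by move=> _; move: ga; rewrite -e ltnn.
- by case: (head 0%N c) => [|i] /=; rewrite in_cons ?gvis ?eqxx ?orbT.
rewrite P3 [in RHS]exprS; case: (c) => [|c0 c'] /=; first by rewrite !big_nil; ring.
rewrite big_cons; ring.
Qed.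

(** [b] packs the frog started at [x], the code of the later changes of frog, and the directions. *)
Definition block_event (x : site d) (b : (nat * seq nat) * seq (direction d)) : set Om :=
  label_event x b.1.1.+1 `&` walk_event x ((x, b.1.1), 0%N) b.2 b.1.2.

Lemma block_event_measurable x b : measurable (block_event x b).
Proof.
by apply: measurableI; [exact: label_event_measurable|exact: walk_event_measurable].
Qed.

Lemma sub_block_event x b :
  block_event x b `<=` trail_event x ((x, b.1.1), 0%N) b.2 b.1.2.
Proof. by move=> w [_ /sub_walk_event]. Qed.

Lemma env_sigma_block_event (S : seq (site d)) x b :
  (size b.1.2 < size b.2)%N -> {subset belast x (trail x b.2) <= S} ->
  env_sigma [set j | index_site j \in S] (block_event x b).
Proof.
case: b => [[i c] u] /= sc uS.
have xS : x \in S by apply: uS; case: (u) sc => //= v u' _; rewrite mem_head.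
apply: env_sigmaI; first exact: env_sigma_preimage.
by apply: env_sigma_walk_event => // z /mem_behead /uS.
Qed.

Lemma Pr_block_event x i c u :
  (size c < size u)%N -> uniq (x :: trail x u) ->
  Pr (block_event x ((i, c), u)) =
  tail i * (p / N%:R) ^+ size u * \prod_(i <- c) label_weight i.
Proof.
move=> sc ux.
rewrite (@Pr_walk_event [:: x] [set inl x])//.
- by rewrite {1}/Pr /label_event Xeta.
- by apply: env_sigma_preimage.
- by move=> j -> /=; rewrite mem_head.
- by rewrite /= mem_head.
Qed.

End blocks.

(** * A bounded Green function in dimension four *)

Section green_function.
Context (R : realFieldType).

(** The law after [k] steps of the walk with steps [-1], [0], [1] of probabilities [1/4], [1/2],
    [1/4], a sum of [2k] fair half-steps. The absolute value expresses symmetry and keeps the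
    binomial index natural. *)
Definition lazy_binomial (k : nat) (j : int) : R :=
  'C(k.*2, k + absz j)%:R / 4 ^+ k.

Lemma lazy_binomialS k j : lazy_binomial k.+1 j =
  (lazy_binomial k (j - 1) + 2 * lazy_binomial k j + lazy_binomial k (j + 1)) / 4.
Proof.
rewrite /lazy_binomial.
suff -> : 'C(k.+1.*2, k.+1 + absz j) =
   ('C(k.*2, k + absz (j - 1)%R) + 2 * 'C(k.*2, k + absz j) + 'C(k.*2, k + absz (j + 1)%R))%N.
  rewrite 2!natrD natrM exprS; field.
  by rewrite expf_neq0// pnatr_eq0.
have pascal2 a : 'C(k.+1.*2, a.+2) = ('C(k.*2, a) + 2 * 'C(k.*2, a.+1) + 'C(k.*2, a.+2))%N.
  by rewrite doubleS !binS; lia.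
(* At the origin both neighbours have the same absolute value; the symmetry of the binomial row
   turns one of them into the entry that Pascal's rule asks for. *)
have [j0|j0] := eqVneq j 0.
  rewrite j0 (_ : absz (0 - 1)%R = 1%N)// (_ : absz (0 + 1)%R = 1%N)// absz0 !addn0 addn1.
  case: k pascal2 => [|k] pascal2; first by [].
  rewrite pascal2 (_ : 'C(k.+1.*2, k) = 'C(k.+1.*2, k.+2)); last first.
    by rewrite -[RHS]bin_sub; [congr 'C(_, _); lia|lia].
  by lia.
suff [i [-> [[-> ->]|[-> ->]]]] : exists i : nat, absz j = i.+1 /\
    ((absz (j - 1)%R = i /\ absz (j + 1)%R = i.+2) \/
     (absz (j - 1)%R = i.+2 /\ absz (j + 1)%R = i)).
- by rewrite addSnnS !addnS pascal2.
- by rewrite addSnnS !addnS pascal2 -addnA addnC [in LHS](addnC (2 * _)%N).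
clear pascal2; case: j j0 => [[//|i] _|i _]; exists i; split=> //.
  by left; split; lia.
by right; split; lia.
Qed.

Lemma lazy_binomial_max k j : lazy_binomial k j <= lazy_binomial k 0.
Proof.
rewrite /lazy_binomial ler_wpM2r ?invr_ge0// ler_nat /=.
elim: (`|j|%N) => [//|i IH]; apply: leq_trans IH; rewrite addnS.
rewrite -(@leq_pmul2l (k + i).+1)// mul_bin_left leq_mul2r.
by apply/orP; right; lia.
Qed.

(** The ratio of consecutive values is [(2i+1)/(2i+2)], and [(2k+1)(2k+3) <= (2k+2)^2] closes the
    induction. *)
Lemma lazy_binomial_decay k : (lazy_binomial k 0) ^+ 2 <= (2 * k + 1)%:R^-1.
Proof.
have rec i : lazy_binomial i.+1 0 = lazy_binomial i 0 * (2 * i + 1)%:R / (2 * i + 2)%:R.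
  rewrite /lazy_binomial /= !addn0 exprS.
  have e1 : ('C(i.+1.*2, i.+1) = 2 * 'C((i.*2).+1, i))%N.
    by have := mul_bin_diag i.+1.*2 i; rewrite doubleS/=; nia.
  have e2 : (i.+1 * 'C((i.*2).+1, i) = (2 * i + 1) * 'C(i.*2, i))%N.
    by have := mul_bin_down (i.*2).+1 i; rewrite /=; nia.
  have {}e2 : i.+1%:R * 'C((i.*2).+1, i)%:R = (2 * i + 1)%:R * 'C(i.*2, i)%:R :> R.
    by rewrite -!natrM e2.
  have i0 : i.+1%:R != 0 :> R by rewrite pnatr_eq0.
  have {}e2 : 'C((i.*2).+1, i)%:R = (2 * i + 1)%:R * 'C(i.*2, i)%:R / i.+1%:R :> R.
    by rewrite -e2 mulrAC divff// mul1r.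
  rewrite e1 natrM e2 (_ : 2 * i + 2 = 2 * i.+1)%N; last by lia.
  rewrite (natrM _ 2 i.+1); move: i0; move: (i.+1%:R : R) => a a0; field.
  by rewrite a0 expf_neq0// pnatr_eq0.
elim: k => [|k IH]; first by rewrite /lazy_binomial /= bin0 expr0 divr1 expr1n muln0 add0n invr1.
rewrite rec exprMn exprMn.
have k0 : 0 <= k%:R :> R by [].
apply: le_trans (_ : (2 * k + 1)%:R^-1 * (2 * k + 1)%:R ^+ 2 * ((2 * k + 2)%:R^-1) ^+ 2 <= _).
  by rewrite ler_wpM2r ?sqr_ge0// ler_wpM2r ?sqr_ge0.
rewrite -subr_ge0 !natrD !natrM -!natr1.
rewrite [leRHS](_ : _ = 1 / ((2 * (k%:R + 1) + 1) * (2 * k%:R + 2) ^+ 2)); last first.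
  by field; rewrite !gt_eqF//; lra.
by rewrite divr_ge0// mulr_ge0 ?exprn_ge0//; lra.
Qed.

(** The probability that the lazy walk started at [j] lies in [[-m, m]] after [k] steps. *)
Fixpoint smear (m : nat) (k : nat) (j : int) : R :=
  if k is k'.+1 then (smear m k' (j - 1) + 2 * smear m k' j + smear m k' (j + 1)) / 4
  else ((`|j| <= m%:Z)%R : bool)%:R.

Lemma smear_ge0 m k j : 0 <= smear m k j.
Proof. by elim: k j => [|k IH] j //=; rewrite divr_ge0// !addr_ge0// mulr_ge0. Qed.

Lemma smear_sum m k j : smear m k j = \sum_(i < m.*2.+1) lazy_binomial k (j - (i%:Z - m%:Z)).
Proof.
elim: k j => [|k IH] j /=.
  rewrite /lazy_binomial expr0.
  have [jm|jm] := boolP (`|j| <= m%:Z).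
    have hj : (`|(j + m%:Z)%R| < m.*2.+1)%N by lia.
    rewrite (bigD1 (Ordinal hj))//= big1 ?addr0.
      by rewrite (_ : j - _ = 0) ?absz0 ?bin0 ?divr1//; lia.
    move=> i; rewrite -(inj_eq val_inj)/= => ij.
    rewrite bin_small ?mul0r//.
    by move/eqP: ij; lia.
  rewrite big1// => i _; rewrite bin_small ?mul0r//.
  by have := ltn_ord i; lia.
rewrite !IH mulr_sumr -!big_split/= mulr_suml; apply: eq_bigr => i _.
rewrite lazy_binomialS.
by congr ((_ + _ + _) / _); congr lazy_binomial; ring.
Qed.

Lemma smear_le m k j : smear m k j <= m.*2.+1%:R * lazy_binomial k 0.
Proof.
rewrite smear_sum mulr_natl -[X in _ *+ X]card_ord -sumr_const.
by apply: ler_sum => i _; exact: lazy_binomial_max.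
Qed.

(** Per block, each class sum of the difference of two chains changes by a difference of two signs,
    so half of it makes a lazy step. The four coordinates move independently, hence the product. *)
Definition smear4 (m k : nat) (v : 'I_4 -> int) : R :=
  \prod_(c < 4) smear m k (v c %/ 2)%Z.

Lemma smear4_ge0 m k v : 0 <= smear4 m k v.
Proof. by rewrite /smear4 prodr_ge0// => c _; exact: smear_ge0. Qed.

(** Each factor is [O(k^(-1/2))]; four of them give a summable [k^(-2)], and the even number of
    factors avoids square roots. *)
Lemma smear4_le m k v : smear4 m k v <= m.*2.+1%:R ^+ 4 / (2 * k + 1)%:R ^+ 2.
Proof.
apply: (@le_trans _ _ (\prod_(c < 4) (m.*2.+1%:R * lazy_binomial k 0))).
  by apply: ler_prod => c _; rewrite smear_ge0 smear_le.
rewrite prodr_const card_ord exprMn ler_wpM2l ?exprn_ge0//.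
rewrite -exprVn (_ : 4 = 2 * 2)%N// exprM ler_pXn2r ?nnegrE ?sqr_ge0 ?invr_ge0//.
exact: lazy_binomial_decay.
Qed.

Definition green (m n : nat) (v : 'I_4 -> int) : R := \sum_(k < n) smear4 m k v.

Lemma green_ge0 m n v : 0 <= green m n v.
Proof. by rewrite /green sumr_ge0// => k _; exact: smear4_ge0. Qed.

Lemma green_le m n v : green m n v <= 3 * m.*2.+1%:R ^+ 4.
Proof.
apply: (@le_trans _ _ (\sum_(k < n) (m.*2.+1%:R ^+ 4 * ((2 * k + 1)%:R ^+ 2)^-1))).
  by apply: ler_sum => k _; exact: smear4_le.
rewrite -mulr_sumr mulrC ler_wpM2r ?exprn_ge0//.
(* The term [2 / (n+1)] is a telescoping slack that makes the induction close. *)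
suff : \sum_(k < n) ((2 * k + 1)%:R ^+ 2)^-1 <= 3 - 2 / n.+1%:R :> R.
  by move/le_trans; apply; rewrite gerBl divr_ge0.
elim: n => [|n IH]; first by rewrite big_ord0 divr1; lra.
rewrite big_ord_recr/= (le_trans (lerD IH (lexx _)))//.
have n0 : 0 <= n%:R :> R by [].
rewrite natrD natrM -!natr1 -subr_ge0.
rewrite [leRHS](_ : _ = (7 * n%:R ^+ 2 + 5 * n%:R) /
   ((n%:R + 1) * (n%:R + 1 + 1) * (2 * n%:R + 1) ^+ 2)); last first.
  by field; rewrite !gt_eqF//; lra.
by rewrite divr_ge0 ?mulr_ge0 ?addr_ge0 ?mulr_ge0 ?exprn_ge0 ?addr_ge0 ?mulr_ge0.
Qed.

(* Half the difference of two independent +-1 steps is a lazy step. *)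
Lemma smear_step m k (a : int) :
  (smear m k ((a + 1 - 1) %/ 2)%Z + smear m k ((a + 1 - -1) %/ 2)%Z
  + (smear m k ((a - 1 - 1) %/ 2)%Z + smear m k ((a - 1 - -1) %/ 2)%Z)) / 4
  = smear m k.+1 (a %/ 2)%Z.
Proof.
have -> : a + 1 - 1 = a by rewrite addrK.
have -> : a - 1 - -1 = a by rewrite opprK subrK.
have -> : ((a + 1 - -1)%R %/ 2)%Z = (a %/ 2)%Z + 1 by lia.
have -> : ((a - 1 - 1)%R %/ 2)%Z = (a %/ 2)%Z - 1 by lia.
rewrite [in RHS]/smear -/smear.
ring.
Qed.

End green_function.

(** * Second moment of the number of chains *)

Section paley_zygmund.
Context (R : realType) (disp : measure_display)
  (Om : measurableType disp) (P : probability Om R).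
Local Notation Pr := (Pr P).

Lemma integral_sum_indic (T : Type) (s : seq T) (E : T -> set Om) :
  (forall t, measurable (E t)) ->
  (\int[P]_w (\sum_(t <- s) (\1_(E t) w)%:E) = (\sum_(t <- s) Pr (E t))%:E)%E.
Proof.
move=> mE; rewrite ge0_integral_sum//.
  rewrite -sumEFin; apply: eq_bigr => t _.
  by rewrite integral_indic// setIT PrE.
by move=> t; apply/measurable_EFinP; exact: measurable_indic.
Qed.

(* Cauchy-Schwarz, in the form 2 a S <= a^2 P(U) + Q for all a >= 0, so that no
   square-integrability has to be discussed. *)
Lemma second_moment_method (T : Type) (s : seq T) (E : T -> set Om) (U : set Om) :
  (forall t, measurable (E t)) -> measurable U ->
  U = \big[setU/set0]_(t <- s) E t ->
  (\sum_(t <- s) Pr (E t)) ^+ 2 <=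
  Pr U * \sum_(t <- s) \sum_(t' <- s) Pr (E t `&` E t').
Proof.
move=> mE mU UE; set S := \sum_(t <- s) Pr (E t); set Q := \sum_(t <- s) \sum_(t' <- s) Pr (E t `&` E t').
have mEE t t' : measurable (E t `&` E t') by exact: measurableI.
have S0 : 0 <= S by apply: sumr_ge0 => t _; exact: Pr_ge0.
have p0 : 0 <= Pr U := Pr_ge0 _ _.
have U0 w : ~ U w -> \sum_(t <- s) \1_(E t) w = 0 :> R.
  rewrite UE; elim: (s) => [|t s' IH]; rewrite !(big_nil, big_cons)// => h.
  rewrite IH ?addr0; last by move=> h'; apply: h; right.
  by rewrite indicE memNset// => h'; apply: h; left.
have key a : 0 <= a -> 2 * a * S <= a ^+ 2 * Pr U + Q.
  move=> a0.
  have : (\int[P]_w (\sum_(t <- s) (2 * a)%:E * (\1_(E t) w)%:E) <=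
      \int[P]_w ((a ^+ 2)%:E * (\1_U w)%:E + \sum_(t <- s) \sum_(t' <- s) (\1_(E t `&` E t') w)%:E))%E.
    apply: ge0_le_integral => //.
    - move=> w _; apply: sume_ge0 => t _; by rewrite -EFinM lee_fin !mulr_ge0.
    - apply: emeasurable_sum => t; apply: measurable_funeM.
      by apply/measurable_EFinP; exact: measurable_indic.
    - apply: emeasurable_funD.
        apply: measurable_funeM.
        by apply/measurable_EFinP; exact: measurable_indic.
      apply: emeasurable_sum => t; apply: emeasurable_sum => t'.
      by apply/measurable_EFinP; apply: measurable_indic; exact: measurableI.
    - move=> w _.
      rewrite -ge0_sume_distrr; last by move=> t _; rewrite lee_fin.
      under [X in (_ <= _ + X)%E]eq_bigr do rewrite sumEFin.
      rewrite !sumEFin -!EFinM -EFinD lee_fin.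
      have -> : \sum_(t <- s) \sum_(t' <- s) \1_(E t `&` E t') w =
          (\sum_(t <- s) \1_(E t) w) ^+ 2 :> R.
        rewrite expr2 mulr_suml; apply: eq_bigr => t _.
        by rewrite mulr_sumr; apply: eq_bigr => t' _; rewrite indicI.
      have [Uw|/U0 ->] := pselect (U w); last by rewrite mulr0 expr0n/= addr0 mulr_ge0 ?sqr_ge0//.
      rewrite indicE mem_set// mulr1; move: (\sum_(t <- s) _) => y.
      by have := sqr_ge0 (a - y); nra.
  rewrite ge0_integralD//; first last.
  - apply: emeasurable_sum => t; apply: emeasurable_sum => t'.
    by apply/measurable_EFinP; apply: measurable_indic; exact: measurableI.
  - by move=> w _; apply: sume_ge0 => t _; apply: sume_ge0 => t' _; rewrite lee_fin.
  - by apply: measurable_funeM; apply/measurable_EFinP; exact: measurable_indic.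
  - by move=> w _; rewrite -EFinM lee_fin mulr_ge0 ?sqr_ge0//.
  rewrite ge0_integralZl//; first last.
  - by rewrite lee_fin sqr_ge0.
  - by apply/measurable_EFinP; exact: measurable_indic.
  have -> : (\int[P]_w (\1_U w)%:E = (Pr U)%:E)%E by rewrite integral_indic// setIT PrE.
  under [X in (X <= _)%E]eq_integral.
    move=> w _; rewrite -ge0_sume_distrr; last by move=> t _; rewrite lee_fin.
    over.
  rewrite /= ge0_integralZl//; first last.
  - by rewrite lee_fin mulr_ge0.
  - by move=> w _; apply: sume_ge0 => t _; rewrite lee_fin.
  - by apply: emeasurable_sum => t; apply/measurable_EFinP; exact: measurable_indic.
  rewrite integral_sum_indic//.
  rewrite ge0_integral_sum//; first last.
  - by move=> t w _; apply: sume_ge0 => t' _; rewrite lee_fin.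
  - move=> t; apply: emeasurable_sum => t'.
    by apply/measurable_EFinP; apply: measurable_indic; exact: measurableI.
  under [X in (_ <= _ + X)%E]eq_bigr => t _ do rewrite (integral_sum_indic _ (mEE t)).
  by rewrite sumEFin -!EFinM -EFinD lee_fin.
(* If [U] is null, [a = Q / S] forces [Q = 0], and then [a = 1] contradicts [S > 0]; otherwise the
   optimal choice is [a = S / Pr U]. *)
have [pz|pz] := eqVneq (Pr U) 0.
  have : S <= 0; last by move=> S1; rewrite (_ : S = 0) ?expr0n ?pz ?mul0r//; lra.
  have Q0 : 0 <= Q by apply: sumr_ge0 => t _; apply: sumr_ge0 => t' _; exact: Pr_ge0.
  rewrite leNgt; apply/negP => S1.
  have := key (Q / S); rewrite pz mulr0 add0r => /(_ (divr_ge0 Q0 S0)).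
  have -> : 2 * (Q / S) * S = 2 * Q by field; rewrite gt_eqF.
  move=> Q1; have {}Q0 : Q = 0 by lra.
  by have := key 1 ler01; rewrite pz Q0; lra.
have {}pz : 0 < Pr U by rewrite lt_neqAle eq_sym pz.
have := key (S / Pr U) (divr_ge0 S0 p0).
have -> : 2 * (S / Pr U) * S = 2 * (S ^+ 2 / Pr U) by ring.
have -> : (S / Pr U) ^+ 2 * Pr U = S ^+ 2 / Pr U by field; rewrite gt_eqF.
move=> h; have : S ^+ 2 / Pr U <= Q by lra.
by rewrite ler_pdivrMr// mulrC.
Qed.

End paley_zygmund.

Lemma ler_sum_sub (R : numDomainType) (T : eqType) (s s' : seq T) (F : T -> R) :
  uniq s -> {subset s <= s'} -> (forall t, 0 <= F t) ->
  \sum_(t <- s) F t <= \sum_(t <- s') F t.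
Proof.
elim: s s' => [|t s IH] s' /=; first by rewrite big_nil => _ _ h; apply: sumr_ge0.
move=> /andP[ts us] ss' F0.
have p : perm_eq s' (t :: rem t s') by apply/perm_to_rem/ss'; rewrite mem_head.
rewrite (perm_big _ p)/= !big_cons lerD2l IH// => z zs.
have zt : z != t by apply: contraNneq ts => <-.
have := ss' z; rewrite in_cons zs orbT => /(_ isT).
by rewrite (perm_mem p) in_cons (negbTE zt).
Qed.

Lemma abs_half_le (a b c : int) (n : nat) :
  `|c - a| <= n%:Z -> `|c - b| <= n%:Z -> `|((b - a)%R %/ 2)%Z| <= n%:Z.
Proof. lia. Qed.

Lemma abs_step_le (a b c : int) (n : nat) :
  `|c - b| <= n%:Z -> `|b - a| <= 1 -> `|c - a| <= n.+1%:Z.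
Proof. lia. Qed.

Section second_moment.
Context (R : realType) (d : nat) (disp : measure_display)
  (Om : measurableType disp) (P : probability Om R)
  (X : env_index d -> Om -> nat) (dir_of : nat -> direction d).
Hypothesis Xm : forall j B, measurable (X j @^-1` B).
Hypothesis Xind : forall (I : choiceType) (g : env_index d -> I),
  indep_families P (fun i => <<s \bigcup_(j in [set j | g j = i]) sigma_discrete (X j) >>).
Let N := #|{: direction d}|.
Hypothesis Xdir : forall g (v : direction d),
  P (X (inr (g, true)) @^-1` [set k | dir_of k = v]) = ((N%:R : R)^-1)%:E.
Hypothesis N_gt0 : (0 < N)%N.
Variable p : R.
Hypothesis Xbit : forall g, P (X (inr (g, false)) @^-1` [set k | k != 0%N]) = p%:E.
Variable tail : nat -> R.
Hypothesis Xeta : forall x i, P (X (inl x) @^-1` [set k | (i < k)%N]) = (tail i)%:E.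

Variables (M L : nat) (U : seq (seq (direction d))).
Hypothesis U_uniq : uniq U.
Hypothesis U_size : forall u, u \in U -> size u = L.+1.
Hypothesis U_simple : forall u x, u \in U -> uniq (x :: trail x u).
Variable level : site d -> int.
Hypothesis U_level : forall u x z, u \in U -> z \in belast x (trail x u) ->
  level z = level x.
Hypothesis U_level_end : forall u x, u \in U ->
  level (x + displacement u) = level x + 1.
Variable phi : 'I_4 -> site d -> int.
Hypothesis phiB : forall c x y, phi c (x - y) = phi c x - phi c y.
Hypothesis phi_step : forall c v, `|phi c (step_vec v)| <= 1.
(** Under a uniform choice in [U], the four class sums of the displacement are independent fair
    signs. *)
Hypothesis U_phi : forall f : 'I_4 -> int -> R,
  \sum_(u <- U) \prod_(c < 4) f c (phi c (displacement u)) =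
  (size U)%:R * \prod_(c < 4) ((f c 1 + f c (-1)) / 2).

Local Notation Pr := (Pr P).
Local Notation env_sigma := (env_sigma X).
Local Notation trail_event := (trail_event X dir_of).
Local Notation dirs := (enum {: direction d}).
Local Notation walks n := (words dirs n).
Local Notation block_event := (block_event X dir_of).

Definition codes : seq (nat * seq nat) :=
  [seq (i, c) | i <- iota 0 M, c <- words (iota 0 M.+1) L].

Definition blocks : seq ((nat * seq nat) * seq (direction d)) :=
  [seq (k, u) | k <- codes, u <- U].

Definition code_weight (k : nat * seq nat) : R :=
  tail k.1 * \prod_(i <- k.2) label_weight tail i.

Let r : R := (p / N%:R) ^+ L.+1.
Definition growth : R := (\sum_(k <- codes) code_weight k) * r * (size U)%:R.
Local Notation lambda := growth.

(** Blocks that meet start within [2 * L.+1] of each other in each class sum, hence within [m] after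
    halving. *)
Let m := L.+1.
(** [CG] bounds the Green function, so [eps] makes its contribution at most [1]. [A] is to absorb
    pairs of blocks from one site, and [T] bounds all contributions together. *)
Let CG : R := 3 * m.*2.+1%:R ^+ 4.
Let eps : R := CG^-1.
Let A : R := 2 * (size codes)%:R ^+ 2.
Let T : R := 2 + A.
Let Cb : R := (collision_bound L.+1 2)%:R.
Hypothesis lambda_ge2 : 2 <= lambda.
Hypothesis N_large1 : (size codes)%:R ^+ 2 * T * Cb / N%:R <= 4 * eps.
Hypothesis N_large2 : T * Cb / N%:R <= 2.

Let NR_gt0 : 0 < N%:R :> R. Proof. by rewrite ltr0n. Qed.
Let CG_gt0 : 0 < CG. Proof. by rewrite mulr_gt0// exprn_gt0. Qed.
Let eps_gt0 : 0 < eps. Proof. by rewrite invr_gt0. Qed.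
Let A_ge0 : 0 <= A. Proof. by rewrite mulr_ge0// exprn_ge0. Qed.

Lemma codes_uniq : uniq codes.
Proof.
apply: allpairs_uniq; rewrite ?iota_uniq// ?words_uniq ?iota_uniq//.
by move=> [? ?] [? ?] /= _ _ [-> ->].
Qed.

Lemma code_size k : k \in codes -> size k.2 = L.
Proof.
by move=> /allpairsP[[i c] [_ /=]]; rewrite mem_words => /andP[/eqP <- _] ->.
Qed.

Lemma U_walks : {subset U <= walks L.+1}.
Proof.
move=> u uU; rewrite mem_words U_size// eqxx/=; apply/allP => v _.
by rewrite /= mem_enum.
Qed.

Lemma Pr_block x k u : k \in codes -> u \in U ->
  Pr (block_event x (k, u)) = code_weight k * r.
Proof.
move=> kc uU; case: k kc => i c kc.
rewrite (Pr_block_event Xm Xind Xdir Xbit Xeta)/=; first last.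
- exact: U_simple.
- by rewrite (code_size kc) U_size.
by rewrite U_size// /code_weight /r /=; ring.
Qed.

Lemma sum_Pr_block x : \sum_(b <- blocks) Pr (block_event x b) = lambda.
Proof.
rewrite /blocks big_allpairs_dep /growth -mulrA mulr_suml.
rewrite big_seq [RHS]big_seq; apply: eq_bigr => k kc.
rewrite big_seq (eq_bigr (fun=> code_weight k * r)) => [|u uU]; last exact: Pr_block.
by rewrite -big_seq big_const_seq iter_addr_0 count_predT -[LHS]mulr_natr mulrA.
Qed.

Lemma trail_event_disjoint y g c u u' : size u = size u' -> u != u' ->
  trail_event y g u c `&` trail_event y g u' c = set0.
Proof.
elim: u u' y g c => [|v u IH] [|v' u'] y g c //= [su].
rewrite eqseq_cons negb_and; case: (eqVneq v v') => [->|vv'] /= uu'.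
  by rewrite setIACA IH// setI0.
by rewrite setIACA dir_event_disjoint// set0I.
Qed.

(* Bounds the second moment of chains started at distance z, in units of the
   squared first moment: the Green function pays for the blocks that start near
   each other, A for those that start at the same site. *)
Definition weight_fun (n : nat) (z : site d) : R :=
  1 + eps * green R m n (phi ^~ z) + (if z == 0 then A else 0).

Lemma eps_green_le1 n z : eps * green R m n (phi ^~ z) <= 1.
Proof.
rewrite /eps mulrC ler_pdivrMr// mul1r; exact: green_le.
Qed.

Lemma eps_green_ge0 n z : 0 <= eps * green R m n (phi ^~ z).
Proof. by rewrite mulr_ge0 ?green_ge0// ltW. Qed.

Lemma weight_fun_le n z : weight_fun n z <= T.
Proof.
rewrite /weight_fun /T; move: (eps_green_le1 n z) A_ge0.
by move: (eps * _) A => e a e1 a0; case: ifP => _; lra.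
Qed.

Lemma weight_fun_ge1 n z : 1 <= weight_fun n z.
Proof.
rewrite /weight_fun; move: (eps_green_ge0 n z) A_ge0.
by move: (eps * _) A => e a e1 a0; case: ifP => _; lra.
Qed.

(** Averaging over two independent blocks moves each halved difference by one lazy step, and the
    product form lets the four coordinates be averaged separately. *)
Lemma smear4_average k z :
  \sum_(u <- U) \sum_(u' <- U)
     smear4 R m k (phi ^~ (z + displacement u' - displacement u)) =
  (size U)%:R ^+ 2 * smear4 R m k.+1 (phi ^~ z).
Proof.
pose f (t : int) (c : 'I_4) (a : int) := smear R m k ((phi c z + a - t) %/ 2)%Z.
have phiD c x y : phi c (x + y) = phi c x + phi c y.
  by have := phiB c (x + y) y; rewrite addrK => ->; rewrite subrK.
have E1 u : \sum_(u' <- U) smear4 R m k (phi ^~ (z + displacement u' - displacement u)) =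
   (size U)%:R * \prod_(c < 4) ((f (phi c (displacement u)) c 1 + f (phi c (displacement u)) c (-1)) / 2).
  rewrite -(U_phi (fun c => f (phi c (displacement u)) c)); apply: eq_bigr => u' _.
  by apply: eq_bigr => c _; rewrite /f phiB phiD.
under eq_bigr do rewrite E1.
rewrite -mulr_sumr (U_phi (fun c t => (f t c 1 + f t c (-1)) / 2)) mulrA -expr2.
congr (_ * _); apply: eq_bigr => c _; rewrite -smear_step /f; by field.
Qed.

(** The shift of the time index keeps all terms of [green] except the one at time [0], the indicator
    that the blocks start near each other. This missing term is the gain that pays for
    collisions. *)
Lemma green_average n z :
  \sum_(u <- U) \sum_(u' <- U)
     green R m n (phi ^~ (z + displacement u' - displacement u)) =
  (size U)%:R ^+ 2 * (green R m n.+1 (phi ^~ z) - smear4 R m 0 (phi ^~ z)).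
Proof.
rewrite /green big_ord_recl /= addrAC subrr add0r mulr_sumr.
under eq_bigr do rewrite exchange_big/=.
rewrite exchange_big/=; apply: eq_bigr => k _.
by rewrite smear4_average.
Qed.

Lemma phi_trail c u x z : z \in x :: trail x u -> `|phi c z - phi c x| <= (size u)%:Z.
Proof.
elim: u x z => [|v u IH] x z; first by rewrite inE => /eqP ->; rewrite subrr normr0.
rewrite in_cons => /predU1P[->|]; first by rewrite subrr normr0.
move=> /IH h; have := phi_step c v.
have -> : step_vec v = (x + step_vec v) - x by rewrite addrC addKr.
rewrite phiB; exact: abs_step_le h.
Qed.

Lemma collision_near x x' u u' : u \in U -> u' \in U ->
  ~~ uniq ((x :: trail x u) ++ (x' :: trail x' u')) ->
  smear4 R m 0 (phi ^~ (x' - x)) = 1.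
Proof.
move=> uU u'U; rewrite cat_uniq !U_simple// andbT andTb negbK => /hasP[z z2 z1].
rewrite /smear4 big1// => c _ /=.
have h1 := phi_trail c z1; have h2 := phi_trail c z2.
rewrite phiB; rewrite U_size// in h1; rewrite U_size// in h2.
by rewrite (abs_half_le h1 h2).
Qed.

Lemma Pr_blocks_indep x x' k k' u u' :
  k \in codes -> k' \in codes -> u \in U -> u' \in U ->
  uniq ((x :: trail x u) ++ (x' :: trail x' u')) ->
  Pr (block_event x (k, u) `&` block_event x' (k', u')) =
  code_weight k * r * (code_weight k' * r).
Proof.
move=> kc k'c uU u'U un.
rewrite -(Pr_block x kc uU) -(Pr_block x' k'c u'U).
apply: (@env_sigma_indep _ _ _ _ _ _ Xm Xind
   [set j | index_site j \in x :: trail x u]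
   [set j | index_site j \in x' :: trail x' u']).
- move=> j /= j1 j2; move: un; rewrite cat_uniq => /and3P[_ /hasPn h _].
  by have := h _ j2; rewrite /= j1.
- apply: env_sigma_block_event => /=; first by rewrite (code_size kc) U_size.
  by move=> z /mem_belast.
- apply: env_sigma_block_event => /=; first by rewrite (code_size k'c) U_size.
  by move=> z /mem_belast.
Qed.

Lemma code_weight_r_ge0 k : k \in codes -> U != [::] -> 0 <= code_weight k * r.
Proof.
case: U U_simple U_size Pr_block => // u U' _ _ PB kc _.
by rewrite -(PB 0 k u kc (mem_head _ _)) Pr_ge0.
Qed.

Lemma U_neq0 : U != [::].
Proof.
apply/eqP => U0; have := lambda_ge2.
by rewrite /growth U0 /= mulr0 lern0.
Qed.

Lemma Pr_blocks_le x x' k k' u u' :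
  Pr (block_event x (k, u) `&` block_event x' (k', u')) <=
  Pr (trail_event x ((x, k.1), 0%N) u k.2 `&` trail_event x' ((x', k'.1), 0%N) u' k'.2).
Proof.
apply: le_Pr.
- by apply: measurableI; exact: block_event_measurable.
- by apply: measurableI; exact: trail_event_measurable.
- by apply: setISS => w /sub_block_event.
Qed.

(** Pairs with disjoint trails are independent and end at different sites, so only the Green part of
    the weight occurs and is averaged. Intersecting pairs occur only for near starts, where [smear4]
    at time [0] is [1]; their total probability is at most [Cb / N] and their weight at most [T]. *)
Lemma code_pair_distinct n x x' k k' : x != x' -> k \in codes -> k' \in codes ->
  \sum_(u <- U) \sum_(u' <- U)
    Pr (block_event x (k, u) `&` block_event x' (k', u')) *
    weight_fun n ((x' - x) + displacement u' - displacement u) <=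
  code_weight k * r * (code_weight k' * r) * (size U)%:R ^+ 2 *
    (1 + eps * (green R m n.+1 (phi ^~ (x' - x)) - smear4 R m 0 (phi ^~ (x' - x))))
  + T * Cb / N%:R * smear4 R m 0 (phi ^~ (x' - x)).
Proof.
move=> xx' kc k'c; set w := code_weight k * r * _.
have w0 : 0 <= w by rewrite mulr_ge0// code_weight_r_ge0// U_neq0.
set z := x' - x; set sm := smear4 _ _ _ _.
pose PT u u' := Pr (trail_event x ((x, k.1), 0%N) u k.2 `&` trail_event x' ((x', k'.1), 0%N) u' k'.2).
pose bad u u' := ~~ uniq ((x :: trail x u) ++ (x' :: trail x' u')).
have T0 : 0 <= T by rewrite addr_ge0.
have sm0 : 0 <= sm by exact: smear4_ge0.
apply: (@le_trans _ _ (\sum_(u <- U) \sum_(u' <- U)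
   (w * (1 + eps * green R m n (phi ^~ (z + displacement u' - displacement u)))
    + sm * (T * (if bad u u' then PT u u' else 0))))).
  rewrite big_seq [leRHS]big_seq; apply: ler_sum => u uU.
  rewrite big_seq [leRHS]big_seq; apply: ler_sum => u' u'U.
  have g0 := eps_green_ge0 n (z + displacement u' - displacement u).
  case: ifPn => [b|].
    rewrite -[leLHS]add0r lerD//; first by rewrite mulr_ge0// addr_ge0.
    rewrite /sm (collision_near uU u'U b) mul1r mulrC.
    apply: ler_pM; rewrite ?Pr_ge0 ?(le_trans ler01 (weight_fun_ge1 _ _))//.
      exact: weight_fun_le.
    exact: Pr_blocks_le.
  rewrite /bad negbK => un; rewrite !mulr0 addr0 Pr_blocks_indep//.
  rewrite -/w ler_wpM2l// /weight_fun ifN ?addr0//.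
  apply: contraTneq un => e0.
  have e : x' + displacement u' = x + displacement u.
    by apply/eqP; rewrite -subr_eq0 opprD addrACA addrA; apply/eqP.
  have := last_trail x' u'; rewrite e -last_trail => h.
  have su : size (trail x u) != 0%N by rewrite size_trail U_size.
  have su' : size (trail x' u') != 0%N by rewrite size_trail U_size.
  rewrite cat_uniq; apply/negP => /and3P[_ /hasPn hh _].
  have := hh (last x' (trail x' u')) (mem_last _ _).
  by rewrite /= h mem_last.
under eq_bigr do rewrite big_split/= -!mulr_sumr.
rewrite big_split/= -!mulr_sumr; apply: lerD.
  rewrite -mulrA ler_wpM2l//.
  under eq_bigr do rewrite big_split/= big_const_seq iter_addr_0 count_predT -mulr_sumr.
  rewrite big_split/= big_const_seq iter_addr_0 count_predT -mulr_sumr green_average.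
  by rewrite le_eqVlt; apply/orP; left; apply/eqP; rewrite -/sm -[_ *+ size U]mulr_natr; ring.
rewrite mulrC ler_wpM2r// -[leRHS]mulrA ler_wpM2l//.
apply: le_trans (collision_sites Xm Xind Xdir N_gt0 L.+1 k.1 k'.1 k.2 k'.2 xx').
apply: (@le_trans _ _ (\sum_(u <- U) \sum_(u' <- walks L.+1) (if bad u u' then PT u u' else 0))).
  apply: ler_sum => u _; apply: ler_sum_sub => //; first exact: U_walks.
  by move=> u'; case: ifP => // _; exact: Pr_ge0.
apply: ler_sum_sub => //; first exact: U_walks.
by move=> u; apply: sumr_ge0 => u' _; case: ifP => // _; exact: Pr_ge0.
Qed.

(** With the same code two different words are incompatible, so only the diagonal remains. *)
Lemma code_pair_same n x k : k \in codes ->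
  \sum_(u <- U) \sum_(u' <- U)
    Pr (block_event x (k, u) `&` block_event x (k, u')) *
    weight_fun n (displacement u' - displacement u) <=
  code_weight k * r * (size U)%:R * T.
Proof.
move=> kc.
have T0 : 0 <= T by rewrite addr_ge0.
apply: (@le_trans _ _ (\sum_(u <- U) code_weight k * r * T)); last first.
  by rewrite big_const_seq iter_addr_0 count_predT -[leLHS]mulr_natr mulrAC.
rewrite big_seq [leRHS]big_seq; apply: ler_sum => u uU.
rewrite (bigD1_seq u)//= setIid Pr_block// [X in _ + X]big_seq_cond [X in _ + X]big1 ?addr0.
  by rewrite ler_wpM2l ?weight_fun_le// code_weight_r_ge0// U_neq0.
move=> u' /andP[u'U u'u].
suff -> : block_event x (k, u) `&` block_event x (k, u') = set0 by rewrite Pr0 mul0r.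
rewrite -subset0 -(@trail_event_disjoint x ((x, k.1), 0%N) k.2 u u').
- by apply: setISS => w /sub_block_event.
- by rewrite !U_size.
- by rewrite eq_sym.
Qed.

(** Different codes bring in different frogs, which reach the same end only with probability
    [Cb / N]; all other pairs have weight at most [2] and total probability at most [1]. *)
Lemma code_pair_other n x k k' : k \in codes -> k' \in codes -> k != k' ->
  \sum_(u <- U) \sum_(u' <- U)
    Pr (block_event x (k, u) `&` block_event x (k', u')) *
    weight_fun n (displacement u' - displacement u) <=
  T * Cb / N%:R + 2.
Proof.
move=> kc k'c kk'.
have T0 : 0 <= T by rewrite addr_ge0.
pose PT u u' := Pr (trail_event x ((x, k.1), 0%N) u k.2 `&` trail_event x ((x, k'.1), 0%N) u' k'.2).
apply: (@le_trans _ _ (\sum_(u <- U) \sum_(u' <- U)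
   (T * (if displacement u == displacement u' then PT u u' else 0) + 2 * PT u u'))).
  apply: ler_sum => u _; apply: ler_sum => u' _.
  have PT0 : 0 <= PT u u' by exact: Pr_ge0.
  have h : Pr (block_event x (k, u) `&` block_event x (k', u')) <= PT u u' by exact: Pr_blocks_le.
  case: ifPn => [e|e].
    rewrite -[leLHS]addr0 lerD ?mulr_ge0// mulrC.
    by apply: ler_pM; rewrite ?Pr_ge0 ?weight_fun_le ?(le_trans ler01 (weight_fun_ge1 _ _)).
  rewrite mulr0 add0r mulrC.
  apply: ler_pM; rewrite ?Pr_ge0 ?(le_trans ler01 (weight_fun_ge1 _ _))//.
  rewrite /weight_fun ifN; last by rewrite subr_eq0 eq_sym.
  by rewrite addr0 -[leRHS]/(1 + 1) lerD2l eps_green_le1.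
under eq_bigr do rewrite big_split/= -!mulr_sumr.
rewrite big_split/= -!mulr_sumr; apply: lerD; last first.
  rewrite -[leRHS]mulr1 ler_wpM2l//.
  rewrite -(PrT P).
  apply: le_trans (sum_trail_event2 P dir_of Xm x ((x, k.1), 0%N) k.2 L.+1 x ((x, k'.1), 0%N) k'.2 L.+1 measurableT).
  rewrite [leRHS](_ : _ = \sum_(u <- walks L.+1) \sum_(u' <- walks L.+1) PT u u'); last first.
    by apply: eq_bigr => u _; apply: eq_bigr => u' _; rewrite setTI.
  apply: (@le_trans _ _ (\sum_(u <- U) \sum_(u' <- walks L.+1) PT u u')).
    by apply: ler_sum => u _; apply: ler_sum_sub => [//||u']; [exact: U_walks|exact: Pr_ge0].
  apply: ler_sum_sub => [//||u]; first exact: U_walks.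
  by apply: sumr_ge0 => u' _; exact: Pr_ge0.
rewrite -mulrA ler_wpM2l//.
apply: (@le_trans _ _ (\sum_(u <- walks L.+1) \sum_(u' <- walks L.+1)
    (if displacement u == displacement u' then PT u u' else 0))).
  apply: (@le_trans _ _ (\sum_(u <- U) \sum_(u' <- walks L.+1)
      (if displacement u == displacement u' then PT u u' else 0))).
    apply: ler_sum => u _; apply: ler_sum_sub => [//||u']; first exact: U_walks.
    by case: ifP => // _; exact: Pr_ge0.
  apply: ler_sum_sub => [//||u]; first exact: U_walks.
  by apply: sumr_ge0 => u' _; case: ifP => // _; exact: Pr_ge0.
apply: (@le_trans _ _ ((collision_bound L.+1 1)%:R / N%:R)); last first.
  by rewrite ler_wpM2r ?invr_ge0// ler_nat collision_bound_mono.
case: k k' kc k'c kk' @PT => [i c] [i' c'] kc k'c kk' /=.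
have [ii'|ii'] := eqVneq i i'; last exact: (collision_labels Xm Xind Xdir N_gt0).
have cc' : c != c' by apply: contraNneq kk' => ->; rewrite ii'.
have := @collision_join _ _ _ _ _ _ _ Xm Xind Xdir N_gt0 L x ((x, i), 0%N) c c' [:: x] set0 setT.
rewrite PrT mul1r ii' => H; apply: le_trans (H _ _ _ _ _ _ _ _).
- by apply: ler_sum => u _; apply: ler_sum => u' _; rewrite setTI.
- exact: (code_size kc).
- exact: (code_size k'c).
- exact: cc'.
- exact: env_sigmaT.
- by [].
- by move=> a _.
- by [].
- by rewrite /= mem_head.
Qed.

Lemma sum_blocks (F : (nat * seq nat) * seq (direction d) -> (nat * seq nat) * seq (direction d) -> R) :
  \sum_(b <- blocks) \sum_(b' <- blocks) F b b' =
  \sum_(k <- codes) \sum_(k' <- codes) \sum_(u <- U) \sum_(u' <- U) F (k, u) (k', u').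
Proof.
rewrite /blocks big_allpairs_dep; apply: eq_bigr => k _.
under eq_bigr do rewrite big_allpairs_dep.
by rewrite exchange_big.
Qed.

Lemma sum_code_weight : \sum_(k <- codes) code_weight k * r = lambda / (size U)%:R.
Proof.
rewrite -mulr_suml /growth mulfK// pnatr_eq0 size_eq0; exact: U_neq0.
Qed.

(** The inductive step of the second moment: [weight_fun] is a supersolution. For distinct starts
    [N_large1] bounds the collision error by [lambda ^+ 2 * eps] times the term lost in
    [green_average]. For equal starts the diagonal grows only like [lambda] and the pairs of
    different codes contribute a constant, which [A] absorbs. *)
Lemma block_step n x x' :
  \sum_(b <- blocks) \sum_(b' <- blocks)
    Pr (block_event x b `&` block_event x' b') *
    weight_fun n ((x' + displacement b'.2) - (x + displacement b.2)) <=
  lambda ^+ 2 * weight_fun n.+1 (x' - x).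
Proof.
rewrite sum_blocks.
have lam0 : 0 <= lambda by exact: le_trans lambda_ge2.
have T0 : 0 <= T by rewrite addr_ge0.
have natmul2 (a : R) k : a *+ k *+ k = a * k%:R ^+ 2.
  by rewrite -mulrnA -[LHS]mulr_natr natrM expr2.
have U0 : (size U)%:R != 0 :> R by rewrite pnatr_eq0 size_eq0; exact: U_neq0.
have l4 : 4 <= lambda ^+ 2.
  rewrite (_ : 4 = 2 ^+ 2); last by rewrite expr2; ring.
  by rewrite lerXn2r ?nnegrE.
have [xx'|xx'] := eqVneq x x'.
  rewrite -xx' subrr.
  apply: (@le_trans _ _ (\sum_(k <- codes) \sum_(k' <- codes)
     ((if k' == k then code_weight k * r * (size U)%:R * T else 0) + (T * Cb / N%:R + 2)))).
    rewrite big_seq [leRHS]big_seq; apply: ler_sum => k kc.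
    rewrite big_seq [leRHS]big_seq; apply: ler_sum => k' k'c.
    under eq_bigr do under eq_bigr do rewrite /= opprD addrACA subrr add0r.
    have c0 : 0 <= T * Cb / N%:R + 2 by rewrite addr_ge0// divr_ge0// mulr_ge0.
    case: eqVneq => [->|kk'].
      by rewrite -[leLHS]addr0 lerD// code_pair_same.
    by rewrite add0r code_pair_other// eq_sym.
  under eq_bigr do rewrite big_split/= big_const_seq iter_addr_0 count_predT.
  rewrite big_split/= big_const_seq iter_addr_0 count_predT.
  rewrite (_ : \sum_(k <- codes) _ = lambda * T); last first.
    rewrite big_seq (eq_bigr (fun k => code_weight k * r * ((size U)%:R * T))); last first.
      move=> k kc; rewrite (bigD1_seq k) ?codes_uniq//= eqxx big1 ?addr0 ?mulrA//.
      by move=> k' /negbTE ->.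
    by rewrite -big_seq -mulr_suml sum_code_weight mulrA divfK.
  rewrite natmul2.
  have h1 : (T * Cb / N%:R + 2) * (size codes)%:R ^+ 2 <= 4 * (size codes)%:R ^+ 2.
    by rewrite ler_wpM2r ?exprn_ge0//; move: N_large2; lra.
  apply: le_trans (lerD (lexx _) h1) _.
  (* It remains to fit [lambda * T + 2 * A] into [lambda ^+ 2 * (1 + A)]: as [lambda >= 2], the
     first term takes at most [lambda ^+ 2 * (1 + A / 2)], and as [lambda ^+ 2 >= 4], the second at
     most [lambda ^+ 2 * A / 2]. *)
  rewrite /weight_fun eqxx; have e0 := eps_green_ge0 n.+1 0.
  apply: (@le_trans _ _ (lambda ^+ 2 * (1 + A))); last first.
    by rewrite ler_wpM2l ?exprn_ge0//; move: e0; lra.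
  have h2 : lambda * T <= lambda ^+ 2 * (T / 2).
    rewrite (_ : lambda ^+ 2 * _ = lambda * (T * (lambda / 2))); last by field.
    by rewrite ler_wpM2l// ler_peMr// ler_pdivlMr// mul1r.
  have -> : 4 * (size codes)%:R ^+ 2 = 2 * A by rewrite /A; ring.
  apply: le_trans (lerD h2 (lexx _)) _.
  rewrite /T; move: A_ge0 l4; move: (lambda ^+ 2) A => l a a0 l4; nra.
set z := x' - x; set sm := smear4 R m 0 (phi ^~ z).
have sm0 : 0 <= sm by exact: smear4_ge0.
set gr := green R m n.+1 (phi ^~ z).
have z0 : z != 0 by rewrite subr_eq0 eq_sym.
apply: (@le_trans _ _ (\sum_(k <- codes) \sum_(k' <- codes)
  (code_weight k * r * (code_weight k' * r) * ((size U)%:R ^+ 2 * (1 + eps * (gr - sm)))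
   + T * Cb / N%:R * sm))).
  rewrite big_seq [leRHS]big_seq; apply: ler_sum => k kc.
  rewrite big_seq [leRHS]big_seq; apply: ler_sum => k' k'c.
  rewrite mulrA; apply: le_trans (code_pair_distinct n xx' kc k'c).
  rewrite le_eqVlt; apply/orP; left; apply/eqP; apply: eq_bigr => u _; apply: eq_bigr => u' _.
  by congr (_ * weight_fun _ _); rewrite /= opprD addrACA addrA.
under eq_bigr do rewrite big_split/= big_const_seq iter_addr_0 count_predT -mulr_suml -mulr_sumr.
rewrite big_split/= big_const_seq iter_addr_0 count_predT -mulr_suml -mulr_suml sum_code_weight.
rewrite natmul2.
have -> : lambda / (size U)%:R * (lambda / (size U)%:R) * ((size U)%:R ^+ 2 * (1 + eps * (gr - sm))) =
   lambda ^+ 2 * (1 + eps * (gr - sm)) by field.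
have -> : T * Cb / N%:R * sm * (size codes)%:R ^+ 2 = ((size codes)%:R ^+ 2 * T * Cb / N%:R) * sm.
  by ring.
have h1 : (size codes)%:R ^+ 2 * T * Cb / N%:R * sm <= lambda ^+ 2 * eps * sm.
  rewrite ler_wpM2r//; apply: le_trans N_large1 _.
  by rewrite ler_wpM2r// ltW.
apply: le_trans (lerD (lexx _) h1) _.
rewrite /weight_fun (negbTE z0) -/gr addr0 le_eqVlt; apply/orP; left; apply/eqP.
ring.
Qed.

Fixpoint chain_event (x : site d) (bs : seq ((nat * seq nat) * seq (direction d))) : set Om :=
  if bs is b :: bs' then block_event x b `&` chain_event (x + displacement b.2) bs' else setT.

Lemma chain_event_measurable x bs : measurable (chain_event x bs).
Proof.
elim: bs x => [|b bs IH] x; first exact: measurableT.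
by apply: measurableI; [exact: block_event_measurable|exact: IH].
Qed.

Lemma mem_blocks b : b \in blocks -> b.1 \in codes /\ b.2 \in U.
Proof. by move=> /allpairsP[[k u] /= [kc uU ->]]. Qed.

Lemma env_sigma_block_level x b : b \in blocks ->
  env_sigma [set j | level (index_site j) = level x] (block_event x b).
Proof.
move=> /mem_blocks [bc bU].
apply: (@env_sigmaS _ _ _ X [set j | index_site j \in belast x (trail x b.2)]).
  by move=> j /= /(U_level bU).
by apply: env_sigma_block_event => //; rewrite (code_size bc) U_size.
Qed.

Lemma env_sigma_chain_level x n bs : bs \in words blocks n ->
  env_sigma [set j | level x <= level (index_site j)] (chain_event x bs).
Proof.
elim: n x bs => [|n IH] x [|b bs]; rewrite mem_words//=.
  by move=> _; exact: env_sigmaT.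
move=> /andP[sbs /andP[bB bsB]]; apply: env_sigmaI.
  apply: (@env_sigmaS _ _ _ X [set j | level (index_site j) = level x]).
    by move=> j /= ->.
  exact: env_sigma_block_level.
apply: (@env_sigmaS _ _ _ X [set j | level (x + displacement b.2) <= level (index_site j)]).
  move=> j /=; rewrite U_level_end; last by case: (mem_blocks bB).
  by apply: le_trans; rewrite lerDl.
by apply: IH; rewrite mem_words -eqSS sbs.
Qed.

(** The first blocks of both chains read only the common level of [x] and [x'], the later ones only
    higher levels; the probability of the intersection factors and [block_step] closes the
    induction. *)
Lemma chain_second_moment n x x' : level x = level x' ->
  \sum_(bs <- words blocks n) \sum_(bs' <- words blocks n)
    Pr (chain_event x bs `&` chain_event x' bs') <= lambda ^+ n ^+ 2 * weight_fun n (x' - x).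
Proof.
have lam0 : 0 <= lambda by exact: le_trans lambda_ge2.
elim: n x x' => [|n IH] x x' xx'.
  by rewrite !big_words0 /= setIT PrT expr0 expr1n mul1r weight_fun_ge1.
rewrite big_words_cons.
under eq_bigr => b _.
  under eq_bigr do rewrite big_words_cons.
  rewrite exchange_big/=; over.
have -> : lambda ^+ n.+1 ^+ 2 = lambda ^+ 2 * lambda ^+ n ^+ 2 by rewrite -exprMn -exprS.
rewrite /= mulrAC.
apply: (@le_trans _ _ (\sum_(b <- blocks) \sum_(b' <- blocks)
    Pr (block_event x b `&` block_event x' b') *
    weight_fun n ((x' + displacement b'.2) - (x + displacement b.2)) * lambda ^+ n ^+ 2)); last first.
  under eq_bigr do rewrite -mulr_suml.
  by rewrite -mulr_suml ler_wpM2r ?exprn_ge0// block_step.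
rewrite big_seq [leRHS]big_seq; apply: ler_sum => b bB.
rewrite big_seq [leRHS]big_seq; apply: ler_sum => b' b'B.
have [bc bU] := mem_blocks bB; have [b'c b'U] := mem_blocks b'B.
have lev : level (x + displacement b.2) = level (x' + displacement b'.2).
  by rewrite !U_level_end// xx'.
rewrite -mulrA; apply: (@le_trans _ _ (Pr (block_event x b `&` block_event x' b') *
  \sum_(bs <- words blocks n) \sum_(bs' <- words blocks n)
    Pr (chain_event (x + displacement b.2) bs `&` chain_event (x' + displacement b'.2) bs'))); last first.
  by rewrite ler_wpM2l ?Pr_ge0// [X in _ <= X]mulrC IH.
rewrite mulr_sumr big_seq [leRHS]big_seq; apply: ler_sum => bs bsB.
rewrite mulr_sumr big_seq [leRHS]big_seq; apply: ler_sum => bs' bs'B.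
rewrite setIACA (@env_sigma_indep _ _ _ _ _ _ Xm Xind
   [set j | level (index_site j) = level x]
   [set j | level (x + displacement b.2) <= level (index_site j)])//.
- by move=> j /= -> ; rewrite U_level_end// gerDl.
- apply: env_sigmaI; first exact: env_sigma_block_level.
  by rewrite xx'; exact: env_sigma_block_level.
- apply: env_sigmaI; first exact: env_sigma_chain_level bsB.
  by rewrite lev; exact: env_sigma_chain_level bs'B.
Qed.

Lemma chain_first_moment n x :
  \sum_(bs <- words blocks n) Pr (chain_event x bs) = lambda ^+ n.
Proof.
elim: n x => [|n IH] x; first by rewrite big_words0 /= PrT.
rewrite big_words_cons exprS -{1}(sum_Pr_block x) mulr_suml.
rewrite big_seq [RHS]big_seq; apply: eq_bigr => b bB.
have [bc bU] := mem_blocks bB.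
rewrite -(IH (x + displacement b.2)) mulr_sumr.
rewrite big_seq [RHS]big_seq; apply: eq_bigr => bs bsB.
rewrite /= (@env_sigma_indep _ _ _ _ _ _ Xm Xind
   [set j | level (index_site j) = level x]
   [set j | level (x + displacement b.2) <= level (index_site j)])//.
- by move=> j /= -> ; rewrite U_level_end// gerDl.
- exact: env_sigma_block_level.
- exact: env_sigma_chain_level bsB.
Qed.

(** For chains from one site the second moment is at most [T] times the squared first moment, so
    [second_moment_method] gives [1 / T] for every [n]. *)
Lemma chain_union_ge n :
  (2 + 2 * (size codes)%:R ^+ 2)^-1 <=
  Pr (\big[setU/set0]_(bs <- words blocks n) chain_event 0 bs).
Proof.
have lam0 : 0 < lambda by apply: lt_le_trans lambda_ge2.
set V := \big[setU/set0]_(bs <- _) _.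
have mV : measurable V by apply: bigsetU_measurable => bs _; exact: chain_event_measurable.
have := second_moment_method P (chain_event_measurable 0) mV (erefl V).
rewrite chain_first_moment => h.
have T0 : 0 < 2 + 2 * (size codes)%:R ^+ 2 :> R by rewrite ltr_wpDr.
have h2 : lambda ^+ n ^+ 2 <= Pr V * (lambda ^+ n ^+ 2 * T).
  apply: le_trans h _; rewrite ler_wpM2l ?Pr_ge0//.
  apply: le_trans (chain_second_moment n (erefl (level 0))) _.
  by rewrite subrr ler_wpM2l ?weight_fun_le// !exprn_ge0// ltW.
have l0 : 0 < lambda ^+ n ^+ 2 by rewrite !exprn_gt0.
rewrite -[leLHS]mul1r ler_pdivrMr// -(ler_pM2l l0) mulr1.
by rewrite mulrCA; exact: h2.
Qed.

End second_moment.

Lemma preimage_countable (disp : measure_display) (T : measurableType disp)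
    (E : countType) (f : T -> E) :
  (forall e, measurable (f @^-1` [set e])) -> forall B, measurable (f @^-1` B).
Proof.
move=> mf B; have -> : f @^-1` B = \bigcup_e (f @^-1` [set e] `&` (if `[< B e >] then setT else set0)).
  apply/seteqP; split=> [w Bw|w [e _ [<-]]] /=.
    by exists (f w) => //; split=> //; rewrite asboolT.
  by case: ifP => // /asboolP.
apply: countable_bigcupT_measurable; first exact: countableP.
by move=> e; apply: measurableI => //; case: ifP.
Qed.

Lemma sigma_preimage_countable (Om : Type) (G : set (set Om)) (E : countType) (f : Om -> E) :
  (forall e, <<s G >> (f @^-1` [set e])) -> forall B, <<s G >> (f @^-1` B).
Proof.
elim/Ppointed: Om => Om in G f *.
  move=> _ B; rewrite (_ : _ @^-1` _ = set0); first exact: sigma_algebra0.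
  exact: empty_eq0.
exact: (@preimage_countable _ (g_sigma_algebraType G) E f).
Qed.

(** * The frog model on Z^d and its activation times *)

Section neighbours.
Variable d : nat.

Lemma Zd_adjP (x y : Zd d) :
  reflect (exists v : direction d, y = x + step_vec v) (adj x y).
Proof.
apply: (iffP idP) => [|[v ->]]; last first.
  rewrite /adj /= /Zd_adj (bigD1 v.1)//= big1 ?addr0.
    rewrite !mxE !eqxx /= mulr1 opprD addrA subrr add0r normrN.
    by case: (v.2); rewrite ?normrN1 ?normr1.
  move=> i iv; rewrite !mxE (negbTE iv) andbF mulr0 addr0 subrr normr0//.
rewrite /adj /= /Zd_adj => /eqP s1.
have [i xyi] : exists i, x ord0 i - y ord0 i != 0.
  apply/not_existsP => h; move: s1; rewrite big1// => i _.
  by have /negP := h i; rewrite negbK => /eqP ->; rewrite normr0.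
move: s1; rewrite (bigD1 i)//= => s1.
have r0 : 0 <= \sum_(j < d | j != i) `|x ord0 j - y ord0 j| by rewrite sumr_ge0.
have e1 : `|x ord0 i - y ord0 i| = 1 by move: xyi s1 r0; move: (x _ _ - _) (\sum_(j < d | j != i) _) => a b; lia.
have r1 : \sum_(j < d | j != i) `|x ord0 j - y ord0 j| = 0 by move: s1; rewrite e1; move: (\sum_(j < d | j != i) _) => b; lia.
have oth j : j != i -> y ord0 j = x ord0 j.
  move=> ji; move/eqP: r1; rewrite psumr_eq0// => /allP /(_ j).
  rewrite mem_index_enum => /(_ isT); rewrite ji /= normr_eq0 subr_eq0.
  by move/eqP.
exists (i, x ord0 i < y ord0 i); apply/rowP => j; rewrite !mxE eqxx /=.
have [->|ji] := eqVneq j i.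
  by rewrite mulr1; move: e1; move: (x _ _) (y _ _) => a b; case: (ltP a b) => /= ab; lia.
by rewrite mulr0 addr0 oth.
Qed.

Lemma Zd_degree (x : Zd d) : degree x = #|{: direction d}|.
Proof.
pose f (v : direction d) : Zd d := (x : 'rV[int]_d) + step_vec v.
rewrite /degree (_ : fset_set _ = [fset f v | v in {: direction d}]%fset).
  rewrite card_imfset/=; first by rewrite -cardE.
  by move=> v v' /addrI; exact: step_vec_inj.
apply/fsetP => y; rewrite in_fset_set; last exact: locally_finite.
apply/idP/imfsetP; rewrite inE /=.
  by move=> /Zd_adjP[v ->]; exists v.
by move=> [v _ ->]; apply/Zd_adjP; exists v.
Qed.

End neighbours.

Section realization.
Context (R : realType) (d : nat) (disp : measure_display)
  (Om : measurableType disp) (P : probability Om R)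
  (X : env_index d -> Om -> nat) (dir_of : nat -> direction d).
Hypothesis Xm : forall j B, measurable (X j @^-1` B).
Hypothesis Xind : forall (I : choiceType) (g : env_index d -> I),
  indep_families P (fun i => <<s \bigcup_(j in [set j | g j = i]) sigma_discrete (X j) >>).
Let N := #|{: direction d}|.
Hypothesis Xdir : forall g (v : direction d),
  P (X (inr (g, true)) @^-1` [set k | dir_of k = v]) = ((N%:R : R)^-1)%:E.
Variable p : R.
Hypothesis Xbit : forall g, P (X (inr (g, false)) @^-1` [set k | k != 0%N]) = p%:E.
Variable eta : probability nat R.
Hypothesis Xeta : forall x B, P (X (inl x) @^-1` B) = eta B.

Local Notation Pr := (Pr P).
Local Notation env_sigma := (env_sigma X).
Local Notation dir_event := (dir_event X dir_of).

Definition env_walk (x : site d) (i n : nat) (w : Om) : site d :=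
  x + \sum_(t < n) step_vec (dir_of (X (inr (((x, i), t : nat), true)) w)).

(** A zero bit at [a] forbids step [a.+1]: the frog is last seen at time [a], so its lifetime is
    [a.+1]. *)
Definition env_lifetime (x : site d) (i : nat) (w : Om) : option nat :=
  if pselect (exists a, X (inr (((x, i), a), false)) w == 0%N) is left e
  then Some (ex_minn e).+1 else None.

Definition env_frogs : frogs (Zd d) Om :=
  @Frogs (Zd d) Om (fun x w => X (inl x) w) env_walk env_lifetime.

Lemma env_walkS x i n w : env_walk x i n.+1 w =
  env_walk x i n w + step_vec (dir_of (X (inr (((x, i), n), true)) w)).
Proof. by rewrite /env_walk big_ord_recr/= addrA. Qed.

Lemma alive_env_lifetime n x i w : alive_at n (env_lifetime x i w) <->
  forall a, (a < n)%N -> X (inr (((x, i), a), false)) w != 0%N.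
Proof.
rewrite /env_lifetime; case: pselect => [e|ne]; last first.
  by split=> // _ a _; apply/negP => h; apply: ne; exists a.
case: ex_minnP => a0 a00 mina; rewrite /= ltnS; split.
  by move=> na a an; apply/negP => /mina; rewrite leqNgt (leq_trans an na).
by move=> h; rewrite leqNgt; apply/negP => /h; rewrite a00.
Qed.

Definition frog_group (j : env_index d) : (Zd d + (Zd d * nat) + (Zd d * nat))%type :=
  match j with
  | inl x => inl (inl x)
  | inr (g, true) => inl (inr g.1)
  | inr (g, false) => inr g.1
  end.

(** Each variable of the frog model is a function of its own group of coordinates, so the
    independence of the groups passes to the model. *)
Lemma sub_frog_sigma a : frog_sigma env_frogs a `<=`
  <<s \bigcup_(j in [set j | frog_group j = a]) sigma_discrete (X j) >>.
Proof.
have sX j B : frog_group j = a ->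
    <<s \bigcup_(j in [set j | frog_group j = a]) sigma_discrete (X j) >> (X j @^-1` B).
  by move=> ja; apply: sub_sigma_algebra; exists j => //; exists B.
case: a sX => [[x|[x i]]|[x i]] sX B /=.
- by move=> [C _ <-]; exact: (sX (inl x)).
- move: B; apply: smallest_sub; first exact: smallest_sigma_algebra.
  move=> B [n _ [C _ <-]].
  apply: sigma_preimage_countable => {C}.
  elim: n => [|n IH] y.
    rewrite (_ : _ @^-1` _ = (if x == y then setT else set0)).
      case: ifP => _; last exact: sigma_algebra0.
      exact: sigma_setT.
    apply/seteqP; split=> w; rewrite /preimage/= /env_walk big_ord0 addr0.
      by move=> ->; rewrite eqxx.
    by case: eqP.
  pose f w : Zd d * direction d := (env_walk x i n w, dir_of (X (inr (((x, i), n), true)) w)).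
  rewrite (_ : _ @^-1` _ = f @^-1` [set q | q.1 + step_vec q.2 = y]); last first.
    by apply/seteqP; split=> w; rewrite /preimage/= env_walkS.
  apply: sigma_preimage_countable => -[z v].
  rewrite (_ : _ @^-1` _ = (env_walk x i n @^-1` [set z]) `&`
     (X (inr (((x, i), n), true)) @^-1` [set k | dir_of k = v])).
    apply: sigma_setI; first exact: IH.
    exact: sX.
  by apply/seteqP; split=> w; rewrite /preimage/= /f => -[-> ->].
- move=> [C _ <-]; apply: sigma_preimage_countable => {C}.
  have alive n : <<s \bigcup_(j in [set j | frog_group j = inr (x, i)]) sigma_discrete (X j) >>
     [set w | alive_at n (env_lifetime x i w)].
    elim: n => [|n IH].
      rewrite (_ : [set w | alive_at _ _] = setT); first exact: sigma_setT.
      by apply/seteqP; split=> // w _ /=; apply/alive_env_lifetime.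
    rewrite (_ : [set w | alive_at _ _] = [set w | alive_at n (env_lifetime x i w)] `&`
       (X (inr (((x, i), n), false)) @^-1` [set k | k != 0%N])).
      apply: sigma_setI; first exact: IH.
      exact: sX.
    apply/seteqP; split=> w /=.
      move=> /alive_env_lifetime h; split; last exact: h.
      by apply/alive_env_lifetime => b bn; apply: h; exact: ltnW.
    move=> [/alive_env_lifetime h1 h2]; apply/alive_env_lifetime => b.
    by rewrite ltnS leq_eqVlt => /predU1P[->|]; [exact: h2|exact: h1].
  have sC A : <<s \bigcup_(j in [set j | frog_group j = inr (x, i)]) sigma_discrete (X j) >> A ->
      <<s \bigcup_(j in [set j | frog_group j = inr (x, i)]) sigma_discrete (X j) >> (~` A).
    by move=> hA; rewrite -setTD; have [_ hD _] := smallest_sigma_algebra setT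
      (\bigcup_(j in [set j | frog_group j = inr (x, i)]) sigma_discrete (X j)); exact: hD.
  have some k : <<s \bigcup_(j in [set j | frog_group j = inr (x, i)]) sigma_discrete (X j) >>
     (env_lifetime x i @^-1` [set Some k]).
    case: k => [|k].
      rewrite (_ : _ @^-1` _ = set0); first exact: sigma_algebra0.
      by apply/seteqP; split=> // w; rewrite /preimage/= /env_lifetime; case: pselect.
    rewrite (_ : _ @^-1` _ = [set w | alive_at k (env_lifetime x i w)] `&`
       ~` [set w | alive_at k.+1 (env_lifetime x i w)]).
      by apply: sigma_setI; [exact: alive|apply: sC; exact: alive].
    apply/seteqP; split=> w; rewrite /preimage/=.
      by move=> -> /=; split; [|rewrite ltnn].
    case: (env_lifetime x i w) => [l|] /= [h1 h2]; last by exfalso; exact: h2.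
    congr Some; apply/eqP; rewrite eqn_leq h1 andbT leqNgt; exact/negP.
  case=> [k|]; first exact: some.
  rewrite (_ : _ @^-1` _ = ~` (\bigcup_k (env_lifetime x i @^-1` [set Some k]))).
    by apply: sC; apply: (@sigma_algebra_bigcup _ setT) => k; exact: some.
  apply/seteqP; split=> w; rewrite /preimage/=.
    by move=> e [k _ /=]; rewrite e.
  by move=> h; case e : (env_lifetime x i w) => [k|//]; exfalso; apply: h; exists k.
Qed.

Lemma frog_sigma_measurable a : frog_sigma env_frogs a `<=` measurable.
Proof.
move=> B /sub_frog_sigma; apply: sigma_measurable => _ [j _ [C _ <-]]; exact: Xm.
Qed.

Lemma frog_sigma_independent : mutually_independent P (frog_sigma env_frogs).
Proof.
apply/mutually_independentE => s A us sA.
by apply: (Xind us) => a /sA; exact: sub_frog_sigma.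
Qed.

Lemma env_walk_law x i : simple_random_walk P (G := Zd d) x (env_walk x i).
Proof.
move=> n v.
pose E n := [set w | forall k, (k <= n)%N -> env_walk x i k w = v k].
pose I n : set (env_index d) := [set j | exists2 t, (t < n)%N & j = inr (((x, i), t), true)].
suff H : env_sigma (I n) (E n) /\ Pr (E n) = (v 0%N == x)%:R *
     \prod_(k < n) ((adj (v k) (v k.+1))%:R / (degree (v k))%:R).
  rewrite -H.2 PrE//; exact: env_sigma_measurable H.1.
elim: n => [|n [sE PE]].
  rewrite big_ord0 mulr1 (_ : E 0%N = if v 0%N == x then setT else set0).
    case: ifP => _; first by rewrite PrT; split=> //; exact: env_sigmaT.
    by rewrite Pr0; split=> //; exact: sigma_algebra0.
  apply/seteqP; split=> w /=.
    by move=> /(_ 0%N isT); rewrite /env_walk big_ord0 addr0 => ->; rewrite eqxx.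
  case: eqP => // vx _ k; rewrite leqn0 => /eqP ->.
  by rewrite /env_walk big_ord0 addr0.
have ES : E n.+1 = E n `&` [set w | v n + step_vec (dir_of (X (inr (((x, i), n), true)) w)) = v n.+1].
  apply/seteqP; split=> w /=.
    move=> h; split; first by move=> k kn; apply: h; exact: leqW.
    by rewrite -h// -env_walkS h.
  move=> [h1 h2] k; rewrite leq_eqVlt => /predU1P[->|]; last exact: h1.
  by rewrite env_walkS h1.
rewrite big_ord_recr/= Zd_degree mulrA -PE -[Zd_adj _ _]/(adj (v n) (v n.+1)).
have [/Zd_adjP[u vu]|nadj] := boolP (adj (v n) (v n.+1)); last first.
  rewrite mul0r mulr0 (_ : E n.+1 = set0); first by rewrite Pr0; split=> //; exact: sigma_algebra0.
  rewrite ES; apply/seteqP; split=> // w [_ /= h]; move/Zd_adjP: nadj; apply.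
  by exists (dir_of (X (inr (((x, i), n), true)) w)).
have {}ES : E n.+1 = E n `&` dir_event ((x, i), n) u.
  rewrite ES; congr (_ `&` _); apply/seteqP; split=> w /=; rewrite vu.
    by move=> /addrI /step_vec_inj.
  by rewrite /dir_event/= => ->.
rewrite ES; split.
  apply: env_sigmaI; last by apply: env_sigma_preimage; exists n.
  by apply: env_sigmaS sE => j [t tn ->]; exists t => //; exact: ltnW.
rewrite (Pr_dir_event Xm Xind Xdir u sE) ?mul1r//.
by move=> [t tn [e]]; rewrite e ltnn in tn.
Qed.

Lemma env_lifetime_law x i : geometric_lifetime P p (env_lifetime x i).
Proof.
pose alive n := [set w | forall a, (a < n)%N -> X (inr (((x, i), a), false)) w != 0%N].
pose I n : set (env_index d) := [set j | exists2 t, (t < n)%N & j = inr (((x, i), t), false)].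
have aliveS n : alive n.+1 = alive n `&` X (inr (((x, i), n), false)) @^-1` [set k | k != 0%N].
  apply/seteqP; split=> w /=.
    by move=> h; split; [move=> a an; apply: h; exact: ltnW|exact: h].
  by move=> [h1 h2] a; rewrite ltnS leq_eqVlt => /predU1P[->//|]; exact: h1.
have nI n : ~ I n (inr (((x, i), n), false)) by move=> [t tn [e]]; rewrite e ltnn in tn.
have H n : env_sigma (I n) (alive n) /\ Pr (alive n) = p ^+ n.
  elim: n => [|n [sA PA]].
    rewrite (_ : alive 0%N = setT); first by rewrite PrT; split=> //; exact: env_sigmaT.
    by apply/seteqP; split=> // w _ a.
  rewrite aliveS; split.
    apply: env_sigmaI; last by apply: env_sigma_preimage; exists n.
    by apply: env_sigmaS sA => j [t tn ->]; exists t => //; exact: ltnW.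
  rewrite (@env_sigma_indep _ _ _ _ _ _ Xm Xind (I n) [set inr (((x, i), n), false)])//.
  - by rewrite PA exprSr; congr (_ * _); rewrite /Pr Xbit.
  - by move=> j jI /= je; rewrite je in jI; exact: nI jI.
  - exact: env_sigma_preimage.
have PL k : P [set w | env_lifetime x i w = Some k.+1] = ((1 - p) * p ^+ k)%:E.
  rewrite (_ : [set w | _] = alive k `&` X (inr (((x, i), k), false)) @^-1` [set k | k = 0%N]).
    rewrite -PrE; last by apply: measurableI; [exact: (env_sigma_measurable Xm (H k).1)|exact: Xm].
    rewrite (@env_sigma_indep _ _ _ _ _ _ Xm Xind (I k) [set inr (((x, i), k), false)])//.
    - rewrite (H k).2 mulrC; congr (_ * _)%:E.
      rewrite (_ : _ @^-1` _ = ~` (X (inr (((x, i), k), false)) @^-1` [set k | k != 0%N])).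
        by rewrite /Pr probability_setC// Xbit.
      apply/seteqP; split=> w /=; rewrite /preimage/=; first by move=> ->.
      by move=> /negP; rewrite negbK => /eqP.
    - by move=> j jI /= je; rewrite je in jI; exact: nI jI.
    - exact: (H k).1.
    - exact: env_sigma_preimage.
  apply/seteqP; split=> w /=.
    move=> Lk; split.
      by apply/alive_env_lifetime; rewrite Lk /=.
    apply/eqP/negPn/negP => h.
    have : alive k.+1 w.
      rewrite aliveS; split=> //.
      by apply/alive_env_lifetime; rewrite Lk /=.
    by move/alive_env_lifetime; rewrite Lk /= ltnn.
  move=> [/alive_env_lifetime h1 /= h2].
  have : ~ alive_at k.+1 (env_lifetime x i w).
    by move/alive_env_lifetime => /(_ k (ltnSn k)); rewrite h2.
  case: (env_lifetime x i w) h1 => [l|] /= h1 h3; last by exfalso; exact: h3.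
  congr Some; apply/eqP; rewrite eqn_leq h1 andbT leqNgt; exact/negP.
(* For [p = 1] all lifetimes [Some k.+1] are null, and the value [Some 0] never occurs. *)
split=> [[//|k] _|p1]; first exact: PL.
have mL B : measurable (env_lifetime x i @^-1` B).
  by apply: (@frog_sigma_measurable (inr (x, i))); exists B.
have := probability_setC P (mL [set Some k.+1 | k in setT]).
rewrite [X in P (~` X)](_ : _ = \bigcup_k [set w | env_lifetime x i w = Some k.+1]); last first.
  apply/seteqP; split=> w; first by move=> [k _ /= e]; exists k.
  by move=> [k _ /= e]; exists k.
rewrite [X in (1 - P X)%E](_ : _ = \bigcup_k [set w | env_lifetime x i w = Some k.+1]); last first.
  apply/seteqP; split=> w; first by move=> [k _ /= e]; exists k.
  by move=> [k _ /= e]; exists k.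
rewrite measure_bigcup//; last 2 first.
  by move=> k _; exact: (mL [set Some k.+1]).
  by apply/trivIsetP => a b _ _ ab; apply/seteqP; split=> // w [/= -> []] /eqP; rewrite (negbTE ab).
rewrite eseries0 ?sube0; last by move=> k _ _; apply: (etrans (PL k)); rewrite p1 subrr mul0r.
move=> <-; congr (P _); apply/seteqP; split=> w /=.
  by move=> e [k _ /=]; rewrite e.
move=> h; case e : (env_lifetime x i w) => [[|k]|//].
  by move: e; rewrite /env_lifetime; case: pselect.
by exfalso; apply: h; exists k.
Qed.

Lemma env_is_FM : is_FM P p eta env_frogs.
Proof.
split.
- exact: frog_sigma_measurable.
- exact: frog_sigma_independent.
- by move=> x B; exact: Xeta.
- exact: env_walk_law.
- exact: env_lifetime_law.
Qed.

End realization.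

(** * Passage and activation times as attained minima *)

Section natural_infima.
Context {R : realType}.
Local Open Scope ereal_scope.

Definition nat_or_infty (e : \bar R) := e = +oo \/ exists n : nat, e = n%:R%:E.

Lemma ereal_inf_natP (S : set (\bar R)) (k : nat) :
  (forall e, S e -> nat_or_infty e) ->
  ereal_inf S = k%:R%:E <->
  S k%:R%:E /\ forall k' : nat, (k' < k)%N -> ~ S k'%:R%:E.
Proof.
move=> SN; split=> [Sk|[Sk kmin]]; last first.
  apply/eqP; rewrite eq_le ereal_inf_lbound//=; apply: le_ereal_inf_tmp => e Se.
  have [->|[n en]] := SN _ Se; first by rewrite leey.
  rewrite en lee_fin ler_nat leqNgt; apply/negP => /kmin; apply.
  by rewrite -en.
have kmin k' : (k' < k)%N -> ~ S k'%:R%:E.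
  move=> k'k /ereal_inf_lbound; rewrite Sk lee_fin ler_nat leqNgt k'k//.
split=> //.
have : ereal_inf S < k.+1%:R%:E by rewrite Sk lte_fin ltr_nat.
move=> /ereal_inf_lt[e Se]; have [->|[n en]] := SN _ Se; first by rewrite ltNge leey.
rewrite en lte_fin ltr_nat ltnS leq_eqVlt => /predU1P[nk|/kmin]; first by rewrite -nk -en.
by rewrite -en.
Qed.

Lemma ereal_inf_nat (S : set (\bar R)) :
  (forall e, S e -> nat_or_infty e) -> nat_or_infty (ereal_inf S).
Proof.
move=> SN; have [[n Sn]|h] := pselect (exists n : nat, S n%:R%:E).
  right; have ex : exists n : nat, `[< S n%:R%:E >] by exists n; apply/asboolP.
  case: (ex_minnP ex) => m /asboolP Sm mmin; exists m.
  apply/ereal_inf_natP => //; split=> // k km /asboolP /mmin.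
  by rewrite leqNgt km.
left; apply/eqP; rewrite eq_le leey /=; apply: le_ereal_inf_tmp => e Se.
by have [->|[n en]] := SN _ Se; rewrite ?leey//; exfalso; apply: h; exists n; rewrite -en.
Qed.

Lemma nat_or_infty_lt (e : \bar R) : nat_or_infty e -> e < +oo -> exists n : nat, e = n%:R%:E.
Proof. by move=> [->|//]; rewrite ltxx. Qed.

End natural_infima.

Section dynamics.
Context (R : realType) (G : rooted_graph) (Om : Type) (F : frogs G Om).
Local Open Scope ereal_scope.
Local Notation passage_time := (@passage_time R G Om F).
Local Notation activation_time := (@activation_time R G Om F).

Lemma passage_timeP w x y (k : nat) :
  passage_time w x y = k%:R%:E ->
  exists i, [/\ (i < particles F x w)%N, alive_at k (lifetime F x i w) &
                walk F x i k w = y].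
Proof.
move=> /ereal_inf_natP [|[n [i ni] /eqP]]; first by move=> _ [n _ <-]; right; exists n.
rewrite eqe eqr_nat => /eqP nk _; exists i; by rewrite -nk.
Qed.

Lemma passage_time_nat w x y : nat_or_infty (passage_time w x y).
Proof. by apply: ereal_inf_nat => _ [n _ <-]; right; exists n. Qed.

Definition route_time (w : Om) (x : G) (s : seq G) : \bar R :=
  \sum_(t <- pairmap (passage_time w) x s) t.

Lemma route_time_cons w x y s :
  route_time w x (y :: s) = passage_time w x y + route_time w y s.
Proof. by rewrite /route_time /= big_cons. Qed.

Lemma route_time_nat w x s : nat_or_infty (route_time w x s).
Proof.
elim: s x => [|y s IH] x; first by rewrite /route_time big_nil; right; exists 0%N.
rewrite route_time_cons.
have [->|[n ->]] := passage_time_nat w x y; first by left; rewrite addye//; case: (IH y) => [->|[n ->]].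
have [->|[n' ->]] := IH y; first by left.
by right; exists (n + n')%N; rewrite natrD.
Qed.

Lemma route_time_ge0 w x s : 0 <= route_time w x s.
Proof. by have [->|[n ->]] := route_time_nat w x s; rewrite ?leey ?lee_fin. Qed.

Lemma route_time_cat w x s s' :
  route_time w x (s ++ s') = route_time w x s + route_time w (last x s) s'.
Proof.
elim: s x => [|y s IH] x /=; first by rewrite {2}/route_time big_nil add0e.
by rewrite !route_time_cons IH addeA.
Qed.

Lemma activation_time_nat w x : nat_or_infty (activation_time w x).
Proof. by apply: ereal_inf_nat => _ [s _ <-]; exact: route_time_nat. Qed.

Lemma activation_time_le w s : activation_time w (last (Defs.root G) s) <= route_time w (Defs.root G) s.
Proof. by apply: ereal_inf_lbound; exists s. Qed.

Lemma activation_timeP w x (k : nat) : activation_time w x = k%:R%:E <->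
  (exists s, last (Defs.root G) s = x /\ route_time w (Defs.root G) s = k%:R%:E) /\
  forall k' : nat, (k' < k)%N ->
    ~ exists s, last (Defs.root G) s = x /\ route_time w (Defs.root G) s = k'%:R%:E.
Proof.
split.
  move=> /ereal_inf_natP [|[s sx sk] h]; first by move=> _ [s _ <-]; exact: route_time_nat.
  split; first by exists s.
  by move=> k' k'k [s' [s'x s'k]]; apply: (h _ k'k); exists s'.
move=> [[s [sx sk]] h]; apply/ereal_inf_natP; first by move=> _ [s' _ <-]; exact: route_time_nat.
split; first by exists s.
by move=> k' k'k [s' s'x s'k]; apply: (h _ k'k); exists s'.
Qed.

Lemma activation_time_root w : activation_time w (Defs.root G) = 0.
Proof.
by apply/(activation_timeP w (Defs.root G) 0); split=> //; exists [::]; rewrite /route_time big_nil.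
Qed.

Lemma activation_timeD w x y :
  activation_time w y <= activation_time w x + passage_time w x y.
Proof.
have [->|[n xn]] := activation_time_nat w x.
  by have [->|[m ->]] := passage_time_nat w x y; rewrite leey.
have /activation_timeP[[s [sx sn]] _] := xn.
rewrite xn -sn -sx.
have -> : route_time w (Defs.root G) s + passage_time w (last (Defs.root G) s) y =
   route_time w (Defs.root G) (rcons s y).
  by rewrite -cats1 route_time_cat route_time_cons /route_time big_nil adde0.
by have := activation_time_le w (rcons s y); rewrite last_rcons.
Qed.

Lemma activation_time_fin_step w x y i n :
  activation_time w x < +oo -> (i < particles F x w)%N ->
  alive_at n (lifetime F x i w) -> walk F x i n w = y -> activation_time w y < +oo.
Proof.
move=> Tx ix aln wn; apply: le_lt_trans (activation_timeD w x y) _.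
rewrite lte_add_pinfty//; apply: (@le_lt_trans _ _ n%:R%:E); last exact: ltry.
by apply: ereal_inf_lbound; exists n => //; exists i.
Qed.

(** Somewhere along the route a hop leads from a site activated by time [n] to one activated later.
    The frog making this hop is still on its way at time [n], hence active. *)
Lemma active_of_crossing w (n : nat) x s :
  activation_time w x <= n%:R%:E -> n%:R%:E < activation_time w (last x s) ->
  route_time w x s < +oo -> exists x i, active_at R F w n x i.
Proof.
elim: s x => [|y s IH] x /=; first by move=> a b; have := le_lt_trans a b; rewrite ltxx.
move=> Tx Tl; rewrite route_time_cons => fin.
have finy : route_time w y s < +oo.
  by apply: le_lt_trans fin; rewrite leeDr//; have [->|[m ->]] := passage_time_nat w x y; rewrite ?leey ?lee_fin.
have finp : passage_time w x y < +oo.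
  by apply: le_lt_trans fin; rewrite leeDl// route_time_ge0.
have [Ty|Ty] := leP (activation_time w y) n%:R%:E; first exact: IH Ty Tl finy.
have [k pk] := nat_or_infty_lt (passage_time_nat w x y) finp.
have [i [ix alk wk]] := passage_timeP pk.
have [a xa] := nat_or_infty_lt (activation_time_nat w x) (le_lt_trans Tx (ltry _)).
have ank : (n < a + k)%N.
  have := lt_le_trans Ty (activation_timeD w x y).
  by rewrite xa pk -EFinD -natrD lte_fin ltr_nat.
have an : (a <= n)%N by move: Tx; rewrite xa lee_fin ler_nat.
exists x, i; split=> //; exists (n - a)%N; split.
  by case: (lifetime F x i w) alk => //= l kl; lia.
by rewrite xa -EFinD -natrD subnKC.
Qed.

Lemma survives_of_late_activation w :
  (forall n : nat, exists x, activation_time w x < +oo /\ n%:R%:E < activation_time w x) ->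
  survives R F w.
Proof.
move=> h n; have [x [Tx nx]] := h n.
have [k xk] := nat_or_infty_lt (activation_time_nat w x) Tx.
have /activation_timeP[[s [sx sk]] _] := xk.
apply: (@active_of_crossing w n (Defs.root G) s).
- by rewrite activation_time_root lee_fin.
- by rewrite sx.
- by rewrite sk ltry.
Qed.

End dynamics.

(** * Measurability of survival *)

Section survival_measurable.
Context (R : realType) (G : rooted_graph) (disp : measure_display)
  (Om : measurableType disp) (F : frogs G Om).
Hypothesis mF : forall j, frog_sigma F j `<=` measurable.
Local Open Scope ereal_scope.

Lemma particles_measurable x B : measurable (particles F x @^-1` B).
Proof. by apply: (@mF (inl (inl x)) (particles F x @^-1` B)); exists B. Qed.

Lemma walk_measurable x i n B : measurable (walk F x i n @^-1` B).
Proof.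
apply: (@mF (inl (inr (x, i))) (walk F x i n @^-1` B)); apply: sub_sigma_algebra.
by exists n => //; exists B.
Qed.

Lemma lifetime_measurable x i B : measurable (lifetime F x i @^-1` B).
Proof. by apply: (@mF (inr (x, i)) (lifetime F x i @^-1` B)); exists B. Qed.

Lemma measurable_iff (A B : set Om) :
  (forall w, A w <-> B w) -> measurable B -> measurable A.
Proof. by move=> AB; rewrite (_ : A = B)//; apply/seteqP; split=> w /AB. Qed.

Lemma exists_measurable (E : countType) (Q : E -> set Om) :
  (forall e, measurable (Q e)) -> measurable [set w | exists e, Q e w].
Proof.
move=> mQ; rewrite (_ : [set w | _] = \bigcup_e Q e).
  by apply: countable_bigcupT_measurable => //; exact: countableP.
by apply/seteqP; split=> w [e]; [exists e|exists e].
Qed.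

Lemma forall_measurable (E : countType) (Q : E -> set Om) :
  (forall e, measurable (Q e)) -> measurable [set w | forall e, Q e w].
Proof.
move=> mQ; rewrite (_ : [set w | _] = ~` [set w | exists e, (~` Q e) w]).
  by apply/measurableC/exists_measurable => e; exact: measurableC.
apply/seteqP; split=> w /=; first by move=> h [e]; apply.
by move=> h e; apply: contrapT => ne; apply: h; exists e.
Qed.

Lemma const_and_measurable (p : Prop) (Q : set Om) :
  measurable Q -> measurable [set w | p /\ Q w].
Proof.
move=> mQ; have [hp|hp] := pselect p.
  rewrite (_ : [set w | _] = Q)//; by apply/seteqP; split=> w //= [].
by rewrite (_ : [set w | _] = set0)//; apply/seteqP; split=> w //= [].
Qed.

Lemma passage_step_measurable x y n : measurable
  [set w | exists i, [/\ (i < particles F x w)%N, alive_at n (lifetime F x i w) & walk F x i n w = y]].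
Proof.
apply: exists_measurable => i.
apply: (@measurable_iff _ ((particles F x @^-1` [set k | (i < k)%N]) `&`
  (lifetime F x i @^-1` [set l | alive_at n l]) `&` (walk F x i n @^-1` [set y]))).
  by move=> w; split=> [[]|[[]]].
apply: measurableI; [apply: measurableI|exact: walk_measurable].
- exact: particles_measurable.
- exact: lifetime_measurable.
Qed.

Lemma passage_time_measurable x y (k : nat) :
  measurable [set w | passage_time R F w x y = k%:R%:E].
Proof.
pose Q n := [set w | exists i, [/\ (i < particles F x w)%N, alive_at n (lifetime F x i w) & walk F x i n w = y]].
have QE n w : [set n%:R%:E | n in [set n | Q n w]] (n%:R%:E : \bar R) <-> Q n w.
  split=> [[m Qm /eqP]|Qn]; last by exists n.
  by rewrite eqe eqr_nat => /eqP <-.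
rewrite (_ : [set w | _] = Q k `&` [set w | forall k', (k' < k)%N -> ~ Q k' w]).
  apply: measurableI; first exact: passage_step_measurable.
  apply: forall_measurable => k'.
  have [kk'|kk'] := boolP (k' < k)%N.
    apply: (@measurable_iff _ (~` Q k')); last exact/measurableC/passage_step_measurable.
    by move=> w; split=> h //; exact: h.
  exact: (@measurable_iff _ setT).
apply/seteqP; split=> w /=.
  move=> /ereal_inf_natP [|/QE Qk h]; first by move=> _ [n _ <-]; right; exists n.
  by split=> // k' k'k /QE; exact: h.
move=> [Qk h]; apply/ereal_inf_natP; first by move=> _ [n _ <-]; right; exists n.
by split; [exact/QE|move=> k' k'k /QE; exact: h].
Qed.

Lemma route_time_measurable x s (k : nat) :
  measurable [set w | route_time R F w x s = k%:R%:E].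
Proof.
elim: s x k => [|y s IH] x k.
  rewrite (_ : [set w | _] = [set w | (0 = k%:R%:E :> \bar R) /\ setT w]).
    by apply: const_and_measurable.
  by apply/seteqP; split=> w /=; rewrite /route_time big_nil // => -[].
rewrite (_ : [set w | _] = [set w | exists a : nat, (a <= k)%N /\
    ([set w | passage_time R F w x y = a%:R%:E] `&` [set w | route_time R F w y s = (k - a)%:R%:E]) w]).
  apply: exists_measurable => a; apply: const_and_measurable.
  by apply: measurableI; [exact: passage_time_measurable|exact: IH].
apply/seteqP; split=> w /=; rewrite route_time_cons.
  have [->|[n pn]] := passage_time_nat R F w x y.
    by have [->|[n ->]] := route_time_nat R F w y s.
  have [->|[n' rn']] := route_time_nat R F w y s; first by rewrite pn.
  rewrite pn rn' -EFinD -natrD => /eqP; rewrite eqe eqr_nat => /eqP <-.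
  by exists n; rewrite leq_addr addKn.
by move=> [a [ak [-> ->]]]; rewrite -EFinD -natrD subnKC.
Qed.

Lemma activation_time_measurable x (k : nat) :
  measurable [set w | activation_time R F w x = k%:R%:E].
Proof.
pose Q n := [set w | exists s, last (Defs.root G) s = x /\ route_time R F w (Defs.root G) s = n%:R%:E].
have mQ n : measurable (Q n).
  by apply: exists_measurable => s; apply: const_and_measurable; exact: route_time_measurable.
rewrite (_ : [set w | _] = Q k `&` [set w | forall k', (k' < k)%N -> ~ Q k' w]).
  apply: measurableI => //; apply: forall_measurable => k'.
  have [kk'|kk'] := boolP (k' < k)%N.
    apply: (@measurable_iff _ (~` Q k')); last exact: measurableC.
    by move=> w; split=> h //; exact: h.
  exact: (@measurable_iff _ setT).
by apply/seteqP; split=> w /=; [move=> /activation_timeP[]|move=> [? ?]; apply/activation_timeP].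
Qed.

Lemma survives_measurable : measurable [set w | survives R F w].
Proof.
apply: forall_measurable => n; apply: exists_measurable => x; apply: exists_measurable => i.
apply: (@measurable_iff _ ((particles F x @^-1` [set k | (i < k)%N]) `&`
  [set w | exists m : nat, (m <= n)%N /\ ((lifetime F x i @^-1` [set l | alive_at m l]) `&`
     [set w | activation_time R F w x = (n - m)%:R%:E]) w])); last first.
  apply: measurableI; first exact: particles_measurable.
  apply: exists_measurable => m; apply: const_and_measurable; apply: measurableI.
    exact: lifetime_measurable.
  exact: activation_time_measurable.
move=> w; split=> /= -[ix [m]].
  move=> [am]; have [->//|[k ->]] := activation_time_nat R F w x.
  rewrite -EFinD -natrD => /eqP; rewrite eqe eqr_nat => /eqP kmn.
  split=> //; exists m; rewrite -kmn addnK leq_addl; by split.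
move=> [mn [am Tk]]; split=> //; exists m; split=> //.
by rewrite Tk -EFinD -natrD subnK.
Qed.

End survival_measurable.

(** * Survival from long chains *)

Section reaching.
Context (R : realType) (d : nat) (disp : measure_display)
  (Om : measurableType disp)
  (X : env_index d -> Om -> nat) (dir_of : nat -> direction d).
Local Notation F := (env_frogs X dir_of).
Local Notation T := (@activation_time R (Zd d) Om F).

(** The invariant of the induction is that frog [i] of the activated site [x] is alive at age [a]
    and stands at [y]; a change of frog restarts it at age [0]. *)
Lemma walk_event_reach w u c y x i a :
  (T w x < +oo)%E -> (i < X (inl x) w)%N -> alive_at a (env_lifetime X x i w) ->
  env_walk X dir_of x i a w = y ->
  walk_event X dir_of y ((x, i), a) u c w ->
  (T w (last y (trail y u)) < +oo)%E.
Proof.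
elim: u c y x i a => [|v u IH] c y x i a Tx ix al wy /=.
  by move=> _; exact: (activation_time_fin_step Tx ix al wy).
move=> [[[dv sv] lv] h].
have al1 : alive_at a.+1 (env_lifetime X x i w).
  apply/alive_env_lifetime => b; rewrite ltnS leq_eqVlt => /predU1P[->//|].
  by move/alive_env_lifetime: al; exact.
have wy1 : env_walk X dir_of x i a.+1 w = y + step_vec v by rewrite env_walkS wy dv.
case: (head 0%N c) lv h => [|i'] lv h /=; first exact: IH h.
apply: (IH (behead c) _ (y + step_vec v) i' 0%N) h => //.
- exact: (activation_time_fin_step Tx ix al1 wy1).
- exact/alive_env_lifetime.
- by rewrite /env_walk big_ord0 addr0.
Qed.

Lemma chain_event_reach w bs x : (T w x < +oo)%E -> chain_event X dir_of x bs w ->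
  (T w ((x : site d) + \sum_(b <- bs) displacement b.2)%R < +oo)%E.
Proof.
elim: bs x => [|b bs IH] x Tx /=; first by rewrite big_nil addr0.
move=> [[lb wb] cb]; rewrite big_cons addrA; apply: IH => //.
rewrite -last_trail; apply: (walk_event_reach Tx lb _ _ wb).
- exact/alive_env_lifetime.
- by rewrite /env_walk big_ord0 addr0.
Qed.

Variable level : site d -> int.
Hypothesis level0 : level 0 = 0.
Hypothesis level_step : forall x v, level (x + step_vec v) <= level x + 1.

Lemma env_walk_level x i n w : level (env_walk X dir_of x i n w) <= level x + n%:Z.
Proof.
elim: n => [|n IH]; first by rewrite /env_walk big_ord0 !addr0.
rewrite env_walkS (le_trans (level_step _ _))// -addn1 PoszD addrA lerD2r//.
Qed.

(** The level rises by at most one per unit of time, so it serves as a clock: high sites are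
    activated late. *)
Lemma route_time_level w x s (k : nat) :
  route_time R F w x s = k%:R%:E -> level (last x s) <= level x + k%:Z.
Proof.
elim: s x k => [|y s IH] x k /=.
  by rewrite lerDl.
rewrite route_time_cons.
have [->|[a pa]] := passage_time_nat R F w x y.
  by have [->|[n ->]] := route_time_nat R F w y s.
have [->|[b rb]] := route_time_nat R F w y s; first by rewrite pa.
rewrite pa rb -EFinD -natrD => /eqP; rewrite eqe eqr_nat => /eqP <-.
have [i [_ _ wa]] := passage_timeP pa.
apply: le_trans (IH _ _ rb) _; rewrite PoszD addrA lerD2r -wa.
exact: env_walk_level.
Qed.

Lemma activation_time_level w x (n : nat) : level x = n.+1%:Z -> (n%:R%:E < T w x)%E.
Proof.
move=> lx; have [->|[k Tk]] := activation_time_nat R F w x; first exact: ltry.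
have /activation_timeP[[s [sx sk]] _] := Tk.
have := route_time_level sk.
rewrite sx lx [level _]level0 add0r Tk lte_fin ltr_nat.
by rewrite lez_nat.
Qed.

End reaching.

Section survival.
Context (R : realType) (d : nat) (disp : measure_display)
  (Om : measurableType disp) (P : probability Om R)
  (X : env_index d -> Om -> nat) (dir_of : nat -> direction d).
Hypothesis Xm : forall j B, measurable (X j @^-1` B).
Variables (M L : nat) (U : seq (seq (direction d))).
Variable level : site d -> int.
Hypothesis level0 : level 0 = 0.
Hypothesis level_step : forall x v, level (x + step_vec v) <= level x + 1.
Hypothesis U_level_end : forall u x, u \in U ->
  level (x + displacement u) = level x + 1.
Variable a : R.
Hypothesis a_gt0 : 0 < a.
Local Notation blocks := (blocks M L U).
Local Notation V n := (\big[setU/set0]_(bs <- words blocks n) chain_event X dir_of 0 bs).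
Hypothesis V_ge : forall n, a <= Pr P (V n).

Lemma chain_event_level bs x : all [in blocks] bs ->
  level (x + \sum_(b <- bs) displacement b.2) = level x + (size bs)%:Z.
Proof.
elim: bs x => [|b bs IH] x /=; first by rewrite big_nil !addr0.
move=> /andP[/mem_blocks[_ bU] /IH h]; rewrite big_cons addrA h U_level_end//.
by rewrite -addrA; congr (_ + _); rewrite -add1n PoszD.
Qed.

Lemma chain_event_rcons bs b x : chain_event X dir_of x (rcons bs b) `<=` chain_event X dir_of x bs.
Proof. by elim: bs x => [|b' bs IH] x w //= [h1 /IH]. Qed.

Lemma survives_chains w : (forall n, V n w) -> survives R (env_frogs X dir_of) w.
Proof.
move=> h; apply: survives_of_late_activation => n.
have := h n.+1; rewrite -bigcup_seq => -[bs /=]; rewrite mem_words => /andP[/eqP sbs bsB] cb.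
exists (0 + \sum_(b <- bs) displacement b.2 : site d); split.
  by apply: chain_event_reach cb; rewrite -[0 : site d]/(Defs.root (Zd d)) activation_time_root ltry.
apply: (activation_time_level R X dir_of level0 level_step).
by rewrite chain_event_level// level0 add0r sbs.
Qed.

(** The events [V n] decrease, since a chain restricts to its initial blocks, and their intersection
    forces survival; continuity from above keeps the bound [a]. *)
Lemma survives_positive : (0 < P [set w | survives R (env_frogs X dir_of) w])%E.
Proof.
have mV n : measurable (V n).
  by apply: bigsetU_measurable => bs _; exact: chain_event_measurable.
have mS : measurable [set w | survives R (env_frogs X dir_of) w].
  by apply: survives_measurable => j; exact: frog_sigma_measurable.
have VS n : V n.+1 `<=` V n.
  move=> w; rewrite -!bigcup_seq => -[bs /=]; rewrite mem_words => /andP[/eqP sbs].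
  case/lastP: bs sbs => [//|bs b]; rewrite size_rcons all_rcons => -[sbs] /andP[_ bsB].
  by move=> /chain_event_rcons h; exists bs => //=; rewrite mem_words sbs eqxx.
have VP : P (V n) @[n --> \oo] --> P (\bigcap_n V n).
  apply: nonincreasing_cvg_mu => //.
  - by rewrite (le_lt_trans (probability_le1 _ _)) ?ltry.
  - exact: bigcapT_measurable.
  - apply/nonincreasing_seqP => n; exact/subsetPset/VS.
apply: (@lt_le_trans _ _ a%:E); first by rewrite lte_fin.
apply: (@le_trans _ _ (P (\bigcap_n V n))).
  rewrite -(cvg_lim (@ereal_hausdorff R) VP); apply: lime_ge.
    by apply/cvg_ex; eexists; exact: VP.
  by apply: nearW => n; rewrite -PrE// lee_fin.
apply: le_measure; rewrite ?inE//; first exact: bigcapT_measurable.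
by move=> w h; apply: survives_chains => n; exact: h.
Qed.
End survival.

Lemma exists_finite_law (R : realType) (n : nat) (f : nat -> R) :
  (forall k, 0 <= f k) -> \sum_(k < n) f k = 1 ->
  exists nu : probability nat R, forall B, nu B = (\sum_(k < n) f k * \1_B (k : nat))%:E.
Proof.
move=> f0 f1.
pose mu : {measure set nat -> \bar R} := msum (fun k => mscale (NngNum (f0 k)) (dirac k)) n.
have muE B : mu B = (\sum_(k < n) f k * \1_B (k : nat))%:E.
  by rewrite /mu /= /msum -sumEFin; apply: eq_bigr => k _; rewrite /mscale EFinM; congr (_ * _)%E; rewrite /dirac indicE.
have muT : mu setT = 1%E.
  by rewrite muE -f1; congr EFin; apply: eq_bigr => k _; rewrite indicE in_setT mulr1.
(* The total mass is [1], so normalizing only packages the measure as a probability. *)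
exists (mnormalize mu (dirac 0%N)) => B; rewrite -(muE B).
change (mnormalize mu (dirac 0%N) B = mu B).
by rewrite /mnormalize muT; case: ifPn => [/orP[|//]|_]; rewrite ?onee_eq0//= invr1 mule1.
Qed.

(** * Choice of the walks and of the dimension *)

Section walk_family.
Context (d e L0 : nat).
Hypothesis e_gt0 : (0 < e)%N.
Hypothesis e_le : (5 * e <= d)%N.

Local Notation dirs := (enum {: direction d}).

(* Coordinates 0 .. 5e-1 are split into five classes of size e, the others form class 5. *)
Definition coord_class (i : 'I_d) : nat := minn (i %/ e) 5.

Definition class_coords (c : nat) : seq 'I_d := [seq i <- enum 'I_d | coord_class i == c].

(** Class [0] gives the level, classes [1] to [4] the four coordinates of the Green function; class
    [5] holds the ordinary coordinates. *)
Definition class_sum (c : nat) (x : site d) : int :=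
  \sum_(i < d | coord_class i == c) x ord0 i.

Definition sign_of (b : bool) : int := if b then 1 else -1.

Lemma class_sumB c x y : class_sum c (x - y) = class_sum c x - class_sum c y.
Proof. by rewrite /class_sum -sumrB; apply: eq_bigr => i _; rewrite !mxE. Qed.

Lemma class_sum0 c : class_sum c 0 = 0.
Proof. by rewrite /class_sum big1// => i _; rewrite mxE. Qed.

Lemma class_sumD c x y : class_sum c (x + y) = class_sum c x + class_sum c y.
Proof. by rewrite /class_sum -big_split; apply: eq_bigr => i _; rewrite !mxE. Qed.

Lemma class_sum_step c (v : direction d) :
  class_sum c (step_vec v) = if coord_class v.1 == c then sign_of v.2 else 0.
Proof.
rewrite /class_sum; case: ifPn => [vc|vc].
  rewrite (bigD1 v.1)//= big1 => [|i /andP[_ iv]]; last first.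
    by rewrite !mxE (negbTE iv) andbF mulr0.
  by rewrite !mxE !eqxx /= mulr1 addr0.
rewrite big1// => i ic; rewrite !mxE.
by have [iv|iv] := eqVneq i v.1; [rewrite -iv ic in vc|rewrite mulr0].
Qed.

Lemma class_sum_step_le c v : `|class_sum c (step_vec v)| <= 1.
Proof. by rewrite class_sum_step; case: ifP => // _; case: (v.2). Qed.

Lemma class_sum_displacement c (u : seq (direction d)) :
  class_sum c (displacement u) =
  \sum_(v <- u) if coord_class v.1 == c then sign_of v.2 else 0.
Proof.
rewrite /displacement; elim: u => [|v u IH]; first by rewrite !big_nil class_sum0.
by rewrite !big_cons class_sumD IH class_sum_step.
Qed.

Lemma size_class_coords c : (c < 5)%N -> size (class_coords c) = e.
Proof.
move=> c5; have ce (i : nat) : (minn (i %/ e) 5 == c) = (c * e <= i < c.+1 * e)%N.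
  rewrite -leq_divRL// -ltn_divLR//; move: (i %/ e)%N => q.
  by apply/eqP/andP => [h|[h1 h2]]; [split|]; lia.
rewrite size_filter -(count_map val (fun i => minn (i %/ e) 5 == c)) val_enum_ord.
rewrite (eq_count ce) -size_filter.
rewrite (_ : [seq i <- iota 0 d | _] = iota (c * e) e) ?size_iota//.
apply: (irr_sorted_eq ltn_trans ltnn).
- by apply: sorted_filter; [exact: ltn_trans|exact: iota_ltn_sorted].
- exact: iota_ltn_sorted.
- move=> i; rewrite mem_filter !mem_iota add0n /= mulSn.
  have h : (c.+1 * e <= 5 * e)%N by rewrite leq_mul2r c5 orbT.
  by apply/idP/idP; rewrite mulSn in h; lia.
Qed.

Lemma size_class5 : size (class_coords 5) = (d - 5 * e)%N.
Proof.
have ce (i : nat) : (minn (i %/ e) 5 == 5) = (5 * e <= i)%N.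
  by rewrite -leq_divRL//; move: (i %/ e)%N => q; apply/eqP/idP; lia.
rewrite size_filter -(count_map val (fun i => minn (i %/ e) 5 == 5)) val_enum_ord.
rewrite (eq_count ce) -size_filter.
rewrite (_ : [seq i <- iota 0 d | _] = iota (5 * e) (d - 5 * e)) ?size_iota//.
apply: (irr_sorted_eq ltn_trans ltnn).
- by apply: sorted_filter; [exact: ltn_trans|exact: iota_ltn_sorted].
- exact: iota_ltn_sorted.
- by move=> i; rewrite mem_filter !mem_iota add0n /=; apply/idP/idP; lia.
Qed.

Definition class_dirs (c : nat) : seq (direction d) :=
  [seq (i, b) | i <- class_coords c, b <- [:: true; false]].

Definition up_dirs : seq (direction d) := [seq (i, true) | i <- class_coords 0].

Fixpoint choices (ds : seq (seq (direction d))) : seq (seq (direction d)) :=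
  if ds is D :: ds' then [seq v :: s | v <- D, s <- choices ds'] else [:: [::]].

(** The upward step comes last, so that all sites of a block but its end lie on one level. *)
Definition final_parts : seq (seq (direction d)) :=
  choices [:: class_dirs 1; class_dirs 2; class_dirs 3; class_dirs 4; up_dirs].

Definition ordinary_pred (o : seq (direction d)) : bool :=
  uniq (map fst o) && all (fun v => coord_class v.1 == 5) o.

Definition ordinary_parts : seq (seq (direction d)) :=
  [seq o <- words dirs L0 | ordinary_pred o].

Definition walk_family : seq (seq (direction d)) :=
  [seq o ++ s | o <- ordinary_parts, s <- final_parts].

Lemma class_coordsP c i : i \in class_coords c -> coord_class i = c.
Proof. by rewrite mem_filter => /andP[/eqP]. Qed.

Lemma class_dirsP c v : v \in class_dirs c -> coord_class v.1 = c.
Proof. by move=> /allpairsP[[i b] /= [/class_coordsP ic _ ->]]. Qed.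

Lemma up_dirsP v : v \in up_dirs -> coord_class v.1 = 0%N /\ v.2 = true.
Proof. by move=> /mapP[i /class_coordsP ic ->]. Qed.

Lemma class_coords_uniq c : uniq (class_coords c).
Proof. by rewrite filter_uniq// enum_uniq. Qed.

Lemma class_dirs_uniq c : uniq (class_dirs c).
Proof.
apply: allpairs_uniq => //; first exact: class_coords_uniq.
by move=> [? ?] [? ?] /= _ _ [-> ->].
Qed.

Lemma up_dirs_uniq : uniq up_dirs.
Proof. by rewrite map_inj_uniq ?class_coords_uniq// => x y []. Qed.

Lemma choices_uniq ds : all uniq ds -> uniq (choices ds).
Proof.
elim: ds => //= D ds IH /andP[uD /IH uds]; apply: allpairs_uniq => //.
by move=> [? ?] [? ?] /= _ _ [-> ->].
Qed.

Lemma final_partsP s : s \in final_parts -> exists v1 v2 v3 v4 v0,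
  [/\ s = [:: v1; v2; v3; v4; v0],
      [/\ coord_class v1.1 = 1%N, coord_class v2.1 = 2%N, coord_class v3.1 = 3%N &
          coord_class v4.1 = 4%N], coord_class v0.1 = 0%N & v0.2 = true].
Proof.
rewrite /final_parts => /allpairsP[[v1 s1] [/class_dirsP h1 + ->]].
move=> /allpairsP[[v2 s2] [/class_dirsP h2 + ->]].
move=> /allpairsP[[v3 s3] [/class_dirsP h3 + ->]].
move=> /allpairsP[[v4 s4] [/class_dirsP h4 + ->]].
move=> /allpairsP[[v0 s0] [/up_dirsP[h0 h0'] + ->]].
rewrite /= inE => /eqP ->.
by exists v1, v2, v3, v4, v0.
Qed.

Lemma walk_familyP u : u \in walk_family -> exists o v1 v2 v3 v4 v0,
  [/\ u = o ++ [:: v1; v2; v3; v4; v0], size o = L0 /\ ordinary_pred o,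
      [/\ coord_class v1.1 = 1%N, coord_class v2.1 = 2%N, coord_class v3.1 = 3%N &
          coord_class v4.1 = 4%N], coord_class v0.1 = 0%N & v0.2 = true].
Proof.
move=> /allpairsP[[w s] /= [oO /final_partsP[v1 [v2 [v3 [v4 [v0 [-> h1 h2 h3]]]]]] ->]].
move: oO; rewrite mem_filter mem_words => /andP[oo /andP[/eqP so _]].
by exists w, v1, v2, v3, v4, v0.
Qed.

Lemma walk_family_uniq : uniq walk_family.
Proof.
apply: allpairs_uniq.
- by apply/filter_uniq/words_uniq/enum_uniq.
- by apply: choices_uniq; rewrite /= !class_dirs_uniq up_dirs_uniq.
move=> [w s] [w' s'] h h' /=.
have [[a b] /= [oO _ [oa _]]] := allpairsP h; have [[a' b'] /= [oO' _ [oa' _]]] := allpairsP h'.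
move: oO oO'; rewrite -oa -oa' => {h h' oa oa'}; rewrite !mem_filter !mem_words => /andP[_ /andP[/eqP sa _]] /andP[_ /andP[/eqP sa' _]].
by move=> /eqP; rewrite eqseq_cat ?sa ?sa'// => /andP[/eqP -> /eqP ->].
Qed.

Lemma walk_family_size u : u \in walk_family -> size u = (L0 + 5)%N.
Proof.
by move=> /walk_familyP[w [v1 [v2 [v3 [v4 [v0 [-> [so _] _ _ _]]]]]]]; rewrite size_cat so.
Qed.

Lemma walk_family_coords u : u \in walk_family -> uniq (map fst u).
Proof.
move=> /walk_familyP[w [v1 [v2 [v3 [v4 [v0 [-> [_ /andP[uo /allP co]] [h1 h2 h3 h4] h0 _]]]]]]].
rewrite map_cat cat_uniq uo /=; apply/andP; split.
  have no v : coord_class v.1 != 5 -> v.1 \notin map fst w.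
    by move=> v5; apply/negP => /mapP[v' /co /eqP v'5 vv']; rewrite vv' v'5 in v5.
  by rewrite !negb_or !no ?h1 ?h2 ?h3 ?h4 ?h0.
have ne (v v' : direction d) : coord_class v.1 != coord_class v'.1 -> v.1 != v'.1.
  by apply: contra_neq => ->.
by rewrite !in_cons !in_nil !orbF !negb_or !ne ?h1 ?h2 ?h3 ?h4 ?h0.
Qed.

Lemma trail_coord (i : 'I_d) (u : seq (direction d)) (x z : site d) : i \notin map fst u -> z \in x :: trail x u ->
  z ord0 i = x ord0 i.
Proof.
elim: u x => [|v u IH] x /=; first by rewrite inE => _ /eqP ->.
rewrite in_cons negb_or => /andP[iv iu]; rewrite in_cons => /predU1P[->//|].
move=> /(IH _ iu) ->; rewrite !mxE (negbTE iv) andbF mulr0 addr0//.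
Qed.

(** The coordinate changed by the first step is never touched again, so the trail cannot return to
    its start; the same holds from every later site. *)
Lemma trail_simple (u : seq (direction d)) (x : site d) : uniq (map fst u) -> uniq (x :: trail x u).
Proof.
elim: u x => [//|v u IH] x /= /andP[vu uu].
have /= -> := IH (x + step_vec v) uu; rewrite andbT.
apply/negP => /(trail_coord vu); rewrite !mxE !eqxx /= mulr1.
by move=> /eqP; rewrite -subr_eq0 opprD addrA subrr add0r; case: (v.2).
Qed.

Lemma trail_rcons u v (x : site d) :
  trail x (rcons u v) = rcons (trail x u) (last x (trail x u) + step_vec v).
Proof. by elim: u x => //= v' u IH x; rewrite IH. Qed.

Lemma trail_class_sum c u x z : all (fun v => coord_class v.1 != c) u ->
  z \in x :: trail x u -> class_sum c z = class_sum c x.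
Proof.
elim: u x => [|v u IH] x /=; first by rewrite inE => _ /eqP ->.
move=> /andP[vc uc]; rewrite in_cons => /predU1P[->//|].
by move=> /(IH _ uc) ->; rewrite class_sumD class_sum_step (negbTE vc) addr0.
Qed.

Lemma walk_family_level u x z : u \in walk_family -> z \in belast x (trail x u) ->
  class_sum 0 z = class_sum 0 x.
Proof.
move=> /walk_familyP[w [v1 [v2 [v3 [v4 [v0 [-> [_ /andP[_ /allP co]] [h1 h2 h3 h4] h0 _]]]]]]].
rewrite (_ : w ++ _ = rcons (w ++ [:: v1; v2; v3; v4]) v0); last by rewrite -cats1 -catA.
rewrite trail_rcons belast_rcons => /trail_class_sum; apply.
rewrite all_cat /= h1 h2 h3 h4 !andbT; apply/allP => v /co /eqP -> //.
Qed.

Lemma walk_family_level_end u x : u \in walk_family ->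
  class_sum 0 (x + displacement u) = class_sum 0 x + 1.
Proof.
move=> /walk_familyP[w [v1 [v2 [v3 [v4 [v0 [-> [_ /andP[_ /allP co]] [h1 h2 h3 h4] h0 h0']]]]]]].
rewrite class_sumD class_sum_displacement big_cat /= !big_cons big_nil h1 h2 h3 h4 h0 h0' /=.
rewrite big_seq big1 => [|v /co /eqP -> //].
by rewrite !add0r.
Qed.

Lemma big_class_dirs (R : nmodType) c (f : direction d -> R) :
  \sum_(v <- class_dirs c) f v = \sum_(i <- class_coords c) (f (i, true) + f (i, false)).
Proof.
rewrite /class_dirs big_allpairs_dep; apply: eq_bigr => i _.
by rewrite big_cons big_seq1.
Qed.

Lemma big_choices (R : comRingType) (fs : seq (direction d -> R)) ds :
  size fs = size ds ->
  \sum_(s <- choices ds) \prod_(q <- zip fs s) q.1 q.2 =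
  \prod_(q <- zip fs ds) \sum_(v <- q.2) q.1 v.
Proof.
elim: ds fs => [|D ds IH] [|f fs] //=; first by rewrite big_seq1 !big_nil.
move=> [sf].
rewrite big_allpairs_dep big_cons /= -(IH _ sf) mulr_suml; apply: eq_bigr => v _.
by rewrite mulr_sumr; apply: eq_bigr => s _; rewrite /= big_cons.
Qed.

Lemma lift4 : (lift ord0 ord0 = inord 1 :> 'I_4) *
  (lift ord0 (lift ord0 ord0) = inord 2 :> 'I_4) *
  (lift ord0 (lift ord0 (lift ord0 ord0)) = inord 3 :> 'I_4).
Proof. by split; [split|]; apply/val_inj; rewrite /= !inordK. Qed.

(** Ordinary steps and the upward step leave classes [1] to [4] unchanged, and the sum over
    [final_parts] factors over its five choices, each among [e] coordinates. *)
Lemma walk_family_phi (R : comRingType) (f : 'I_4 -> int -> R) :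
  \sum_(u <- walk_family) \prod_(c < 4) f c (class_sum c.+1 (displacement u)) =
  (size ordinary_parts * e ^ 5)%:R * \prod_(c < 4) (f c 1 + f c (-1)).
Proof.
rewrite /walk_family big_allpairs_dep.
transitivity (\sum_(o <- ordinary_parts) (e ^ 5)%:R * \prod_(c < 4) (f c 1 + f c (-1))); last first.
  by rewrite big_const_seq iter_addr_0 count_predT -[LHS]mulr_natl natrM mulrA.
rewrite big_seq [RHS]big_seq; apply: eq_bigr => w; rewrite mem_filter => /andP[/andP[_ /allP cw] _].
pose g (c : 'I_4) (v : direction d) : R := f c (sign_of v.2).
pose fs := [:: g ord0; g (inord 1); g (inord 2); g (inord 3); fun=> 1].
transitivity (\sum_(s <- final_parts) \prod_(q <- zip fs s) q.1 q.2).
  rewrite big_seq [RHS]big_seq; apply: eq_bigr => s /final_partsP.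
  move=> [v1 [v2 [v3 [v4 [v0 [-> [h1 h2 h3 h4] h0 _]]]]]].
  have E c : (c < 4)%N -> class_sum c.+1 (displacement (w ++ [:: v1; v2; v3; v4; v0])) =
     \sum_(v <- [:: v1; v2; v3; v4; v0]) if coord_class v.1 == c.+1 then sign_of v.2 else 0.
    move=> c4; rewrite class_sum_displacement big_cat/= [X in X + _]big_seq big1 ?add0r//.
    by move=> v /cw /eqP ->; rewrite gtn_eqF.
  rewrite !big_ord_recl big_ord0 !lift4 !E//.
  rewrite !big_cons !big_nil h1 h2 h3 h4 h0 /g /= ?inordK// !addr0 ?add0r !mulr1.
  by [].
rewrite big_choices// /= !big_cons big_nil /= !big_class_dirs /g /= !mulr1.
have S c (h : 'I_4) : (c < 5)%N ->
   \sum_(i <- class_coords c) (f h (sign_of true) + f h (sign_of false)) = e%:R * (f h 1 + f h (-1)).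
  by move=> c5; rewrite big_const_seq iter_addr_0 count_predT size_class_coords// mulr_natl.
rewrite !S// (_ : \sum_(v <- up_dirs) 1 = e%:R); last first.
  by rewrite big_const_seq iter_addr_0 count_predT /up_dirs size_map size_class_coords.
rewrite !big_ord_recl big_ord0 mulr1 natrX !lift4.
ring.
Qed.

End walk_family.

Section counting.
Context (d e L0 : nat).
Hypothesis e_gt0 : (0 < e)%N.
Hypothesis e_le : (5 * e <= d)%N.
Local Notation dirs := (enum {: direction d}).

Lemma card_direction : #|{: direction d}| = (2 * d)%N.
Proof. by rewrite card_prod card_ord card_bool mulnC. Qed.

Lemma count_fresh_dirs (l : seq 'I_d) :
  (2 * (d - 5 * e - size l) <=
   count (fun v : direction d => (coord_class e v.1 == 5) && (v.1 \notin l)) dirs)%N.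
Proof.
pose C := [seq i <- class_coords d e 5 | i \notin l].
have sC : (d - 5 * e - size l <= size C)%N.
  rewrite leq_subLR -(size_class5 e_gt0 e_le) -(count_predC [in l] (class_coords d e 5)).
  rewrite size_filter leq_add// -size_filter; apply: uniq_leq_size.
    by rewrite filter_uniq// class_coords_uniq.
  by move=> i; rewrite mem_filter => /andP[].
apply: (@leq_trans (size [seq (i, b) | i <- C, b <- [:: true; false]])).
  by rewrite size_allpairs mulnC leq_mul2r sC orbT.
rewrite -size_filter; apply: uniq_leq_size.
  apply: allpairs_uniq => //; first by apply: filter_uniq; exact: class_coords_uniq.
  by move=> [? ?] [? ?] /= _ _ [-> ->].
move=> v /allpairsP[[i b] /= [iC _ ->]].
move: iC; rewrite mem_filter => /andP[il iC]; rewrite mem_filter /= il (class_coordsP iC) eqxx.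
by rewrite mem_enum.
Qed.

(** Each new ordinary step must avoid the fewer than [L0] coordinates already used, which leaves at
    least [d - 5 * e - L0] coordinates of class [5], with two signs each. *)
Lemma count_ordinary n : (n <= L0)%N ->
  ((2 * (d - 5 * e - L0)) ^ n <= count (ordinary_pred e) (words dirs n))%N.
Proof.
elim: n => [//|n IH] nL.
rewrite -sum1_count big_mkcond big_words_cons exchange_big/=.
apply: (@leq_trans (\sum_(s <- words dirs n) (if ordinary_pred e s then 2 * (d - 5 * e - L0) else 0))%N).
  rewrite -big_mkcond big_const_seq iter_addn_0 expnS mulnC [X in (_ <= X)%N]mulnC leq_mul2r IH ?orbT//.
  exact: ltnW.
rewrite big_seq [X in (_ <= X)%N]big_seq; apply: leq_sum => s; rewrite mem_words => /andP[/eqP ss _].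
case: ifPn => // os; rewrite -big_mkcond sum1_count.
apply: (@leq_trans (2 * (d - 5 * e - size (map fst s)))%N).
  by rewrite leq_mul2l leq_sub2l ?orbT// size_map ss ltnW.
apply: leq_trans (count_fresh_dirs _) _.
apply: sub_count => v /= /andP[v5 vs]; move: os; rewrite /ordinary_pred /= => /andP[-> ->].
by rewrite v5 vs.
Qed.

Lemma size_choices (ds : seq (seq (direction d))) :
  size (choices ds) = (\prod_(D <- ds) size D)%N.
Proof. by elim: ds => [|D ds IH] /=; rewrite ?big_nil// big_cons size_allpairs IH. Qed.

Lemma size_walk_family :
  size (walk_family d e L0) = (size (ordinary_parts d e L0) * (16 * e ^ 5))%N.
Proof.
rewrite size_allpairs size_choices !big_cons big_nil /class_dirs !size_allpairs /up_dirs size_map.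
by rewrite !size_class_coords//= ; congr (_ * _)%N; rewrite !expnS expn0; lia.
Qed.

End counting.

(** * Growth of the number of blocks in high dimension *)

Section growth_rate.
Context (R : realType) (tail : nat -> R).

Lemma big_words_prod (T : eqType) (a : seq T) n (f : T -> R) :
  \sum_(s <- words a n) \prod_(t <- s) f t = (\sum_(t <- a) f t) ^+ n.
Proof.
elim: n => [|n IH]; first by rewrite big_words0 big_nil expr0.
rewrite big_words_cons exprS -IH mulr_suml; apply: eq_bigr => t _.
by rewrite mulr_sumr; apply: eq_bigr => s _; rewrite big_cons.
Qed.

(** The letter [0] has weight [1] and the other letters together the mean of [eta] truncated at [M];
    since letters are chosen freely, each of the [L] inner sites contributes the mean-field
    factor. *)
Lemma sum_codes M L : \sum_(k <- codes M L) code_weight tail k =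
  (\sum_(i < M) tail i) * (1 + \sum_(i < M) tail i) ^+ L.
Proof.
rewrite /codes big_allpairs_dep /code_weight /= -(big_mkord xpredT) /index_iota subn0.
rewrite [LHS](_ : _ = (\sum_(i <- iota 0 M) tail i) *
   \sum_(c <- words (iota 0 M.+1) L) \prod_(i <- c) label_weight tail i); last first.
  by rewrite mulr_suml; apply: eq_bigr => i _; rewrite mulr_sumr.
rewrite big_words_prod /= big_cons /=; congr (_ * (_ + _) ^+ _).
by rewrite -[1%N]/(1 + 0)%N iotaDl big_map.
Qed.

End growth_rate.

Lemma expr_unbounded (R : realType) (a b : R) : 1 < a -> exists n, b <= a ^+ n.
Proof.
move=> a1; have a0 : 0 < a - 1 by rewrite subr_gt0.
have bern n : 1 + (a - 1) * n%:R <= a ^+ n.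
  elim: n => [|n IH]; first by rewrite mulr0 addr0 expr0.
  rewrite exprS -natr1; have n0 : 0 <= n%:R :> R by [].
  have : a * (1 + (a - 1) * n%:R) <= a * a ^+ n by rewrite ler_wpM2l//; lra.
  apply: le_trans; rewrite -subr_ge0.
  rewrite (_ : _ - _ = n%:R * (a - 1) ^+ 2); last by ring.
  by rewrite mulr_ge0// sqr_ge0.
pose n := Num.bound `|b / (a - 1)|.
exists n; apply: le_trans (bern n).
have : b / (a - 1) <= n%:R.
  by apply: le_trans (ler_norm _) _; rewrite ltW// archi_boundP.
by rewrite ler_pdivrMr// mulrC; lra.
Qed.

(** Separates the growth [(p * (1 + mu)) ^+ n] of the ordinary steps from the fixed cost of the five
    final ones; [16 / 2 ^ 5] leaves the last factor [1/2]. *)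
Lemma growth_factor (R : realFieldType) (mu p x o y : R) n : 1 + mu != 0 -> x != 0 ->
  mu * (1 + mu) ^+ (n + 4) * (p / (2 * x)) ^+ (n + 5) * (o * (16 * y ^+ 5)) =
  mu / (1 + mu) * (p * (1 + mu)) ^+ 5 * ((p * (1 + mu)) ^+ n * (o / (2 * x) ^+ n))
  * (y / x) ^+ 5 / 2.
Proof.
move=> mu0 x0; have c0 : (2 * x) ^+ n != 0 by rewrite expf_neq0// mulf_neq0// pnatr_eq0.
rewrite (exprD _ n 4) (exprD _ n 5) (expr_div_n p (2 * x) n) (exprMn n p (1 + mu)).
move: (p ^+ n) ((1 + mu) ^+ n) ((2 * x) ^+ n) c0 => a b c c0; field.
by rewrite c0 mu0 x0.
Qed.

Section large_dimension.
Context (R : realType) (p mu : R).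
Hypothesis mu_gt0 : 0 < mu.
Hypothesis supercritical : 1 < p * (1 + mu).

(** Each auxiliary class takes a share of at most [1 / K] of the coordinates, so that every ordinary
    step keeps at least the share [1 - 6 / K], and [K] is chosen to make
    [m * (1 - 6 / K) >= m' > 1]. The final steps cost a constant depending on [K], which [m' ^+ L0]
    then outgrows. *)
Lemma growth_large : exists L0 K : nat, (6 <= K)%N /\
  forall d e o : nat, (K <= d)%N -> (K * L0 <= d)%N -> e = (d %/ K)%N ->
  ((2 * (d - 5 * e - L0)) ^ L0 <= o)%N ->
  2 <= mu * (1 + mu) ^+ (L0 + 4) * (p / (2 * d)%:R) ^+ (L0 + 5) * (o * (16 * e ^ 5))%:R.
Proof.
pose m := p * (1 + mu).
have m1 : 1 < m := supercritical.
pose K := maxn 6 (Num.bound `|12 * m / (m - 1)|).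
have K6 : (6 <= K)%N by rewrite leq_maxl.
have K0n : (0 < K)%N by exact: leq_trans K6.
have K0 : 0 < K%:R :> R by rewrite ltr0n.
have Kb : 12 * m / (m - 1) <= K%:R.
  apply: (@le_trans _ _ (Num.bound `|12 * m / (m - 1)|)%:R); last by rewrite ler_nat leq_maxr.
  by apply: le_trans (ler_norm _) _; rewrite ltW// archi_boundP.
pose m' := (1 + m) / 2.
have m'1 : 1 < m' by rewrite /m'; lra.
have m'K : m' <= m * (1 - 6 / K%:R).
  have : 12 * m <= K%:R * (m - 1) by rewrite -ler_pdivrMr ?subr_gt0.
  rewrite /m' mulrBr mulr1 => h.
  have : m * (6 / K%:R) <= (m - 1) / 2.
    by rewrite mulrA ler_pdivrMr//; lra.
  lra.
have [L0 hL0] := expr_unbounded (4 * (2 * K%:R) ^+ 5 * (1 + mu) / mu) m'1.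
exists L0, K; split=> //.
move=> d e o Kd KLd ed od.
have dn : (0 < d)%N := leq_trans K0n Kd.
have d0 : 0 < d%:R :> R by rewrite ltr0n.
have e1 : 1 <= 2 * K%:R * (e%:R / d%:R) :> R.
  rewrite mulrA ler_pdivlMr// mul1r -!natrM ler_nat ed.
  have e0 : (0 < d %/ K)%N by rewrite divn_gt0.
  have := ltn_ceil d (leq_trans (isT : 0 < 6)%N K6); have := leq_pmull K e0.
  by move: (d %/ K)%N => q; clear; nia.
have od' : (1 - 6 / K%:R) ^+ L0 <= o%:R / (2 * d)%:R ^+ L0 :> R.
  rewrite ler_pdivlMr; last by rewrite exprn_gt0// ltr0n muln_gt0.
  apply: (@le_trans _ _ ((2 * (d - 5 * e - L0)) ^ L0)%:R); last by rewrite ler_nat.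
  rewrite natrX -exprMn lerXn2r ?nnegrE//.
    rewrite mulr_ge0// subr_ge0 ler_pdivrMr// mul1r (ler_nat _ 6); exact: K6.
  (* The sixth share [1 / K] covers the coordinates used up by earlier ordinary steps, by
     [K * L0 <= d]. *)
  have eK : (K * (5 * e + L0) <= 6 * d)%N.
    have h1 : (e * K <= d)%N by rewrite ed leq_trunc_div.
    by rewrite mulnDr mulnCA (mulnC K e) (mulSnr 5 d) leq_add// leq_mul2l h1 orbT.
  have eLd : (5 * e + L0 <= d)%N by rewrite -(@leq_pmul2l 6)//; apply: leq_trans eK; rewrite leq_mul2r K6 orbT.
  rewrite -subnDA !natrM natrB// mulrCA ler_wpM2l// mulrBl mul1r lerD2l lerN2.
  by rewrite mulrAC ler_pdivlMr// -!natrM ler_nat mulnC.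
have ad1 : (1 - 6 / K%:R) ^+ L0 * m ^+ L0 >= m' ^+ L0.
  have h : m' <= (1 - 6 / K%:R) * m by rewrite mulrC.
  have h0 : 0 <= m' by rewrite ltW// (lt_trans ltr01).
  by rewrite -exprMn lerXn2r ?nnegrE// (le_trans h0).
pose D : R := (2 * d)%:R ^+ L0.
have D0 : 0 < D by rewrite exprn_gt0// ltr0n muln_gt0.
have E : mu * (1 + mu) ^+ (L0 + 4) * (p / (2 * d)%:R) ^+ (L0 + 5) * (o * (16 * e ^ 5))%:R =
   mu / (1 + mu) * m ^+ 5 * (m ^+ L0 * (o%:R / D)) * (e%:R / d%:R) ^+ 5 / 2.
  have mu1 : 1 + mu != 0 by rewrite gt_eqF// addr_gt0.
  have x0 : d%:R != 0 :> R by rewrite gt_eqF.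
  have xd : (2 * d)%:R = 2 * d%:R :> R by rewrite natrM.
  have oe : (o * (16 * e ^ 5))%:R = o%:R * (16 * e%:R ^+ 5) :> R.
    by rewrite natrM [in LHS](natrM _ 16) natrX.
  rewrite oe /D xd; exact: (growth_factor p o%:R e%:R L0 mu1 x0).
rewrite E.
have mu1 : 0 < mu / (1 + mu) by rewrite divr_gt0//; move: mu_gt0; lra.
have m5 : 1 <= m ^+ 5 by rewrite exprn_ege1// ltW.
have X1 : m' ^+ L0 <= m ^+ L0 * (o%:R / D).
  apply: le_trans ad1 _; rewrite mulrC ler_wpM2l ?exprn_ge0//; move: m1; lra.
have X2 : ((2 * K%:R) ^+ 5)^-1 <= (e%:R / d%:R) ^+ 5 :> R.
  rewrite -exprVn lerXn2r ?nnegrE ?invr_ge0 ?mulr_ge0 ?divr_ge0//.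
  by rewrite -[leLHS]mul1r ler_pdivrMr ?mulr_gt0// mulrC.
have K5 : 0 < (2 * K%:R) ^+ 5 :> R by rewrite exprn_gt0// mulr_gt0.
apply: (@le_trans _ _ (mu / (1 + mu) * 1 * (4 * (2 * K%:R) ^+ 5 * (1 + mu) / mu) * ((2 * K%:R) ^+ 5)^-1 / 2)).
  rewrite [leRHS](_ : _ = 2)//; move: K5; move: (_ ^+ 5) => k k0; field.
  by rewrite !gt_eqF//; move: mu_gt0; lra.
rewrite ler_wpM2r ?invr_ge0//.
have Y0 : 0 <= 4 * (2 * K%:R) ^+ 5 * (1 + mu) / mu.
  by rewrite divr_ge0 ?mulr_ge0 ?(ltW K5) ?(ltW mu_gt0)//; move: mu_gt0; lra.
apply: ler_pM => //.
- by apply: mulr_ge0 => //; rewrite mulr1 ltW.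
apply: ler_pM => //; [by rewrite mulr1 ltW| |exact: le_trans hL0 X1].
by rewrite ler_wpM2l// ltW.
Qed.

End large_dimension.

Lemma nat_div_bound (R : realType) (a b : R) : 0 < b ->
  exists D : nat, forall N : nat, (D <= N)%N -> (0 < N)%N -> a / N%:R <= b.
Proof.
move=> b0; exists (Num.bound `|a / b|) => N DN N0.
rewrite ler_pdivrMr ?ltr0n// mulrC -ler_pdivrMr//.
apply: le_trans (ler_norm _) _; apply: le_trans (_ : (Num.bound `|a / b|)%:R <= _).
  by rewrite ltW// archi_boundP.
by rewrite ler_nat.
Qed.

(** The constants are fixed in the order [L0], [K], then [D]: the number of codes and the collision
    bound depend on [M] and [L] only, so both smallness conditions hold once [N = 2d] is large. *)
Theorem supercritical_survival (R : realType) (eta : probability nat R) (p : R) (M : nat) :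
  0 <= p <= 1 ->
  1 < p * (1 + \sum_(i < M) fine (eta [set k | (i < k)%N])) ->
  exists D : nat, forall d, (D <= d)%N -> survives_with_positive_probability (Zd d) p eta.
Proof.
move=> /andP[p0 p1]; pose tail i := fine (eta [set k | (i < k)%N]).
rewrite -[\sum_(i < M) _]/(\sum_(i < M) tail i); set mu := \sum_(i < M) tail i => supc.
have tail0 i : 0 <= tail i by exact: fine_ge0.
have mu0 : 0 <= mu by exact: sumr_ge0.
have mu_gt0 : 0 < mu.
  rewrite lt_neqAle eq_sym mu0 andbT; apply: contraTneq supc => ->.
  by rewrite addr0 mulr1 -leNgt.
have [L0 [K [K6 HK]]] := growth_large mu_gt0 supc.
have K0 : (0 < K)%N by exact: leq_trans K6.
pose L := (L0 + 4)%N; pose S : R := (size (codes M L))%:R.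
pose C : R := (collision_bound L.+1 2)%:R.
have eps_gt0 : 0 < 4 / (3 * L.+1.*2.+1%:R ^+ 4) :> R.
  by rewrite divr_gt0// mulr_gt0// exprn_gt0.
have [D1 hD1] := nat_div_bound (S ^+ 2 * (2 + 2 * S ^+ 2) * C) eps_gt0.
have [D2 hD2] := nat_div_bound ((2 + 2 * S ^+ 2) * C) (ltr0n R 2).
exists (maxn (maxn K (K * L0)) (maxn (maxn D1 D2) 1)) => d.
rewrite !geq_max => /andP[/andP[Kd KLd] /andP[/andP[D1d D2d] d1]].
pose e := (d %/ K)%N; pose U := walk_family d e L0.
pose N := #|{: direction d}|.
have Nd : N = (2 * d)%N by exact: card_direction.
have N0 : (0 < N)%N by rewrite Nd muln_gt0.
have e_gt0 : (0 < e)%N by rewrite divn_gt0.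
have e5 : (5 * e <= d)%N.
  apply: leq_trans (leq_trunc_div d K); rewrite mulnC leq_mul2l.
  by rewrite (leq_trans _ K6) ?orbT.
pose v0 : direction d := (Ordinal d1, true).
(* The default [v0] concerns ranks from [N] on, which the law [unif] chosen below does not
   charge. *)
pose dir_of (k : nat) := nth v0 (enum {: direction d}) k.
have [unif unifE] : exists nu : probability nat R,
    forall v, nu [set k | dir_of k = v] = (N%:R^-1)%:E.
  have [||nu nuE] := @exists_finite_law R N (fun=> N%:R^-1).
  - by move=> _; rewrite invr_ge0.
  - by rewrite sumr_const card_ord -[LHS]mulr_natl divff// pnatr_eq0 -lt0n.
  exists nu => v; rewrite nuE; congr EFin.
  rewrite (bigD1 (enum_rank v))//= big1 ?addr0.
    rewrite indicE mem_set ?mulr1//= /dir_of.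
    exact: nth_enum_rank.
  move=> k kv; rewrite indicE memNset ?mulr0//= => h.
  move/eqP: kv; apply; apply: (enum_val_inj).
  by rewrite enum_rankK -h /dir_of (enum_val_nth v0).
have [bit bitE] : exists nu : probability nat R, nu [set k | k != 0%N] = p%:E.
  have [||nu nuE] := @exists_finite_law R 2 (fun k => if k == 0%N then 1 - p else p).
  - by move=> k; case: ifP => // _; rewrite subr_ge0.
  - by rewrite !big_ord_recl big_ord0 /= addr0 subrK.
  exists nu; rewrite nuE; congr EFin; rewrite !big_ord_recl big_ord0 /= addr0.
  by rewrite !indicE memNset ?mem_set//= mulr0 add0r mulr1.
pose nu (j : env_index d) : probability nat R :=
  match j with inl _ => eta | inr (_, true) => unif | inr (_, false) => bit end.
have [disp [Om [P [X [Xm XP Xind]]]]] := exists_product_space nu.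
have Xdir g v : P (X (inr (g, true)) @^-1` [set k | dir_of k = v]) = ((N%:R : R)^-1)%:E.
  by rewrite XP unifE.
have Xbit g : P (X (inr (g, false)) @^-1` [set k | k != 0%N]) = p%:E by rewrite XP bitE.
have Xeta x B : P (X (inl x) @^-1` B) = eta B by rewrite XP.
have Xtail x i : P (X (inl x) @^-1` [set k | (i < k)%N]) = (tail i)%:E.
  by rewrite Xeta /tail fineK// fin_num_measure.
exists disp, Om, P, (env_frogs X dir_of); split.
  exact: (env_is_FM Xm Xind Xdir Xbit Xeta).
have U_size u : u \in U -> size u = L.+1.
  by move=> /walk_family_size ->; rewrite /L addnS.
have U_simple u x : u \in U -> uniq (x :: trail x u).
  by move=> /walk_family_coords; exact: trail_simple.
have U_lev u x z : u \in U -> z \in belast x (trail x u) ->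
    class_sum e 0 z = class_sum e 0 x.
  exact: walk_family_level.
have U_end u x : u \in U -> class_sum e 0 (x + displacement u) = class_sum e 0 x + 1.
  exact: walk_family_level_end.
have U_phi (f : 'I_4 -> int -> R) :
   \sum_(u <- U) \prod_(c < 4) f c (class_sum e c.+1 (displacement u)) =
   (size U)%:R * \prod_(c < 4) ((f c 1 + f c (-1)) / 2).
  (* [size U] contains the factor [16 * e ^ 5], whose [16] cancels the four halves. *)
  rewrite walk_family_phi// /U size_walk_family// big_split/= prodr_const card_ord.
  by move: (size _) (e ^ 5)%N (\prod_(c < 4) _) => a b c; rewrite !natrM; field.
have grow : 2 <= growth p tail M L U.
  rewrite /growth sum_codes -/mu /U size_walk_family// -/N Nd.
  have cnt : ((2 * (d - 5 * e - L0)) ^ L0 <= size (ordinary_parts d e L0))%N.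
    by rewrite size_filter; apply: count_ordinary.
  have := HK d e _ Kd KLd (erefl _) cnt.
  by rewrite /L -addnS.
have a_gt0 : 0 < (2 + 2 * S ^+ 2)^-1 by rewrite invr_gt0 ltr_wpDr// mulr_ge0// exprn_ge0// ler0n.
have lev0 : class_sum e 0 (0 : site d) = 0 by exact: class_sum0.
have lev_step (x : site d) v : class_sum e 0 (x + step_vec v) <= class_sum e 0 x + 1.
  rewrite class_sumD lerD2l; apply: le_trans (class_sum_step_le e 0 v); exact: ler_norm.
pose phi (c : 'I_4) : site d -> int := class_sum e c.+1.
have phiB c (x y : site d) : phi c (x - y) = phi c x - phi c y by exact: class_sumB.
have phi_step c v : `|phi c (step_vec v)| <= 1 by exact: class_sum_step_le.
have DN D : (D <= d)%N -> (D <= N)%N.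
  by move=> Dd; rewrite Nd mul2n -addnn (leq_trans Dd)// leq_addr.
have N_large1 := hD1 N (DN _ D1d) N0.
have N_large2 := hD2 N (DN _ D2d) N0.
apply: (@survives_positive _ _ _ _ _ _ dir_of Xm M L U (class_sum e 0) lev0 lev_step U_end _ a_gt0).
exact: (@chain_union_ge _ _ _ _ _ _ _ Xm Xind Xdir N0 _ Xbit _ Xtail M L U
  (walk_family_uniq d e L0) U_size U_simple _ U_lev U_end phi phiB phi_step U_phi).
Qed.

(** * Extinction below the mean-field threshold *)

Section countable_union.
Context (R : realType) (disp : measure_display) (Om : measurableType disp)
  (P : probability Om R).
Local Open Scope ereal_scope.

(** Finite partial unions increase to the whole union, so a common bound on finite sums is enough
    and no series has to be evaluated. *)
Lemma countable_union_le (E : countType) (Q : E -> set Om) (a : E -> R) (C : R) :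
  (forall e, measurable (Q e)) -> (forall e, P (Q e) <= (a e)%:E) ->
  (forall s, uniq s -> (\sum_(e <- s) a e <= C)%R) ->
  P [set w | exists e, Q e w] <= C%:E.
Proof.
move=> mQ Qa aC; pose s n : seq E := pmap (@choice.pickle_inv E) (iota 0 n).
have s_uniq n : uniq (s n) by apply: (pmap_uniq (@choice.pickle_invK E)); exact: iota_uniq.
pose V n := \big[setU/set0]_(e <- s n) Q e.
have mV n : measurable (V n) by apply: bigsetU_measurable.
have VE : [set w | exists e, Q e w] = \bigcup_n V n.
  apply/seteqP; split=> [w [e Qe]|w [n _]]; last by rewrite /V -bigcup_seq => -[e _ ?]; exists e.
  exists (choice.pickle e).+1 => //; rewrite /V -bigcup_seq; exists e => //=.
  rewrite mem_pmap; apply/mapP; exists (choice.pickle e); first by rewrite mem_iota ltnSn.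
  by rewrite choice.pickleK_inv.
have VS : {homo V : n m / (n <= m)%N >-> (n <= m)%O}.
  apply/nondecreasing_seqP => n; apply/subsetPset => w; rewrite /V -!bigcup_seq => -[e /= es Qe].
  by exists e => //=; rewrite /s -addn1 iotaD pmap_cat mem_cat es.
rewrite VE; have mU : measurable (\bigcup_n V n) by exact: bigcupT_measurable.
have VP := nondecreasing_cvg_mu (mu := P) mV mU VS.
rewrite -(cvg_lim (@ereal_hausdorff R) VP); apply: lime_le.
  by apply/cvg_ex; eexists; exact: VP.
apply: nearW => n /=; apply: (@le_trans _ _ (\sum_(e <- s n) (a e)%:E)).
  rewrite /V; elim: (s n) => [|e t IH]; first by rewrite !big_nil measure0.
  rewrite !big_cons; apply: le_trans (_ : P (Q e) + P (\big[setU/set0]_(j <- t) Q j) <= _).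
    by apply: measureU2 => //; exact: bigsetU_measurable.
  exact: leeD.
by rewrite sumEFin lee_fin; exact: aC.
Qed.

End countable_union.

Section simple_routes.
Context (R : realType) (G : rooted_graph) (Om : Type) (F : frogs G Om) (w : Om).
Local Open Scope ereal_scope.

(** Loop erasure: passage times are nonnegative, so cutting out what precedes a return to [x] does
    not lengthen the route. *)
Lemma simple_route x s : exists s', [/\ uniq (x :: s'), last x s' = last x s,
  {subset s' <= s} & route_time R F w x s' <= route_time R F w x s].
Proof.
have [n] := ubnP (size s); elim: n x s => // n IH x s; rewrite ltnS => sn.
have [xs|xs] := boolP (x \in s).
  case/splitPr: xs sn => s1 s2; rewrite size_cat /= => sn.
  have [|s' [us' ls' ss' rs']] := IH x s2; first by rewrite (leq_trans _ sn)// addnS ltnS leq_addl.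
  exists s'; split=> //; first by rewrite ls' last_cat.
    by move=> y /ss' ys2; rewrite mem_cat inE ys2 !orbT.
  apply: le_trans rs' _; rewrite route_time_cat route_time_cons.
  apply: le_trans (_ : _ <= passage_time R F w (last x s1) x + route_time R F w x s2) _.
    by rewrite leeDr//; have [->|[m ->]] := passage_time_nat R F w (last x s1) x; rewrite ?leey ?lee_fin.
  by rewrite leeDr// route_time_ge0.
case: s sn xs => [|y s] /= sn; first by exists [::].
rewrite inE negb_or => /andP[xy xs].
have [//|s' [us' ls' ss' rs']] := IH y s.
exists (y :: s'); split=> //=.
- rewrite inE negb_or xy (contra _ xs)//=; exact: ss'.
- by move=> z; rewrite !inE => /predU1P[->|/ss' ->]; rewrite ?eqxx ?orbT.
- by rewrite !route_time_cons leeD2l.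
Qed.

End simple_routes.

(** * Frog chains and their expected number *)

Section subcritical.
Context (R : realType) (G : rooted_graph) (disp : measure_display)
  (Om : measurableType disp) (P : probability Om R) (F : frogs G Om).

(* X lists the sites used before x. *)
Inductive frog_chain (w : Om) : nat -> G -> seq G -> Prop :=
| frog_chain_last n x X i : (i < particles F x w)%N ->
    alive_at n (lifetime F x i w) -> frog_chain w n x X
| frog_chain_step n x X i k y : (i < particles F x w)%N -> (k < n)%N ->
    alive_at k.+1 (lifetime F x i w) -> walk F x i k.+1 w = y ->
    y \notin x :: X -> frog_chain w (n - k.+1) y (x :: X) ->
    frog_chain w n x X.

(** A hop between distinct sites takes at least one step, since walks start at their own sites;
    hence the remaining time decreases strictly along the chain. *)
Lemma frog_chain_route w x s X (t m i : nat) :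
  (forall x i, walk F x i 0 w = x) ->
  uniq (x :: s) -> (forall y, y \in s -> y \notin X) ->
  route_time R F w x s = t%:R%:E ->
  (i < particles F (last x s) w)%N -> alive_at m (lifetime F (last x s) i w) ->
  frog_chain w (t + m) x X.
Proof.
move=> w0; elim: s x X t => [|y s IH] x X t /=.
  move=> _ _; rewrite /route_time big_nil => /eqP; rewrite eqe eq_sym pnatr_eq0 => /eqP -> ix am.
  exact: frog_chain_last ix am.
move=> /andP[xys uys] sX; rewrite route_time_cons.
have [->|[a pa]] := passage_time_nat R F w x y.
  by have [->|[n ->]] := route_time_nat R F w y s.
have [->|[b rb]] := route_time_nat R F w y s; first by rewrite pa.
rewrite pa rb -EFinD -natrD => /eqP; rewrite eqe eqr_nat => /eqP <- il aml.
have [j [jx aj wj]] := passage_timeP pa.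
move: xys; rewrite inE negb_or => /andP[xy xs].
case: a pa aj wj => [|a] pa aj wj; first by move: xy; rewrite -wj w0 eqxx.
apply: (@frog_chain_step _ _ _ _ j a y) => //.
- by rewrite -addnA ltn_addr.
- by rewrite inE negb_or eq_sym xy sX// mem_head.
have -> : (a.+1 + b + m - a.+1)%N = (b + m)%N by rewrite -addnA addKn.
apply: IH => //.
move=> z zs; rewrite inE negb_or sX ?andbT ?inE ?zs ?orbT//.
by apply: contraNneq xs => <-.
Qed.

Lemma frog_chain_active w n x i : (forall x i, walk F x i 0 w = x) ->
  active_at R F w n x i -> frog_chain w n (Defs.root G) [::].
Proof.
move=> w0 [ix [m [am]]]; have [->//|[t Tt]] := activation_time_nat R F w x.
rewrite Tt -EFinD -natrD => /eqP; rewrite eqe eqr_nat => /eqP <-.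
have /activation_timeP[[s [sx st]] _] := Tt.
have [s' [us' ls' _ rs']] := simple_route R F w (Defs.root G) s.
have rs't : route_time R F w (Defs.root G) s' = t%:R%:E.
  apply/eqP; rewrite eq_le -{1}st rs' -Tt -sx -ls'; exact: activation_time_le.
by apply: (frog_chain_route w0 us' _ rs't (i := i)); rewrite // ls' sx.
Qed.

Variables (p : R) (eta : probability nat R).
Hypothesis FM : is_FM P p eta F.

Let mF : forall j, frog_sigma F j `<=` measurable. Proof. by case: FM. Qed.

Lemma frog_chainE w n x X : frog_chain w n x X <->
  exists i, (i < particles F x w)%N /\
    (alive_at n (lifetime F x i w) \/
     exists k : 'I_n, exists y, y \notin x :: X /\
      [/\ alive_at k.+1 (lifetime F x i w), walk F x i k.+1 w = y &
          frog_chain w (n - k.+1) y (x :: X)]).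
Proof.
split=> [[n' x' X' i ix al|n' x' X' i k y ix kn al wy yX ch]|[i [ix [al|[k [y [yX [al wy ch]]]]]]]].
- by exists i; split=> //; left.
- by exists i; split=> //; right; exists (Ordinal kn), y.
- exact: frog_chain_last ix al.
- exact: (frog_chain_step ix (ltn_ord k) al wy).
Qed.

Let live x i n := [set w | alive_at n (lifetime F x i w)].
Let many x i := particles F x @^-1` [set k | (i < k)%N].
Let goes x i n y := walk F x i n @^-1` [set y].

Let live_measurable x i n : measurable (live x i n).
Proof. exact: (lifetime_measurable mF x i [set l | alive_at n l]). Qed.

Let many_measurable x i : measurable (many x i).
Proof. exact: (particles_measurable mF). Qed.

Let goes_measurable x i n y : measurable (goes x i n y).
Proof. exact: (walk_measurable mF). Qed.

Lemma frog_chain_measurable n x X : measurable [set w | frog_chain w n x X].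
Proof.
have [m] := ubnP n; elim: m n x X => // m IH n x X; rewrite ltnS => nm.
apply: (measurable_iff (fun w => frog_chainE w n x X)).
apply: exists_measurable => i.
pose C (k : 'I_n) y := [set w | y \notin x :: X /\
  (live x i k.+1 `&` goes x i k.+1 y `&` [set w | frog_chain w (n - k.+1) y (x :: X)]) w].
apply: (@measurable_iff _ _ _ (many x i `&` (live x i n `|` [set w | exists k y, C k y w]))).
  move=> w; split=> -[ix [al|[k [y [yX h]]]]]; split=> //; try by left.
    by right; exists k, y; split=> //; case: h.
  by right; exists k, y; split=> //; case: h => -[].
apply: measurableI; first exact: many_measurable.
apply: measurableU; first exact: live_measurable.
apply: exists_measurable => k; apply: exists_measurable => y.
apply: const_and_measurable.
apply: measurableI; first exact: measurableI.
by apply: IH; rewrite (leq_trans _ nm)// ltn_subrL /= (leq_ltn_trans _ (ltn_ord k)).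
Qed.

Definition frog_site (j : G + (G * nat) + (G * nat)) : G :=
  match j with inl (inl x) => x | inl (inr (x, _)) => x | inr (x, _) => x end.

(* The frogs outside X are independent of A and keep their joint law. *)
Definition independent_past (X : seq G) (A : set Om) : Prop :=
  forall (s : seq (G + (G * nat) + (G * nat))) (B : G + (G * nat) + (G * nat) -> set Om),
    uniq s -> (forall j, j \in s -> frog_sigma F j (B j)) ->
    (forall j, j \in s -> frog_site j \notin X) ->
    P (A `&` \big[setI/setT]_(j <- s) B j) = (P A * \prod_(j <- s) P (B j))%E.

Lemma independent_past_nil : independent_past [::] setT.
Proof.
move=> s B us sB _; rewrite setTI probability_setT mul1e.
by case: FM => _ /mutually_independentE ind _ _ _; exact: ind.
Qed.

(** The three variables of [x] are put in front of a list that avoids [x], so one application of the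
    hypothesis on [A] gives both the product for the new events and the independence of what lies
    outside [x :: X]. *)
Lemma independent_past_cons X A x i (B1 B2 B3 : set Om) : x \notin X ->
  frog_sigma F (inl (inl x)) B1 -> frog_sigma F (inl (inr (x, i))) B2 ->
  frog_sigma F (inr (x, i)) B3 -> independent_past X A ->
  P (A `&` (B1 `&` (B2 `&` B3))) = (P A * (P B1 * (P B2 * P B3)))%E /\
  independent_past (x :: X) (A `&` (B1 `&` (B2 `&` B3))).
Proof.
move=> xX h1 h2 h3 indA.
pose j3 : seq (G + (G * nat) + (G * nat)) := [:: inl (inl x); inl (inr (x, i)); inr (x, i)].
have E s (B : G + (G * nat) + (G * nat) -> set Om) : uniq s ->
    (forall j, j \in s -> frog_sigma F j (B j)) ->
    (forall j, j \in s -> frog_site j \notin x :: X) ->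
    P (A `&` (B1 `&` (B2 `&` B3)) `&` \big[setI/setT]_(j <- s) B j) =
    (P A * (P B1 * (P B2 * P B3)) * \prod_(j <- s) P (B j))%E.
  move=> us sB sX.
  pose B' j := if frog_site j == x then
    match j with inl (inl _) => B1 | inl (inr _) => B2 | inr _ => B3 end else B j.
  have B'B j : j \in s -> B' j = B j.
    move=> /sX; rewrite inE negb_or => /andP[h _].
    by rewrite /B' ifN.
  have sj j : j \in j3 -> frog_site j = x by rewrite !inE => /or3P[] /eqP ->.
  have := indA (j3 ++ s) B'; rewrite !big_cat !big_cons !big_nil.
  rewrite (eq_big_seq _ B'B).
  under [X in _ -> _ -> _ -> _ = (_ * (_ * X))%E]eq_big_seq => j /B'B -> do over.
  rewrite /B' /= eqxx setIT mule1 -!setIA -!muleA => -> //.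
  - have js j : j \in j3 -> j \notin s.
      by move=> /sj jx; apply/negP => /sX; rewrite jx mem_head.
    by rewrite us /= !inE !js// !inE eqxx ?orbT.
  - move=> j js; have [jx|jx] := eqVneq (frog_site j) x; last first.
      have j_s : j \in s by case/or4P: js jx => [/eqP ->|/eqP ->|/eqP ->|//]; rewrite eqxx.
      exact: sB.
    case/or4P: js => [/eqP ->|/eqP ->|/eqP ->|/sX]//; by rewrite jx mem_head.
  - move=> j; case/or4P => [/eqP ->|/eqP ->|/eqP ->|/sX]//.
    by rewrite inE negb_or => /andP[].
split; first by have := E [::] (fun=> setT); rewrite !big_nil setIT mule1; apply.
by move=> s B us sB sX; rewrite E//; congr (_ * _)%E; have := E [::] (fun=> setT); rewrite !big_nil setIT mule1 => ->.
Qed.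

Variable mu : R.
Let tail i : R := fine (eta [set k | (i < k)%N]).
Hypothesis p_ge0 : 0 <= p.
Hypothesis sum_tail : forall N, \sum_(i < N) tail i <= mu.

Let tail_ge0 i : 0 <= tail i. Proof. exact: fine_ge0. Qed.
Let mu_ge0 : 0 <= mu. Proof. by have := sum_tail 0; rewrite big_ord0. Qed.

Let P_many x i : P (many x i) = (tail i)%:E.
Proof. by case: FM => _ _ h _ _; rewrite h fineK// fin_num_measure. Qed.

(** The lifetimes [1] to [n] have total mass [1 - p ^+ n], and none of them reaches time [n].
    Arguing by the complement treats [p = 1] in the same way. *)
Let P_live x i n : (P (live x i n) <= (p ^+ n)%:E)%E.
Proof.
case: FM => _ _ _ _ /(_ x i)[geo _].
have mL B : measurable (lifetime F x i @^-1` B) by exact: lifetime_measurable.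
pose dies j := lifetime F x i @^-1` [set Some j.+1].
pose D k := \big[setU/set0]_(j < k) dies j.
have mD k : measurable (D k) by apply: bigsetU_measurable => j _; exact: mL.
have PD k : P (D k) = (1 - p ^+ k)%:E.
  elim: k => [|k IH]; first by rewrite /D big_ord0 measure0 expr0 subrr.
  have -> : D k.+1 = D k `|` dies k by rewrite /D big_ord_recr.
  apply: (etrans (measureU _ (mD k) (mL _) _)).
    apply/seteqP; split=> // w []; rewrite /D -(bigcup_mkord k dies) => -[j /= jk].
    by rewrite /dies /= => -> [jk']; move: jk; rewrite jk' ltnn.
  by rewrite [X in (X + _)%E]IH [X in (_ + X)%E](geo k.+1 _)//= -EFinD exprS; congr EFin; ring.
apply: (@le_trans _ _ (P (~` D n))).
  apply: le_measure; rewrite ?inE//; first exact: measurableC.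
  move=> w /= al; rewrite /D -(bigcup_mkord n dies) => -[j /= jn Lj].
  by move: al; rewrite /live /= (Lj : lifetime F x i w = Some j.+1) /=; rewrite ltnNge jn.
by rewrite probability_setC// PD -EFinB lee_fin subKr.
Qed.

(** Renewal identity: the present frog lasts until [n], or is left at step [k.+1] for one of [mu]
    frogs on average, whose chains have the time [n - k.+1] left. *)
Let growth_sum n : p ^+ n + \sum_(k < n) p ^+ k.+1 * (mu * (p * (1 + mu)) ^+ (n - k.+1)) =
  (p * (1 + mu)) ^+ n.
Proof.
elim: n => [|n IH]; first by rewrite big_ord0 addr0 !expr0.
rewrite big_ord_recl /= subSS subn0 expr1.
have -> : \sum_(i < n) p ^+ (bump 0 i).+1 * (mu * (p * (1 + mu)) ^+ (n.+1 - (bump 0 i).+1)) =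
    p * \sum_(k < n) p ^+ k.+1 * (mu * (p * (1 + mu)) ^+ (n - k.+1)).
  by rewrite mulr_sumr; apply: eq_bigr => k _; rewrite /bump /= add1n subSS exprS -mulrA.
rewrite [in RHS]exprS -{2}IH exprS.
by move: IH; set S := \sum_(_ < _) _; set c := (p * (1 + mu)) ^+ n => <-; ring.
Qed.

(** Union bound over the first frog [i], its number of steps and the site [y] where it is left. For
    different [y] the events are disjoint, so the walk contributes a total of at most [1] on any
    graph. The rest of the chain is bounded by induction with the enlarged past, and [growth_sum]
    adds up the terms. *)
Lemma frog_chain_le n x X A : x \notin X -> measurable A -> independent_past X A ->
  (P (A `&` [set w | frog_chain w n x X]) <=
   (fine (P A) * (mu * (p * (1 + mu)) ^+ n))%:E)%E.
Proof.
have [m] := ubnP n; elim: m n x X A => // m IH n x X A; rewrite ltnS => nm xX mA indA.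
pose c k := mu * (p * (1 + mu)) ^+ k.
have c_ge0 k : 0 <= c k.
  by rewrite mulr_ge0// exprn_ge0// mulr_ge0// addr_ge0.
have PA0 : 0 <= fine (P A) by exact: fine_ge0.
have w_ge0 i k j : 0 <= fine (P A) * (tail i * p ^+ k) * c j.
  by apply: mulr_ge0 => //; apply: mulr_ge0 => //; apply: mulr_ge0 => //; exact: exprn_ge0.
have PAE : P A = (fine (P A))%:E by rewrite fineK// fin_num_measure.
have m_many i : frog_sigma F (inl (inl x)) (many x i) by exists [set k | (i < k)%N].
have m_live i k : frog_sigma F (inr (x, i)) (live x i k) by exists [set l | alive_at k l].
pose C i k y := A `&` (many x i `&` (goes x i k.+1 y `&` live x i k.+1)) `&`
  [set w | frog_chain w (n - k.+1) y (x :: X) /\ y \notin x :: X].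
have mC i k y : measurable (C i k y).
  apply: measurableI.
    by apply: measurableI => //; apply: measurableI => //; exact: measurableI.
  apply: (@measurable_iff _ _ _ [set w | y \notin x :: X /\ [set w | frog_chain w (n - k.+1) y (x :: X)] w]).
    by move=> w; split=> -[].
  exact/const_and_measurable/frog_chain_measurable.
have PC i k y : (k < n)%N ->
    (P (C i k y) <= (fine (P A) * (tail i * p ^+ k.+1) * c (n - k.+1)%N *
       fine (P (goes x i k.+1 y)))%:E)%E.
  move=> kn; have [yX|yX] := boolP (y \in x :: X).
    rewrite (_ : C i k y = set0) ?measure0 ?lee_fin; last first.
      by apply/seteqP; split=> // w [_ [_]]; rewrite yX.
    by rewrite mulr_ge0 ?fine_ge0.
  have m_goes : frog_sigma F (inl (inr (x, i))) (goes x i k.+1 y).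
    by apply: sub_sigma_algebra; exists k.+1 => //; exists [set y].
  have [PE indE] := independent_past_cons xX (m_many i) m_goes (m_live i k.+1) indA.
  have PlE : P (live x i k.+1) = (fine (P (live x i k.+1)))%:E by rewrite fineK// fin_num_measure.
  have PgE : P (goes x i k.+1 y) = (fine (P (goes x i k.+1 y)))%:E by rewrite fineK// fin_num_measure.
  have nk : (n - k.+1 < m)%N by rewrite (leq_trans _ nm)// ltn_subrL /= (leq_ltn_trans _ kn).
  rewrite (_ : C i k y = A `&` (many x i `&` (goes x i k.+1 y `&` live x i k.+1)) `&`
      [set w | frog_chain w (n - k.+1) y (x :: X)]); last first.
    by apply/seteqP; split=> w [? h]; split=> //; case: h.
  apply: le_trans (IH _ _ _ _ nk yX _ indE) _.
    by apply: measurableI => //; apply: measurableI => //; exact: measurableI.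
  rewrite PE PAE P_many PlE PgE -!EFinM lee_fin /= -/(c _).
  rewrite [leRHS](_ : _ = fine (P A) * (tail i * (fine (P (goes x i k.+1 y)) * p ^+ k.+1)) * c (n - k.+1)%N); last by ring.
  rewrite ler_wpM2r// ler_wpM2l// ler_wpM2l// ler_wpM2l ?fine_ge0//.
  by rewrite -lee_fin -PlE.
pose D i := [set w | exists k : 'I_n, exists y, C i k y w].
have mD i : measurable (D i) by do 2!apply: exists_measurable => ?.
have PD i : (P (D i) <= (\sum_(k < n) fine (P A) * (tail i * p ^+ k.+1) * c (n - k.+1)%N)%:E)%E.
  apply: (@countable_union_le _ _ _ _ _ _ (fun k : 'I_n => fine (P A) * (tail i * p ^+ k.+1) * c (n - k.+1)%N)).
  - by move=> k; apply: exists_measurable => ?.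
  - move=> k; apply: (@countable_union_le _ _ _ _ _ _ (fun y =>
      fine (P A) * (tail i * p ^+ k.+1) * c (n - k.+1)%N * fine (P (goes x i k.+1 y)))) => //.
      by move=> y; exact: PC.
    move=> s us; rewrite -mulr_sumr -[leRHS]mulr1 ler_wpM2l//.
    rewrite -(PrT P); under eq_bigr => y _ do rewrite -(setTI (goes x i k.+1 y)).
    apply: sum_Pr_disjoint => // y y' yy'; apply/seteqP; split=> // w [h h'].
    by move/eqP: yy'; apply; rewrite -(h : walk F x i k.+1 w = y).
  - move=> s us; apply: ler_sum_sub => //.
      by move=> k _; rewrite mem_index_enum.
(* The factor [setT] stands for the walk, which is unrestricted when the chain ends with frog
   [i]. *)
pose E i := A `&` (many x i `&` (setT `&` live x i n)).
have mE i : measurable (E i) by apply: measurableI => //; apply: measurableI => //; exact: measurableI.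
have PE i : (P (E i) <= (fine (P A) * (tail i * p ^+ n))%:E)%E.
  have m_goes : frog_sigma F (inl (inr (x, i))) setT by exact: sigma_setT.
  have [-> _] := independent_past_cons xX (m_many i) m_goes (m_live i n) indA.
  have PlE : P (live x i n) = (fine (P (live x i n)))%:E by rewrite fineK// fin_num_measure.
  rewrite PAE P_many probability_setT mul1e PlE -!EFinM lee_fin ler_wpM2l// ler_wpM2l//.
  by rewrite -lee_fin -PlE.
have -> : A `&` [set w | frog_chain w n x X] = [set w | exists i, (E i `|` D i) w].
  apply/seteqP; split=> w.
    move=> [Aw /frog_chainE[i [ix [al|[k [y [yX [al wy ch]]]]]]]]; exists i; first by left.
    by right; exists k, y.
  move=> [i [[Aw [ix [_ al]]]|[k [y [[Aw [ix [wy al]]] [ch yX]]]]]]; split=> //.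
    by apply/frog_chainE; exists i; split=> //; left.
  by apply/frog_chainE; exists i; split=> //; right; exists k, y.
apply: (@countable_union_le _ _ _ _ _ _ (fun i => tail i * (fine (P A) * (p * (1 + mu)) ^+ n))).
- by move=> i; exact: measurableU.
- move=> i; apply: (@le_trans _ _ (P (E i) + P (D i))%E); first exact: measureU2.
  apply: le_trans (leeD (PE i) (PD i)) _.
  rewrite -EFinD lee_fin -growth_sum [leRHS]mulrA mulrDr mulr_sumr.
  rewrite lerD//; first by rewrite mulrA (mulrC (tail i)).
  by apply: ler_sum => k _; rewrite le_eqVlt; apply/orP; left; apply/eqP; rewrite /c; ring.
- move=> s us; rewrite -mulr_suml mulrCA ler_wpM2l//.
  rewrite ler_wpM2r ?exprn_ge0 ?mulr_ge0 ?addr_ge0//.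
  (* All indices in [s] lie below [N], so the sum is part of an initial sum of tails. *)
  pose N := (\max_(i <- s) i).+1.
  apply: le_trans (sum_tail N); rewrite -(big_mkord xpredT tail).
  apply: ler_sum_sub => //.
  by move=> i si; rewrite mem_index_iota /= ltnS; exact: leq_bigmax_seq.
Qed.

(** The law makes a walk start at its site only almost surely; the countably many exceptional events
    are discarded together. *)
Lemma walk_start_null : P [set w | exists xi : G * nat, walk F xi.1 xi.2 0 w <> xi.1] = 0%E.
Proof.
apply/eqP; rewrite eq_le measure_ge0 andbT.
apply: (@countable_union_le _ _ _ _ _ (fun xi => ~` (goes xi.1 xi.2 0 xi.1)) (fun=> 0)).
- by move=> xi; apply: measurableC.
- move=> [x i] /=; rewrite probability_setC//.
  have -> : goes x i 0 x = [set w | forall k, (k <= 0)%N -> walk F x i k w = x].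
    apply/seteqP; split=> w; first by move=> h k; rewrite leqn0 => /eqP ->.
    by move=> h; exact: h.
  case: FM => _ _ _ /(_ x i 0%N (fun=> x)) -> _.
  by rewrite big_ord0 eqxx mulr1 subee.
- by move=> s _; rewrite big1.
Qed.

Lemma survives_le n : (P [set w | survives R F w] <= (mu * (p * (1 + mu)) ^+ n)%:E)%E.
Proof.
set bad := [set w | exists xi : G * nat, walk F xi.1 xi.2 0 w <> xi.1].
have mbad : measurable bad.
  by apply: exists_measurable => xi; exact: (measurableC (goes_measurable xi.1 xi.2 0 xi.1)).
have mch := frog_chain_measurable n (Defs.root G) [::].
apply: (@le_trans _ _ (P (bad `|` [set w | frog_chain w n (Defs.root G) [::]]))).
  apply: le_measure; rewrite ?inE//; first exact: survives_measurable.
    exact: measurableU.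
  move=> w /(_ n)[x [i act]]; have [|h] := pselect (bad w); first by left.
  right; apply: (frog_chain_active _ act) => y j; apply: contrapT => ne; apply: h.
  by exists (y, j).
apply: (@le_trans _ _ (P bad + P [set w | frog_chain w n (Defs.root G) [::]])%E).
  exact: measureU2.
rewrite [P bad]walk_start_null add0e.
have := @frog_chain_le n (Defs.root G) [::] setT isT measurableT independent_past_nil.
by rewrite setTI probability_setT /= mul1r.
Qed.

Lemma subcritical_extinction : p * (1 + mu) < 1 -> P [set w | survives R F w] = 0%E.
Proof.
move=> sub; apply/eqP; rewrite eq_le measure_ge0 andbT.
have h : (mu * (p * (1 + mu)) ^+ n) @[n --> \oo] --> (0 : R).
  rewrite -[0](mulr0 mu); apply: cvgMr; apply: cvg_expr.
  by rewrite ger0_norm// mulr_ge0// addr_ge0.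
have hE : (mu * (p * (1 + mu)) ^+ n)%:E @[n --> \oo] --> (0 : \bar R).
  by apply: cvg_EFin h; exact: nearW.
rewrite -(cvg_lim (@ereal_hausdorff R) hE); apply: lime_ge; first by apply/cvg_ex; eexists; exact: hE.
by apply: nearW => n; exact: survives_le.
Qed.

End subcritical.

(** * The critical parameter *)

Section mean.
Context (R : realType) (disp : measure_display) (Om : measurableType disp)
  (P : probability Om R) (eta : {RV P >-> nat}).
Local Open Scope ereal_scope.

Let mtail i : measurable (eta @^-1` [set k | (i < k)%N]).
Proof. by rewrite -[X in measurable X]setTI; exact: (@measurable_funPT _ _ _ _ eta). Qed.

Lemma sum_ltn_indic (n k : nat) : (\sum_(0 <= i < n) (i < k) = minn n k)%N.
Proof.
elim: n => [|n IH]; first by rewrite big_nil min0n.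
by rewrite big_nat_recr//= IH; case: ltnP => h; lia.
Qed.

(** A natural number counts the [i] below it; sum and integral are exchanged by nonnegativity. *)
Lemma expectation_tail_sum : 'E_P[fun w => (eta w)%:R] =
  \sum_(i <oo) P (eta @^-1` [set k | (i < k)%N]).
Proof.
rewrite unlock; transitivity (\int[P]_w \sum_(i <oo) (\1_(eta @^-1` [set k | (i < k)%N]) w)%:E).
  apply: eq_integral => w _; apply/esym/cvg_lim => //; apply: cvg_near_cst.
  exists (eta w) => // n /= wn; rewrite sumEFin; congr EFin.
  rewrite -[in RHS](minn_idPr wn) -sum_ltn_indic natr_sum; apply: eq_bigr => i _.
  by rewrite indicE; case: ltnP => h; [rewrite mem_set|rewrite memNset//= ltnNge h].
rewrite integral_nneseries//.
  by apply: eq_eseriesr => i _; rewrite integral_indic// setIT.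
by move=> i; apply/measurable_EFinP; exact: measurable_indic.
Qed.

Hypothesis eta_mean : 'E_P[fun w => (eta w)%:R] < +oo.
Let tail i := fine (distribution P eta [set k | (i < k)%N]).
Let mean := fine 'E_P[fun w => (eta w)%:R].

Let mean_fin : 'E_P[fun w => (eta w)%:R] = mean%:E.
Proof. by rewrite fineK// ge0_fin_numE// expectation_ge0. Qed.

Let tailE i : P (eta @^-1` [set k | (i < k)%N]) = (tail i)%:E.
Proof. by rewrite fineK// fin_num_measure. Qed.

Lemma tail_sum_le N : (\sum_(i < N) tail i <= mean)%R.
Proof.
rewrite -lee_fin -mean_fin expectation_tail_sum -sumEFin -(big_mkord xpredT (EFin \o tail)).
under eq_bigr => i _ do rewrite /= -tailE.
by apply: nneseries_lim_ge => i _ _; exact: measure_ge0.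
Qed.

(** The partial sums are means of truncations of [eta]; this supplies the truncation level for
    supercritical [p]. *)
Lemma tail_sum_gt (a : R) : (a < mean)%R -> exists N, (a < \sum_(i < N) tail i)%R.
Proof.
move=> am; apply: contrapT => h.
suff : (mean <= a)%R by rewrite leNgt am.
rewrite -lee_fin -mean_fin expectation_tail_sum.
apply: lime_le; first by apply: is_cvg_nneseries => i _ _; exact: measure_ge0.
apply: nearW => N; under eq_bigr => i _ do rewrite tailE.
rewrite sumEFin lee_fin big_mkord leNgt; apply/negP => aN; apply: h.
by exists N.
Qed.

Lemma mean_gt0 : 0 < P [set w | (1 <= eta w)%N] -> (0 < mean)%R.
Proof.
move=> h; apply: lt_le_trans (tail_sum_le 1); rewrite big_ord_recl big_ord0 addr0.
by rewrite -lte_fin -tailE.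
Qed.
End mean.

Theorem theorem1p8 (R : realType) (disp : measure_display)
    (Om : measurableType disp) (P : probability Om R)
    (eta : {RV P >-> nat})
    (eta_pos : (0 < P [set w | (1 <= eta w)%N])%E)
    (eta_mean : ('E_P[fun w => (eta w)%:R] < +oo)%E) :
  p_c (Zd d) (distribution P eta) @[d --> \oo]
    --> (1 + fine ('E_P[fun w => (eta w)%:R])%E)^-1.
Proof.
set mean := fine _.
have m0 : 0 < mean by exact: mean_gt0.
have m1 : 0 < 1 + mean by rewrite addr_gt0.
pose S d := [set p | 0 <= p <= 1 /\ survives_with_positive_probability (Zd d) p (distribution P eta)].
have lower d p : S d p -> (1 + mean)^-1 <= p.
  move=> [/andP[p0 p1] [disp' [Om' [P' [F [FM]]]]]]; apply: contraTT; rewrite -ltNge => pm.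
  have sub : p * (1 + mean) < 1 by rewrite -ltr_pdivlMr// div1r.
  by rewrite (subcritical_extinction FM p0 (tail_sum_le eta_mean) sub) ltxx.
have upper p : (1 + mean)^-1 < p -> p <= 1 -> \forall d \near \oo, S d p.
  move=> pm p1.
  have p0 : 0 < p by apply: lt_trans pm; rewrite invr_gt0.
  (* With [s] the truncated mean, [p * (1 + s) > 1] means [s > 1 / p - 1], a number below [mean]
     because [p] exceeds the threshold. *)
  have [|N hN] := @tail_sum_gt _ _ _ _ _ eta_mean (p^-1 - 1).
    by rewrite ltrBlDl -[ltRHS]invrK ltf_pV2// posrE invr_gt0.
  have [||D hD] := @supercritical_survival R (distribution P eta) p N.
  - by rewrite p1 ltW.
  - by rewrite mulrC -ltr_pdivrMr// mul1r -ltrBlDl.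
  - by exists D => // d /= Dd; split; [rewrite p1 ltW|exact: hD].
have lt1 : (1 + mean)^-1 < 1 by rewrite invf_lt1// ltrDl.
apply/cvgrPdist_le => e e0.
(* The cap keeps [p] a probability and leaves it above the threshold, which is below [1]. *)
pose p := Num.min 1 ((1 + mean)^-1 + e).
have pm : (1 + mean)^-1 < p by rewrite lt_min lt1 ltrDl.
have p1 : p <= 1 by rewrite ge_min lexx.
near=> d.
have Sd : S d p by near: d; exact: upper.
(* Membership of [p] in [S d] shows that the infimum is over a nonempty set, without which a lower
   bound of the set would not bound it. *)
have h1 : (1 + mean)^-1 <= p_c (Zd d) (distribution P eta).
  by apply: lb_le_inf; [exists p|exact: lower].
have h2 : p_c (Zd d) (distribution P eta) <= p.
  by apply: ge_inf => //; exists (1 + mean)^-1; exact: lower.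
rewrite distrC ger0_norm ?subr_ge0// lerBlDl; apply: le_trans h2 _.
by rewrite ge_min lexx orbT.
Unshelve. all: by end_near.
Qed.
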